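(* Let $\mathrm{Sp}(4,\mathbb{R})$ act on the set $\mathcal{L}_{\omega_{\mathrm{cn}}}(\mathbb{R}^4)$ of Lie brackets on $\mathbb{R}^4$ for which the canonical symplectic form $\omega_{\mathrm{cn}}$ is closed, and order the orbit space $\mathcal{L}_{\omega_{\mathrm{cn}}}(\mathbb{R}^4)/\mathrm{Sp}(4,\mathbb{R})$ by degeneration (an orbit $\mathcal{O}$ degenerates to an orbit $\mathcal{O}'$ if $\mathcal{O}'\subseteq\overline{\mathcal{O}}$). With the notation for the brackets $\mu_i$ given in the context, the Hasse diagram of this partial order (an arrow $\mu\to\lambda$ meaning that $\mathrm{Sp}(4,\mathbb{R})\cdot\mu$ degenerates properly to $\mathrm{Sp}(4,\mathbb{R})\cdot\lambda$ with no orbit strictly in between) consists of exactly the following arrows, for all admissible values of the parameters: 1. $\mu_5(\lambda)\to\mu_{15}$ and $\mu_5(\lambda)\to\mu_2$ for all $\lambda\ge 0$; 2. $\mu_6\to\mu_{15}$; 3. $\mu_{16}\to\mu_{15}$ and $\mu_{16}\to\mu_7$; 4. $\mu_{15}\to\mu_1$; 5. $\mu_{18}\to\mu_{12}(-\tfrac12)$; 6. $\mu_{19}\to\mu_{12}(-\tfrac12)$ and $\mu_{19}\to\mu_{17}$; 7. $\mu_{17}\to\mu_7$; 8. $\mu_{10}\to\mu_7$ and $\mu_{10}\to\mu_{11}(-1)$; 9. $\mu_{11}(-1)\to\mu_1$; 10. $\mu_8\to\mu_7$, $\mu_8\to\mu_2$, $\mu_9\to\mu_7$, $\mu_9\to\mu_2$;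 11. $\mu_{23}\to\mu_{20}(\tfrac12)$, $\mu_{23}\to\mu_7$, $\mu_{24}\to\mu_{20}(\tfrac12)$, $\mu_{24}\to\mu_7$; 12. $\mu_{20}(\tfrac12)\to\mu_1$; 13. $\mu_{20}(\lambda)\to\mu_7$ for all $\lambda>\tfrac12$ with $\lambda\ne 1,2$; 14. $\mu_{21}(\delta)\to\mu_7$ and $\mu_{22}(\delta)\to\mu_7$ for all $\delta>0$; 15. $\mu_{12}(\alpha)\to\mu_7$ for all $-1<\alpha<0$ (including $\alpha=-\tfrac12$); 16. $\mu_{11}(\beta)\to\mu_7$ for all $-1<\beta<1$; 17. $\mu_{13}(\delta)\to\mu_7$ and $\mu_{14}(\delta)\to\mu_7$ for all $\delta>0$; 18. $\mu_3\to\mu_7$ and $\mu_4\to\mu_7$; 19. $\mu_7\to\mu_1$, $\mu_2\to\mu_1$, $\mu_1\to\mu_0$. Thus, for two brackets $\mu,\lambda$ from the list, $\lambda\in\overline{\mathrm{Sp}(4,\mathbb{R})\cdot\mu}\setminus \mathrm{Sp}(4,\mathbb{R})\cdot\mu$ if and only if there is a directed path of length at least one from $\mu$ to $\lambda$ using these arrows (brackets lying in the same $\mathrm{Sp}(4,\mathbb{R})$-orbit being identified).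
   Context: Let $e_1,\dots,e_4$ be the canonical basis of $\mathbb{R}^4$ with dual basis $e_i^*$, and $\omega_{\mathrm{cn}}=e_1^*\wedge e_3^*+e_2^*\wedge e_4^*$. $\mathrm{Sp}(4,\mathbb{R})$ is the group of linear automorphisms of $\mathbb{R}^4$ preserving $\omega_{\mathrm{cn}}$. $\mathcal{L}_{\omega_{\mathrm{cn}}}(\mathbb{R}^4)$ is the set of Lie brackets $\mu$ on $\mathbb{R}^4$ (alternating bilinear maps satisfying the Jacobi identity) with $\omega_{\mathrm{cn}}(\mu(x,y),z)+\omega_{\mathrm{cn}}(\mu(y,z),x)+\omega_{\mathrm{cn}}(\mu(z,x),y)=0$ for all $x,y,z$. The group acts by $(g\cdot\mu)(x,y)=g\,\mu(g^{-1}x,g^{-1}y)$. Closures are taken in the usual Hausdorff vector space topology. Degeneration of $\mu$ to $\lambda$ means $\lambda\in\overline{\mathrm{Sp}(4,\mathbb{R})\cdot\mu}$; it is proper if $\lambda\notin\mathrm{Sp}(4,\mathbb{R})\cdot\mu$. Degeneration induces a partial order on the orbit space. By Ovando's classification, every $\mu\in\mathcal{L}_{\omega_{\mathrm{cn}}}(\mathbb{R}^4)$ lies in the $\mathrm{Sp}(4,\mathbb{R})$-orbit of one of the following brackets (only nonzero brackets of basis vectors, up to skew-symmetry, are listed; the name of the corresponding symplectic Lie algebra is in parentheses): $\mu_0$ ($\mathfrak{a}_4$): abelian. $\mu_1$ ($\mathfrak{rh}_3$): $[e_1,e_2]=e_3$. $\mu_2$ ($\mathfrak{rr}_{3,0}$):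 $[e_1,e_3]=e_3$. $\mu_3$ ($\mathfrak{rr}_{3,-1}$): $[e_1,e_2]=-e_2$, $[e_1,e_4]=e_4$. $\mu_4$ ($\mathfrak{rr}'_{3,0}$): $[e_1,e_2]=e_4$, $[e_1,e_4]=-e_2$. $\mu_5(\lambda)$, $\lambda\ge0$ ($\mathfrak{r}_2\mathfrak{r}_2,\omega_\lambda$): $[e_1,e_2]=-\lambda e_3$, $[e_1,e_3]=e_3$, $[e_2,e_4]=e_4$. $\mu_6$ ($\mathfrak{r}'_2$): $[e_1,e_3]=e_3$, $[e_1,e_4]=e_4$, $[e_2,e_3]=-e_4$, $[e_2,e_4]=e_3$. $\mu_7$ ($\mathfrak{n}_4$): $[e_1,e_2]=e_4$, $[e_1,e_4]=e_3$. $\mu_8$ ($\mathfrak{r}_{4,0},\omega_+$): $[e_1,e_3]=e_3$, $[e_1,e_4]=e_2$. $\mu_9$ ($\mathfrak{r}_{4,0},\omega_-$): $[e_1,e_3]=e_3$, $[e_1,e_4]=-e_2$. $\mu_{10}$ ($\mathfrak{r}_{4,-1}$): $[e_1,e_2]=e_2$, $[e_1,e_3]=-e_3$, $[e_1,e_4]=-e_3-e_4$. $\mu_{11}(\beta)$, $-1\le\beta<1$ ($\mathfrak{r}_{4,-1,\beta}$): $[e_1,e_2]=-e_2$, $[e_1,e_3]=\beta e_3$, $[e_1,e_4]=e_4$. $\mu_{12}(\alpha)$, $-1<\alpha<0$ ($\mathfrak{r}_{4,\alpha,-\alpha}$): $[e_1,e_2]=-e_2$, $[e_1,e_3]=-\frac1\alpha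 e_3$, $[e_1,e_4]=e_4$. $\mu_{13}(\delta)$, $\delta>0$ ($\mathfrak{r}'_{4,0,\delta},\omega_+$): $[e_1,e_2]=-\delta e_4$, $[e_1,e_3]=e_3$, $[e_1,e_4]=\delta e_2$. $\mu_{14}(\delta)$, $\delta>0$ ($\mathfrak{r}'_{4,0,\delta},\omega_-$): $[e_1,e_2]=\delta e_4$, $[e_1,e_3]=e_3$, $[e_1,e_4]=-\delta e_2$. $\mu_{15}$ ($\mathfrak{d}_{4,1},\omega_1$): $[e_1,e_2]=e_2$, $[e_1,e_3]=e_3$, $[e_2,e_4]=e_3$. $\mu_{16}$ ($\mathfrak{d}_{4,1},\omega_2$): $[e_1,e_2]=e_2$, $[e_1,e_3]=e_3$, $[e_1,e_4]=e_3$, $[e_2,e_4]=e_3$. $\mu_{17}$ ($\mathfrak{d}_{4,2},\omega_1$): $[e_1,e_2]=2e_2$, $[e_1,e_3]=e_3$, $[e_1,e_4]=-e_4$, $[e_2,e_4]=e_3$. $\mu_{18}$ ($\mathfrak{d}_{4,2},\omega_2$): $[e_1,e_2]=-e_2$, $[e_1,e_3]=2e_3$, $[e_1,e_4]=e_4$, $[e_2,e_3]=e_4$. $\mu_{19}$ ($\mathfrak{d}_{4,2},\omega_3$): $[e_1,e_2]=-e_2$, $[e_1,e_3]=2e_3$, $[e_1,e_4]=e_4$, $[e_2,e_3]=-e_4$. $\mu_{20}(\lambda)$, $\lambda\ge\frac12$, $\lambda\ne1,2$ ($\mathfrak{d}_{4,\lambda}$): $[e_1,e_2]=\lambda e_2$,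 $[e_1,e_3]=e_3$, $[e_1,e_4]=(1-\lambda)e_4$, $[e_2,e_4]=e_3$. $\mu_{21}(\delta)$, $\delta>0$ ($\mathfrak{d}'_{4,\delta},\omega_+$): $[e_1,e_2]=\frac12\delta e_2-e_4$, $[e_1,e_3]=\delta e_3$, $[e_1,e_4]=e_2+\frac12\delta e_4$, $[e_2,e_4]=\delta e_3$. $\mu_{22}(\delta)$, $\delta>0$ ($\mathfrak{d}'_{4,\delta},\omega_-$): $[e_1,e_2]=-\frac12\delta e_2-e_4$, $[e_1,e_3]=-\delta e_3$, $[e_1,e_4]=e_2-\frac12\delta e_4$, $[e_2,e_4]=-\delta e_3$. $\mu_{23}$ ($\mathfrak{h}_4,\omega_+$): $[e_1,e_2]=\frac12e_2$, $[e_1,e_3]=e_3$, $[e_1,e_4]=e_2+\frac12e_4$, $[e_2,e_4]=e_3$. $\mu_{24}$ ($\mathfrak{h}_4,\omega_-$): $[e_1,e_2]=\frac12e_2$, $[e_1,e_3]=e_3$, $[e_1,e_4]=-e_2+\frac12e_4$, $[e_2,e_4]=e_3$.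
   Formalization: The Hasse arrows are characterized only for source orbits in the list (targets and in-between orbits are arbitrary), because the quoted classification misses brackets such as μ_6 with the extra bracket [e1,e2]=k e3, k≠0, whose orbits also degenerate properly. *)

(* Defs.v *)
(* MathComp-Analysis; the real numbers are an arbitrary realType R. *)
From HB Require Import structures.
From mathcomp Require Import all_boot all_order all_algebra.
From mathcomp Require Import all_classical all_reals all_analysis.
From Stdlib Require Import Relation_Operators.

Set Implicit Arguments.
Unset Strict Implicit.
Unset Printing Implicit Defensive.

Import Order.TTheory GRing.Theory Num.Theory.
Import numFieldNormedType.Exports.

Local Open Scope classical_set_scope.
Local Open Scope ring_scope.

(* Basis indices are numbered 1, ..., 4 below, whereas 'I_4 is {0, ..., 3}. *)
Definition idx (i : nat) : 'I_4 := inord i.-1.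

Definition e {R : realType} (i : nat) : 'cV[R]_4 := delta_mx (idx i) 0.
Arguments e {R} i%_N.

Definition wedge_dual {R : realType} (i j : nat) (x y : 'cV[R]_4) : R :=
  x (idx i) 0 * y (idx j) 0 - x (idx j) 0 * y (idx i) 0.
Arguments wedge_dual {R} (i j)%_N x y.

Definition omega_cn {R : realType} (x y : 'cV[R]_4) : R :=
  wedge_dual 1 3 x y + wedge_dual 2 4 x y.

(* A bilinear map R^4 x R^4 -> R^4 is encoded by its structure constants: the
   entry (i, j) is the value on the pair of basis vectors (e_i, e_j).  The
   library topology on 'M['cV[R]_4]_4 is the product topology, i.e. the
   Hausdorff vector space topology of this 64-dimensional space. *)
Notation bilin R := 'M['cV[R]_4]_4.

Definition br {R : realType} (mu : bilin R) (x y : 'cV[R]_4) : 'cV[R]_4 :=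
  \sum_(i < 4) \sum_(j < 4) (x i 0 * y j 0) *: mu i j.

Definition lie_bracket {R : realType} (mu : bilin R) : Prop :=
  (forall x, br mu x x = 0) /\
  (forall x y z,
     br mu x (br mu y z) + br mu y (br mu z x) + br mu z (br mu x y) = 0).

Definition omega_closed {R : realType} (mu : bilin R) : Prop :=
  forall x y z, omega_cn (br mu x y) z + omega_cn (br mu y z) x
                + omega_cn (br mu z x) y = 0.

Definition L_omega (R : realType) : set (bilin R) :=
  [set mu | lie_bracket mu /\ omega_closed mu].
Arguments L_omega : clear implicits.

Definition Sp4 (R : realType) : set 'M[R]_4 :=
  [set g | g \in unitmx /\
           forall x y, omega_cn (g *m x) (g *m y) = omega_cn x y].
Arguments Sp4 : clear implicits.

Definition act {R : realType} (g : 'M[R]_4) (mu : bilin R) : bilin R :=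
  \matrix_(i < 4, j < 4)
    (g *m br mu (invmx g *m delta_mx i 0) (invmx g *m delta_mx j 0)).

Definition orb {R : realType} (mu : bilin R) : set (bilin R) :=
  [set act g mu | g in Sp4 R].

Definition orbit_space (R : realType) : set (set (bilin R)) :=
  [set orb mu | mu in L_omega R].
Arguments orbit_space : clear implicits.

Definition orbit_degen {R : realType} (O O' : set (bilin R)) : Prop :=
  O' `<=` closure O.

Definition orbit_proper_degen {R : realType} (O O' : set (bilin R)) : Prop :=
  orbit_degen O O' /\ O' <> O.

Definition hasse_arrow {R : realType} (O O' : set (bilin R)) : Prop :=
  orbit_proper_degen O O' /\
  ~ (exists P, [/\ orbit_space R P, orbit_proper_degen O P
                 & orbit_proper_degen P O']).

(* The alternating bilinear map with [e_i, e_j] = v = - [e_j, e_i] and all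
   other brackets of basis vectors zero (for i <> j). *)
Definition lb {R : realType} (i j : nat) (v : 'cV[R]_4) : bilin R :=
  \matrix_(k < 4, l < 4)
    (if (k == idx i) && (l == idx j) then v
     else if (k == idx j) && (l == idx i) then - v else 0).
Arguments lb {R} (i j)%_N v.

Inductive label (R : Type) : Type :=
| mu0 | mu1 | mu2 | mu3 | mu4
| mu5 (lambda : R)
| mu6 | mu7 | mu8 | mu9 | mu10
| mu11 (beta : R)
| mu12 (alpha : R)
| mu13 (delta : R)
| mu14 (delta : R)
| mu15 | mu16 | mu17 | mu18 | mu19
| mu20 (lambda : R)
| mu21 (delta : R)
| mu22 (delta : R)
| mu23 | mu24.

Arguments mu0 {R}.
Arguments mu1 {R}.
Arguments mu2 {R}.
Arguments mu3 {R}.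
Arguments mu4 {R}.
Arguments mu6 {R}.
Arguments mu7 {R}.
Arguments mu8 {R}.
Arguments mu9 {R}.
Arguments mu10 {R}.
Arguments mu15 {R}.
Arguments mu16 {R}.
Arguments mu17 {R}.
Arguments mu18 {R}.
Arguments mu19 {R}.
Arguments mu23 {R}.
Arguments mu24 {R}.

Definition admissible {R : realType} (a : label R) : Prop :=
  match a with
  | mu5 l => 0 <= l
  | mu11 b => -1 <= b < 1
  | mu12 a => -1 < a < 0
  | mu13 d | mu14 d | mu21 d | mu22 d => 0 < d
  | mu20 l => [/\ 2^-1 <= l, l <> 1 & l <> 2]
  | _ => True
  end.

Definition bracket_of {R : realType} (a : label R) : bilin R :=
  match a with
  | mu0 => 0
  | mu1 => lb 1 2 (e 3)
  | mu2 => lb 1 3 (e 3)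
  | mu3 => lb 1 2 (- e 2) + lb 1 4 (e 4)
  | mu4 => lb 1 2 (e 4) + lb 1 4 (- e 2)
  | mu5 l => lb 1 2 (- l *: e 3) + lb 1 3 (e 3) + lb 2 4 (e 4)
  | mu6 => lb 1 3 (e 3) + lb 1 4 (e 4) + lb 2 3 (- e 4) + lb 2 4 (e 3)
  | mu7 => lb 1 2 (e 4) + lb 1 4 (e 3)
  | mu8 => lb 1 3 (e 3) + lb 1 4 (e 2)
  | mu9 => lb 1 3 (e 3) + lb 1 4 (- e 2)
  | mu10 => lb 1 2 (e 2) + lb 1 3 (- e 3) + lb 1 4 (- e 3 - e 4)
  | mu11 b => lb 1 2 (- e 2) + lb 1 3 (b *: e 3) + lb 1 4 (e 4)
  | mu12 a => lb 1 2 (- e 2) + lb 1 3 (- a^-1 *: e 3) + lb 1 4 (e 4)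
  | mu13 d => lb 1 2 (- d *: e 4) + lb 1 3 (e 3) + lb 1 4 (d *: e 2)
  | mu14 d => lb 1 2 (d *: e 4) + lb 1 3 (e 3) + lb 1 4 (- d *: e 2)
  | mu15 => lb 1 2 (e 2) + lb 1 3 (e 3) + lb 2 4 (e 3)
  | mu16 => lb 1 2 (e 2) + lb 1 3 (e 3) + lb 1 4 (e 3) + lb 2 4 (e 3)
  | mu17 => lb 1 2 (2 *: e 2) + lb 1 3 (e 3) + lb 1 4 (- e 4) + lb 2 4 (e 3)
  | mu18 => lb 1 2 (- e 2) + lb 1 3 (2 *: e 3) + lb 1 4 (e 4) + lb 2 3 (e 4)
  | mu19 => lb 1 2 (- e 2) + lb 1 3 (2 *: e 3) + lb 1 4 (e 4) + lb 2 3 (- e 4)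
  | mu20 l =>
      lb 1 2 (l *: e 2) + lb 1 3 (e 3) + lb 1 4 ((1 - l) *: e 4) + lb 2 4 (e 3)
  | mu21 d =>
      lb 1 2 ((d / 2) *: e 2 - e 4) + lb 1 3 (d *: e 3)
      + lb 1 4 (e 2 + (d / 2) *: e 4) + lb 2 4 (d *: e 3)
  | mu22 d =>
      lb 1 2 (- (d / 2) *: e 2 - e 4) + lb 1 3 (- d *: e 3)
      + lb 1 4 (e 2 - (d / 2) *: e 4) + lb 2 4 (- d *: e 3)
  | mu23 =>
      lb 1 2 (2^-1 *: e 2) + lb 1 3 (e 3) + lb 1 4 (e 2 + 2^-1 *: e 4)
      + lb 2 4 (e 3)
  | mu24 =>
      lb 1 2 (2^-1 *: e 2) + lb 1 3 (e 3) + lb 1 4 (- e 2 + 2^-1 *: e 4)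
      + lb 2 4 (e 3)
  end.

Inductive arrow {R : realType} : label R -> label R -> Prop :=
| arrow_5_15 l of 0 <= l : arrow (mu5 l) mu15
| arrow_5_2 l of 0 <= l : arrow (mu5 l) mu2
| arrow_6_15 : arrow mu6 mu15
| arrow_16_15 : arrow mu16 mu15
| arrow_16_7 : arrow mu16 mu7
| arrow_15_1 : arrow mu15 mu1
| arrow_18_12 : arrow mu18 (mu12 (- 2^-1))
| arrow_19_12 : arrow mu19 (mu12 (- 2^-1))
| arrow_19_17 : arrow mu19 mu17
| arrow_17_7 : arrow mu17 mu7
| arrow_10_7 : arrow mu10 mu7
| arrow_10_11 : arrow mu10 (mu11 (-1))
| arrow_11_1 : arrow (mu11 (-1)) mu1
| arrow_8_7 : arrow mu8 mu7
| arrow_8_2 : arrow mu8 mu2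
| arrow_9_7 : arrow mu9 mu7
| arrow_9_2 : arrow mu9 mu2
| arrow_23_20 : arrow mu23 (mu20 2^-1)
| arrow_23_7 : arrow mu23 mu7
| arrow_24_20 : arrow mu24 (mu20 2^-1)
| arrow_24_7 : arrow mu24 mu7
| arrow_20_1 : arrow (mu20 2^-1) mu1
| arrow_20_7 l of 2^-1 < l & l <> 1 & l <> 2 : arrow (mu20 l) mu7
| arrow_21_7 d of 0 < d : arrow (mu21 d) mu7
| arrow_22_7 d of 0 < d : arrow (mu22 d) mu7
| arrow_12_7 a of -1 < a < 0 : arrow (mu12 a) mu7
| arrow_11_7 b of -1 < b < 1 : arrow (mu11 b) mu7
| arrow_13_7 d of 0 < d : arrow (mu13 d) mu7
| arrow_14_7 d of 0 < d : arrow (mu14 d) mu7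
| arrow_3_7 : arrow mu3 mu7
| arrow_4_7 : arrow mu4 mu7
| arrow_7_1 : arrow mu7 mu1
| arrow_2_1 : arrow mu2 mu1
| arrow_1_0 : arrow mu1 mu0.

(* The labelling is not injective on orbits, e.g. bracket_of mu3 =
   bracket_of (mu11 0) and mu11 b, mu11 (- b) name the same orbit; the listed
   arrows are therefore read between orbits. *)
Definition listed_arrow {R : realType} (O O' : set (bilin R)) : Prop :=
  exists a b : label R,
    [/\ arrow a b, O = orb (bracket_of a) & O' = orb (bracket_of b)].

Definition listed_path {R : realType} :
    set (bilin R) -> set (bilin R) -> Prop :=
  clos_trans (set (bilin R)) listed_arrow.

(* Main.v *)
(** Call a relation between a bracket [nu] and two vectors [u], [v] good when it is
    closed and Sp(4)-invariant.  The orthonormal frames of Lagrangian planes form a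
    compact set, so if every bracket of an orbit satisfies a good relation in some
    such frame, then so does every limit of the orbit, and by invariance the frame
    may then be moved to [(e3, e4)].  The relations used prescribe how [ad] acts on a
    line or a flag in terms of its trace, the ratio of [tr (ad x)^2] to
    [(tr ad x)^2], the cubic form [cubic], and the signs separating [omega_+] from
    [omega_-].  They leave a few structure constants free, and a direct normalisation
    puts every such limit in the orbit of a listed bracket reachable along the
    arrows, so Ovando's classification is not needed.  Conversely each arrow is
    realised by a curve of structure constants.  Finally an invariant [level] drops
    by exactly one along each arrow, so no arrow factors through another orbit and no
    degeneration is reversed. *)

Require Import Defs.
From HB Require Import structures.
From mathcomp Require Import all_boot all_order all_algebra.
From mathcomp Require Import all_classical all_reals all_analysis.
From mathcomp Require Import ring lra.
From Stdlib Require Import Relation_Operators.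

Set Implicit Arguments.
Unset Strict Implicit.
Unset Printing Implicit Defensive.

Import Order.TTheory GRing.Theory Num.Theory.
Import numFieldNormedType.Exports.

Local Open Scope classical_set_scope.
Local Open Scope ring_scope.

(** * Coordinates *)

Section Coordinates.
Variable R : realType.
Implicit Types (mu nu : bilin R) (g h : 'M[R]_4) (x y z : 'cV[R]_4).

(** Except for [mu5], [mu6], [mu18] and [mu19], all labels share one shape: [e1] acts on [e3] by [s]
    and on [<e2, e4>] modulo [e3] by a 2x2 matrix M with entries [a], [b], [c], [d], while [[e2, e4]
    = (a + d) e3]. Jacobi reduces to [(a + d) (s - (a + d)) = 0], which explains the two weights [1]
    and [1/2] of [rel_line] in the proof. Symplectic maps of [<e2, e4>] conjugate M by SL2, not GL2.
    Over the reals the parabolic and elliptic classes then split in two, and this produces the pairs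
    [omega_+], [omega_-]. The [e3]-components [w2], [w4] of [[e1, e2]] and [[e1, e4]] can be
    translated away unless [s - (a + d)] is an eigenvalue of M. In the resonant cases one matrix
    carries several orbits: [mu11 (-1)] and [mu10], [mu15] and [mu16], and for nonzero nilpotent M
    with [s = 0], [mu1] and [mu7]. Traces cannot separate these, hence [rel_dilation], [rel_cubic]
    and [rel_two_step]. *)

Lemma all4 (P : 'I_4 -> Prop) :
  P (idx 1) -> P (idx 2) -> P (idx 3) -> P (idx 4) -> forall i, P i.
Proof.
move=> P1 P2 P3 P4 [[|[|[|[|//]]]] Hi].
- by rewrite (_ : Ordinal Hi = idx 1) //; apply: val_inj; rewrite /= inordK.
- by rewrite (_ : Ordinal Hi = idx 2) //; apply: val_inj; rewrite /= inordK.
- by rewrite (_ : Ordinal Hi = idx 3) //; apply: val_inj; rewrite /= inordK.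
- by rewrite (_ : Ordinal Hi = idx 4) //; apply: val_inj; rewrite /= inordK.
Qed.

Lemma sum4 (V : nmodType) (F : 'I_4 -> V) :
  \sum_(i < 4) F i = F (idx 1) + F (idx 2) + F (idx 3) + F (idx 4).
Proof.
rewrite !big_ord_recr big_ord0 /= add0r.
by congr (_ + _ + _ + _); congr F; apply: val_inj; rewrite /= inordK.
Qed.

Lemma idx_eq (i j : nat) :
  (0 < i < 5)%N -> (0 < j < 5)%N -> (idx i == idx j) = (i == j).
Proof.
case: i => // i; case: j => // j /= Hi Hj.
by rewrite -val_eqE /= !inordK.
Qed.

Definition vec (a b c d : R) : 'cV[R]_4 := \col_i nth 0 [:: a; b; c; d] i.

Lemma vec1 a b c d : vec a b c d (idx 1) 0 = a.
Proof. by rewrite mxE inordK. Qed.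
Lemma vec2 a b c d : vec a b c d (idx 2) 0 = b.
Proof. by rewrite mxE inordK. Qed.
Lemma vec3 a b c d : vec a b c d (idx 3) 0 = c.
Proof. by rewrite mxE inordK. Qed.
Lemma vec4 a b c d : vec a b c d (idx 4) 0 = d.
Proof. by rewrite mxE inordK. Qed.

Definition vecE := (vec1, vec2, vec3, vec4).

Lemma colP4 x y : x (idx 1) 0 = y (idx 1) 0 -> x (idx 2) 0 = y (idx 2) 0 ->
  x (idx 3) 0 = y (idx 3) 0 -> x (idx 4) 0 = y (idx 4) 0 -> x = y.
Proof. by move=> h1 h2 h3 h4; apply/colP; apply: all4. Qed.

Lemma vec_eta x : x = vec (x (idx 1) 0) (x (idx 2) 0) (x (idx 3) 0) (x (idx 4) 0).
Proof. by apply: colP4; rewrite vecE. Qed.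

Lemma vec_inj a b c d a' b' c' d' : vec a b c d = vec a' b' c' d' ->
  [/\ a = a', b = b', c = c' & d = d'].
Proof.
move=> h; have H i := congr1 (fun v : 'cV[R]_4 => v i 0) h.
by move: (H (idx 1)) (H (idx 2)) (H (idx 3)) (H (idx 4)); rewrite !vecE.
Qed.

Lemma vecD a b c d a' b' c' d' :
  vec a b c d + vec a' b' c' d' = vec (a + a') (b + b') (c + c') (d + d').
Proof. by apply: colP4; rewrite mxE !vecE. Qed.

Lemma vecZ l a b c d : l *: vec a b c d = vec (l * a) (l * b) (l * c) (l * d).
Proof. by apply: colP4; rewrite mxE !vecE. Qed.

Lemma vecN a b c d : - vec a b c d = vec (- a) (- b) (- c) (- d).
Proof. by apply: colP4; rewrite mxE !vecE. Qed.

Lemma vec0 : 0 = vec 0 0 0 0.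
Proof. by apply: colP4; rewrite mxE !vecE. Qed.

Lemma e1E : e 1 = vec 1 0 0 0.
Proof. by apply: colP4; rewrite mxE !vecE /= ?idx_eq. Qed.
Lemma e2E : e 2 = vec 0 1 0 0.
Proof. by apply: colP4; rewrite mxE !vecE /= ?idx_eq. Qed.
Lemma e3E : e 3 = vec 0 0 1 0.
Proof. by apply: colP4; rewrite mxE !vecE /= ?idx_eq. Qed.
Lemma e4E : e 4 = vec 0 0 0 1.
Proof. by apply: colP4; rewrite mxE !vecE /= ?idx_eq. Qed.

Definition eE := (e1E, e2E, e3E, e4E).

Lemma omegaE a b c d a' b' c' d' : omega_cn (vec a b c d) (vec a' b' c' d') =
  a * c' - c * a' + (b * d' - d * b').
Proof. by rewrite /omega_cn /wedge_dual !vecE. Qed.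

Lemma brDl mu x y z : br mu (x + y) z = br mu x z + br mu y z.
Proof.
rewrite /br -big_split; apply: eq_bigr => i _ /=.
rewrite -big_split; apply: eq_bigr => j _ /=.
by rewrite mxE mulrDl scalerDl.
Qed.

Lemma brDr mu x y z : br mu z (x + y) = br mu z x + br mu z y.
Proof.
rewrite /br -big_split; apply: eq_bigr => i _ /=.
rewrite -big_split; apply: eq_bigr => j _ /=.
by rewrite mxE mulrDr scalerDl.
Qed.

Lemma brZl mu (l : R) x y : br mu (l *: x) y = l *: br mu x y.
Proof.
rewrite /br scaler_sumr; apply: eq_bigr => i _.
by rewrite scaler_sumr; apply: eq_bigr => j _; rewrite mxE scalerA mulrA.
Qed.

Lemma brZr mu (l : R) x y : br mu y (l *: x) = l *: br mu y x.
Proof.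
rewrite /br scaler_sumr; apply: eq_bigr => i _.
by rewrite scaler_sumr; apply: eq_bigr => j _; rewrite mxE scalerA mulrCA.
Qed.

Lemma br0l mu x : br mu 0 x = 0.
Proof. by rewrite -(scale0r 0) brZl !scale0r. Qed.

Lemma br0r mu x : br mu x 0 = 0.
Proof. by rewrite -(scale0r 0) brZr !scale0r. Qed.

Lemma br_sumr mu x (I : Type) (r : seq I) (P : pred I)
    (F : I -> 'cV[R]_4) :
  br mu x (\sum_(i <- r | P i) F i) = \sum_(i <- r | P i) br mu x (F i).
Proof. by apply: (big_morph (br mu x)) => [y z|]; rewrite ?br0r ?brDr. Qed.

Lemma br_suml mu x (I : Type) (r : seq I) (P : pred I)
    (F : I -> 'cV[R]_4) :
  br mu (\sum_(i <- r | P i) F i) x = \sum_(i <- r | P i) br mu (F i) x.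
Proof. by apply: (big_morph (br mu ^~ x)) => [y z|]; rewrite ?br0l ?brDl. Qed.

Lemma br_add mu nu x y : br (mu + nu) x y = br mu x y + br nu x y.
Proof.
rewrite /br -big_split; apply: eq_bigr => i _ /=.
rewrite -big_split; apply: eq_bigr => j _ /=.
by rewrite mxE scalerDr.
Qed.

Lemma br_delta mu i j : br mu (delta_mx i 0) (delta_mx j 0) = mu i j.
Proof.
rewrite /br (bigD1 i) //= (bigD1 j) //= !mxE !eqxx mulr1 scale1r.
rewrite !big1 ?addr0 // => [i' ni|j' nj]; last first.
  by rewrite mxE (negPf nj) mulr0 scale0r.
by apply: big1 => j' _; rewrite mxE (negPf ni) mul0r scale0r.
Qed.

Lemma col_sum_delta x : x = \sum_i x i 0 *: delta_mx i 0.
Proof.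
rewrite {1}(matrix_sum_delta x); apply: eq_bigr => i _.
by rewrite big_ord1.
Qed.

Lemma br_ext mu nu : (forall x y, br mu x y = br nu x y) -> mu = nu.
Proof. by move=> h; apply/matrixP => i j; rewrite -!br_delta h. Qed.

Lemma br_lb i j v x y : (0 < i < 5)%N -> (0 < j < 5)%N -> i != j ->
  br (lb i j v) x y = wedge_dual i j x y *: v.
Proof.
move=> Hi Hj nij; have nij' : idx i != idx j by rewrite idx_eq.
have E (k l : 'I_4) : lb i j v k l =
   (((k == idx i) && (l == idx j))%:R - ((k == idx j) && (l == idx i))%:R) *: v.
  rewrite mxE; case: eqP => [->|_] /=.
    rewrite (negPf nij') /= subr0; case: eqP => _ /=; first by rewrite scale1r.
    by rewrite scale0r.
  rewrite sub0r; case: ifP => _; rewrite ?scaleN1r ?oppr0 ?scale0r //.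
rewrite /br; under eq_bigr => k _ do under eq_bigr => l _ do rewrite E scalerA.
under eq_bigr => k _ do rewrite -scaler_suml.
rewrite -scaler_suml; congr (_ *: _); rewrite /wedge_dual.
transitivity (\sum_k \sum_l ((x k 0 * (k == idx i)%:R) * (y l 0 * (l == idx j)%:R)
   - (x k 0 * (k == idx j)%:R) * (y l 0 * (l == idx i)%:R))).
  apply: eq_bigr => k _; apply: eq_bigr => l _.
  by rewrite -!mulnb !natrM; ring.
have S (z : 'cV[R]_4) n : \sum_k (z k 0 * (k == idx n)%:R) = z (idx n) 0.
  rewrite (bigD1 (idx n)) //= eqxx mulr1 big1 ?addr0 // => k /negPf ->.
  by rewrite mulr0.
under eq_bigr => k _ do rewrite sumrB -!mulr_sumr !S.
by rewrite sumrB -!mulr_suml !S.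
Qed.

Definition mk (v12 v13 v14 v23 v24 v34 : 'cV[R]_4) : bilin R :=
  lb 1 2 v12 + lb 1 3 v13 + lb 1 4 v14 + lb 2 3 v23 + lb 2 4 v24 + lb 3 4 v34.

Lemma br_mk v12 v13 v14 v23 v24 v34 x y : br (mk v12 v13 v14 v23 v24 v34) x y =
  wedge_dual 1 2 x y *: v12 + wedge_dual 1 3 x y *: v13
  + wedge_dual 1 4 x y *: v14 + wedge_dual 2 3 x y *: v23
  + wedge_dual 2 4 x y *: v24 + wedge_dual 3 4 x y *: v34.
Proof. by rewrite /mk !br_add !br_lb. Qed.

Definition alt_bracket mu := forall x, br mu x x = 0.

Lemma alt_br mu x y : alt_bracket mu -> br mu x y = - br mu y x.
Proof.
move=> h; have := h (x + y); rewrite brDl !brDr !h add0r addr0 => /eqP.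
by rewrite addr_eq0 => /eqP.
Qed.

Lemma alt_basis mu (g1 g2 g3 g4 : 'cV[R]_4) (a b c d a' b' c' d' : R) :
  alt_bracket mu ->
  br mu (a *: g1 + b *: g2 + c *: g3 + d *: g4)
        (a' *: g1 + b' *: g2 + c' *: g3 + d' *: g4) =
  (a * b' - b * a') *: br mu g1 g2 + (a * c' - c * a') *: br mu g1 g3
  + (a * d' - d * a') *: br mu g1 g4 + (b * c' - c * b') *: br mu g2 g3
  + (b * d' - d * b') *: br mu g2 g4 + (c * d' - d * c') *: br mu g3 g4.
Proof.
move=> h; rewrite !(brDl, brDr) !(brZl, brZr).
rewrite (alt_br g2 g1) // (alt_br g3 g1) // (alt_br g4 g1) //.
rewrite (alt_br g3 g2) // (alt_br g4 g2) // (alt_br g4 g3) // !h.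
move: (br mu g1 g2) (br mu g1 g3) (br mu g1 g4) (br mu g2 g3) (br mu g2 g4) (br mu g3 g4).
by move=> u1 u2 u3 u4 u5 u6; apply: colP4; rewrite !mxE; ring.
Qed.

Lemma mk_eta mu : alt_bracket mu ->
  mu = mk (br mu (e 1) (e 2)) (br mu (e 1) (e 3)) (br mu (e 1) (e 4))
          (br mu (e 2) (e 3)) (br mu (e 2) (e 4)) (br mu (e 3) (e 4)).
Proof.
move=> h; apply: br_ext => x y; rewrite br_mk.
by rewrite {1}(col_sum_delta x) {1}(col_sum_delta y) !sum4 alt_basis.
Qed.

End Coordinates.

(** * The symplectic action *)

Section Action.
Variable R : realType.
Implicit Types (mu nu : bilin R) (g h : 'M[R]_4) (x y z : 'cV[R]_4).

Lemma br_act mu g x y :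
  br (act g mu) x y = g *m br mu (invmx g *m x) (invmx g *m y).
Proof.
have E z : invmx g *m z = \sum_i z i 0 *: (invmx g *m delta_mx i 0).
  rewrite {1}(col_sum_delta z) mulmx_sumr.
  by apply: eq_bigr => i _; rewrite -scalemxAr.
rewrite (E x) (E y) br_suml [RHS]mulmx_sumr; apply: eq_bigr => i _.
rewrite br_sumr [RHS]mulmx_sumr; apply: eq_bigr => j _.
by rewrite mxE brZl brZr scalerA -scalemxAr.
Qed.

Lemma br_actM mu g x y : g \in unitmx ->
  br (act g mu) (g *m x) (g *m y) = g *m br mu x y.
Proof. by move=> gU; rewrite br_act !mulKmx. Qed.

Lemma actP mu nu g : g \in unitmx ->
  (forall x y, br nu (g *m x) (g *m y) = g *m br mu x y) -> nu = act g mu.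
Proof.
move=> gU h; apply: br_ext => x y; rewrite br_act -h !mulKVmx //.
Qed.

Lemma act1 mu : act 1%:M mu = mu.
Proof. by apply/esym/actP => [|x y]; rewrite ?unitmx1 ?mul1mx. Qed.

Lemma actM mu g h : g \in unitmx -> h \in unitmx ->
  act (g *m h) mu = act g (act h mu).
Proof.
move=> gU hU; apply/esym/actP => [|x y]; first by rewrite unitmx_mul gU.
by rewrite -!mulmxA !br_actM.
Qed.

Lemma Sp4_1 : Sp4 R 1%:M.
Proof. by split=> [|x y]; rewrite ?unitmx1 ?mul1mx. Qed.

Lemma Sp4_M g h : Sp4 R g -> Sp4 R h -> Sp4 R (g *m h).
Proof.
move=> [gU gP] [hU hP]; split=> [|x y]; first by rewrite unitmx_mul gU.
by rewrite -!mulmxA gP hP.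
Qed.

Lemma Sp4_V g : Sp4 R g -> Sp4 R (invmx g).
Proof.
move=> [gU gP]; split=> [|x y]; first by rewrite unitmx_inv.
by rewrite -gP !mulKVmx.
Qed.

Lemma orb_refl mu : orb mu mu.
Proof. by exists 1%:M; [exact: Sp4_1|rewrite act1]. Qed.

Lemma orb_sym mu nu : orb mu nu -> orb nu mu.
Proof.
move=> [g gS <-]; exists (invmx g); first exact: Sp4_V.
by case: gS => gU _; rewrite -actM ?unitmx_inv // mulVmx // act1.
Qed.

Lemma orb_trans nu mu la : orb mu nu -> orb nu la -> orb mu la.
Proof.
move=> [g gS <-] [h hS <-]; exists (h *m g); first exact: Sp4_M.
by case: gS hS => gU _ [hU _]; rewrite actM.
Qed.

Lemma orb_eq mu nu : orb mu nu -> orb mu = orb nu.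
Proof.
move=> h; apply/seteqP; split=> la hla; last exact: orb_trans hla.
by apply: orb_trans hla; apply: orb_sym.
Qed.

Lemma orb_act mu g : Sp4 R g -> orb mu (act g mu).
Proof. by move=> gS; exists g. Qed.

Lemma L_omega_act mu g : Sp4 R g -> L_omega R mu -> L_omega R (act g mu).
Proof.
move=> [gU gP] [[h1 h2] h3]; have E x : x = g *m (invmx g *m x) by rewrite mulKVmx.
split; first split.
- by move=> x; rewrite (E x) br_actM // h1 mulmx0.
- move=> x y z; rewrite (E x) (E y) (E z) !br_actM // -!mulmxDr.
  by rewrite h2 mulmx0.
- by move=> x y z; rewrite (E x) (E y) (E z) !br_actM // !gP h3.
Qed.

Lemma L_omega_orb mu nu : orb mu nu -> L_omega R mu -> L_omega R nu.
Proof. by move=> [g gS <-]; exact: L_omega_act. Qed.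

Definition colmx (g1 g2 g3 g4 : 'cV[R]_4) : 'M[R]_4 :=
  \matrix_(i, j) (nth 0 [:: g1; g2; g3; g4] j) i 0.

Lemma mul_colmx (g1 g2 g3 g4 : 'cV[R]_4) x : colmx g1 g2 g3 g4 *m x =
  x (idx 1) 0 *: g1 + x (idx 2) 0 *: g2 + x (idx 3) 0 *: g3 + x (idx 4) 0 *: g4.
Proof.
apply/colP => i; rewrite !mxE sum4 !mxE !inordK //= !(mulrC (x _ _)).
by [].
Qed.

Lemma omegaDl x y z : omega_cn (x + y) z = omega_cn x z + omega_cn y z.
Proof. by rewrite /omega_cn /wedge_dual !mxE; ring. Qed.
Lemma omegaDr x y z : omega_cn z (x + y) = omega_cn z x + omega_cn z y.
Proof. by rewrite /omega_cn /wedge_dual !mxE; ring. Qed.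
Lemma omegaZl (l : R) x y : omega_cn (l *: x) y = l * omega_cn x y.
Proof. by rewrite /omega_cn /wedge_dual !mxE; ring. Qed.
Lemma omegaZr (l : R) x y : omega_cn x (l *: y) = l * omega_cn x y.
Proof. by rewrite /omega_cn /wedge_dual !mxE; ring. Qed.
Lemma omegaC x y : omega_cn x y = - omega_cn y x.
Proof. by rewrite /omega_cn /wedge_dual; ring. Qed.
Lemma omegaxx x : omega_cn x x = 0.
Proof. by rewrite /omega_cn /wedge_dual; ring. Qed.
Lemma omegaNl x y : omega_cn (- x) y = - omega_cn x y.
Proof. by rewrite /omega_cn /wedge_dual !mxE; ring. Qed.

Lemma omega_nondeg x y : (forall z, omega_cn x z = omega_cn y z) -> x = y.
Proof.
move=> h; move: (h (e 1)) (h (e 2)) (h (e 3)) (h (e 4)).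
rewrite (vec_eta x) (vec_eta y) !eE !omegaE => h1 h2 h3 h4.
by congr vec; move: h1 h2 h3 h4; lra.
Qed.

Definition symplectic_basis (g1 g2 g3 g4 : 'cV[R]_4) :=
  [/\ omega_cn g1 g3 = 1, omega_cn g2 g4 = 1, omega_cn g1 g2 = 0 &
   [/\ omega_cn g1 g4 = 0, omega_cn g2 g3 = 0 & omega_cn g3 g4 = 0]].

(** Invertibility follows from preservation of the form: a vector killed by the matrix is orthogonal
    to everything, hence zero. *)
Lemma Sp4_colmx (g1 g2 g3 g4 : 'cV[R]_4) :
  symplectic_basis g1 g2 g3 g4 -> Sp4 R (colmx g1 g2 g3 g4).
Proof.
move=> [h1 h2 h3 [h4 h5 h6]].
have P x y : omega_cn (colmx g1 g2 g3 g4 *m x) (colmx g1 g2 g3 g4 *m y) = omega_cn x y.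
  rewrite !mul_colmx !(omegaDl, omegaDr) !(omegaZl, omegaZr) !omegaxx.
  rewrite (omegaC g2 g1) (omegaC g3 g1) (omegaC g3 g2) (omegaC g4 g1).
  rewrite (omegaC g4 g2) (omegaC g4 g3).
  by rewrite h1 h2 h3 h4 h5 h6 /omega_cn /wedge_dual; ring.
split=> //; rewrite -unitmx_tr -row_free_unit -kermx_eq0; apply/eqP/row_matrixP => i.
rewrite row0; set k := row i _.
have : k *m (colmx g1 g2 g3 g4)^T = 0.
  by rewrite /k -row_mul mulmx_ker row0.
move/(congr1 trmx); rewrite trmx_mul trmxK trmx0 => kE.
suff k0 : k^T = 0 by rewrite -[k]trmxK k0 trmx0.
by apply: omega_nondeg => z; rewrite -P kE -(scale0r 0) !omegaZl !mul0r.
Qed.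

(* [nu] is recognised in the orbit of [mu] through a symplectic basis in which
   [nu] has the structure constants of [mu]. *)
Lemma orb_basis mu nu (g1 g2 g3 g4 : 'cV[R]_4) (G := colmx g1 g2 g3 g4) :
  alt_bracket mu -> alt_bracket nu -> symplectic_basis g1 g2 g3 g4 ->
  br nu g1 g2 = G *m br mu (e 1) (e 2) -> br nu g1 g3 = G *m br mu (e 1) (e 3) ->
  br nu g1 g4 = G *m br mu (e 1) (e 4) -> br nu g2 g3 = G *m br mu (e 2) (e 3) ->
  br nu g2 g4 = G *m br mu (e 2) (e 4) -> br nu g3 g4 = G *m br mu (e 3) (e 4) ->
  orb mu nu.
Proof.
move=> aM aN sb h1 h2 h3 h4 h5 h6; have GS := Sp4_colmx sb.
exists G => //; apply/esym/actP => [|x y]; first by case: GS.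
rewrite [in RHS](mk_eta aM) br_mk !mulmxDr -!scalemxAr -h1 -h2 -h3 -h4 -h5 -h6.
by rewrite !mul_colmx alt_basis.
Qed.

Definition trad mu x : R := \sum_j br mu x (delta_mx j 0) j 0.
Definition trad2 mu x : R := \sum_j br mu x (br mu x (delta_mx j 0)) j 0.
(* The product of [x] with itself in the left-symmetric product [x . z] defined by
   [omega (x . z) w = - omega z [x, w]]. *)
Definition lsq mu x : 'cV[R]_4 :=
  vec (- omega_cn x (br mu x (e 3))) (- omega_cn x (br mu x (e 4)))
      (omega_cn x (br mu x (e 1))) (omega_cn x (br mu x (e 2))).
(** A polynomial parametrisation of the hyperplane orthogonal to [u], onto when [u] is nonzero.
    Quantifying over [x] and [y] instead of over the vectors orthogonal to [u] keeps a relation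
    closed as [u] varies. *)
Definition perp (u x y : 'cV[R]_4) := omega_cn u y *: x - omega_cn u x *: y.

Definition ad mu x : 'M[R]_4 := \matrix_(i, j) br mu x (delta_mx j 0) i 0.

Lemma mul_ad mu x y : ad mu x *m y = br mu x y.
Proof.
rewrite {2}(col_sum_delta y) br_sumr; apply/colP => i; rewrite mxE summxE.
by apply: eq_bigr => j _; rewrite brZr !mxE mulrC.
Qed.

Lemma trad_ad mu x : trad mu x = \tr (ad mu x).
Proof. by apply: eq_bigr => j _; rewrite mxE. Qed.

Lemma trad2_ad mu x : trad2 mu x = \tr (ad mu x *m ad mu x).
Proof.
apply: eq_bigr => j _; rewrite -[in LHS]mul_ad !mxE.
by apply: eq_bigr => k _; rewrite !mxE.
Qed.

Lemma ad_act mu g x : g \in unitmx ->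
  ad (act g mu) (g *m x) = g *m ad mu x *m invmx g.
Proof.
move=> gU; apply/matrixP => i j.
have E : g *m (invmx g *m delta_mx j 0) = delta_mx j (0 : 'I_1) by rewrite mulKVmx.
by rewrite mxE -E br_actM // -mul_ad !mulmxA -colE mxE.
Qed.

Lemma trad_act mu g x : g \in unitmx -> trad (act g mu) (g *m x) = trad mu x.
Proof. by move=> gU; rewrite !trad_ad ad_act // mxtrace_mulC mulKmx. Qed.

Lemma trad2_act mu g x : g \in unitmx -> trad2 (act g mu) (g *m x) = trad2 mu x.
Proof.
move=> gU; rewrite !trad2_ad ad_act // mulmxA -(mulmxA _ (invmx g)) !mulmxA.
by rewrite mulmxKV // -!mulmxA mxtrace_mulC -!mulmxA mulVmx // mulmx1.
Qed.

Lemma omega_lsq mu x z : omega_cn (lsq mu x) z = - omega_cn x (br mu x z).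
Proof.
rewrite {2}(col_sum_delta z) br_sumr sum4 !brZr !(omegaDr, omegaZr) -!/(e _).
by rewrite /lsq {1}(vec_eta z) omegaE; ring.
Qed.

Lemma lsq_act mu g x : Sp4 R g -> lsq (act g mu) (g *m x) = g *m lsq mu x.
Proof.
move=> [gU gP]; apply: omega_nondeg => z.
rewrite omega_lsq -(mulKVmx gU z) br_actM // !gP omega_lsq //.
Qed.

Lemma perp_act g u x y : Sp4 R g -> perp (g *m u) (g *m x) (g *m y) = g *m perp u x y.
Proof. by move=> [gU gP]; rewrite /perp !gP mulmxBr -!scalemxAr. Qed.

End Action.

(** * Limits of orbits and compactness of frames *)

Section Continuity.
Variables (R : realType) (T : topologicalType).
Implicit Types (f h : T -> R) (u v : T -> 'cV[R]_4) (m : T -> bilin R).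

Definition ccont u := forall k, continuous (fun t => u t k 0).
Definition bcont m := forall i j, ccont (fun t => m t i j).

Lemma contC (c : R) : continuous (fun _ : T => c).
Proof. by move=> t; apply: cvg_cst. Qed.
Lemma contD f h : continuous f -> continuous h -> continuous (fun t => f t + h t).
Proof. by move=> cf ch t; apply: cvgD; [exact: cf|exact: ch]. Qed.
Lemma contN f : continuous f -> continuous (fun t => - f t).
Proof. by move=> cf t; apply: cvgN; exact: cf. Qed.
Lemma contM f h : continuous f -> continuous h -> continuous (fun t => f t * h t).
Proof. by move=> cf ch t; apply: cvgM; [exact: cf|exact: ch]. Qed.
Lemma contX f n : continuous f -> continuous (fun t => f t ^+ n).
Proof.
move=> cf; elim: n => [|n IH]; first by under eq_fun do rewrite expr0; exact: contC.
by under eq_fun do rewrite exprS; exact: contM.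
Qed.
Lemma cont_sum (I : Type) (r : seq I) (F : I -> T -> R) :
  (forall i, continuous (F i)) -> continuous (fun t => \sum_(i <- r) F i t).
Proof.
move=> cF; elim: r => [|i r IH]; first by under eq_fun do rewrite big_nil; exact: contC.
by under eq_fun do rewrite big_cons; exact: contD.
Qed.

Lemma ccontC x : ccont (fun=> x).
Proof. by move=> k; exact: contC. Qed.
Lemma ccontD u v : ccont u -> ccont v -> ccont (fun t => u t + v t).
Proof. by move=> cu cv k; under eq_fun do rewrite mxE; exact: contD. Qed.
Lemma ccontN u : ccont u -> ccont (fun t => - u t).
Proof. by move=> cu k; under eq_fun do rewrite mxE; exact: contN. Qed.
Lemma ccontZ f u : continuous f -> ccont u -> ccont (fun t => f t *: u t).
Proof. by move=> cf cu k; under eq_fun do rewrite mxE; exact: contM. Qed.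

Lemma ccont_vec (a b c d : T -> R) : continuous a -> continuous b ->
  continuous c -> continuous d -> ccont (fun t => vec (a t) (b t) (c t) (d t)).
Proof. by move=> ca cb cc cd; apply: all4; under eq_fun do rewrite vecE. Qed.

Lemma cont_omega u v : ccont u -> ccont v -> continuous (fun t => omega_cn (u t) (v t)).
Proof.
move=> cu cv; rewrite /omega_cn /wedge_dual.
by do ![apply: contD|apply: contN|apply: contM]; (exact: cu || exact: cv).
Qed.

Lemma ccont_br m u v : bcont m -> ccont u -> ccont v ->
  ccont (fun t => br (m t) (u t) (v t)).
Proof.
move=> cm cu cv k; rewrite /br.
under eq_fun => t do [rewrite summxE; under eq_bigr => i _ do rewrite summxE].
apply: cont_sum => i; apply: cont_sum => j; under eq_fun do rewrite mxE.
by apply: contM; [apply: contM; [exact: cu|exact: cv]|exact: cm].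
Qed.

Lemma cont_trad m u : bcont m -> ccont u -> continuous (fun t => trad (m t) (u t)).
Proof.
by move=> cm cu; apply: cont_sum => i; apply: ccont_br => //; exact: ccontC.
Qed.

Lemma cont_trad2 m u : bcont m -> ccont u -> continuous (fun t => trad2 (m t) (u t)).
Proof.
move=> cm cu; apply: cont_sum => i; apply: ccont_br => //.
by apply: ccont_br => //; exact: ccontC.
Qed.

Lemma ccont_lsq m u : bcont m -> ccont u -> ccont (fun t => lsq (m t) (u t)).
Proof.
move=> cm cu; apply: ccont_vec; do ?apply: contN; apply: cont_omega => //;
  apply: ccont_br => //; exact: ccontC.
Qed.

Lemma ccont_perp u v w : ccont u -> ccont v -> ccont w ->
  ccont (fun t => perp (u t) (v t) (w t)).
Proof.
move=> cu cv cw; apply: ccontD; [|apply: ccontN]; apply: ccontZ => //;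
  exact: cont_omega.
Qed.

Lemma closed_eqR f h : continuous f -> continuous h -> closed [set t | f t = h t].
Proof.
move=> cf ch; have -> : [set t | f t = h t] = (fun t => f t - h t) @^-1` [set 0].
  by apply/seteqP; split=> t /= => [->|/eqP]; rewrite ?subrr // subr_eq0 => /eqP.
apply: preimage_closed; first by move=> t _; apply: contD => //; exact: contN.
exact: closed_eq.
Qed.

Lemma closed_leR f h : continuous f -> continuous h -> closed [set t | f t <= h t].
Proof.
move=> cf ch; have -> : [set t | f t <= h t] = (fun t => h t - f t) @^-1` [set x | 0 <= x].
  by apply/seteqP; split=> t /=; rewrite subr_ge0.
apply: preimage_closed; first by move=> t _; apply: contD => //; exact: contN.
exact: closed_ge.
Qed.

Lemma closed_all (I : Type) (P : I -> T -> Prop) :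
  (forall i, closed [set t | P i t]) -> closed [set t | forall i, P i t].
Proof.
move=> cP; have -> : [set t | forall i, P i t] = \bigcap_(i in setT) [set t | P i t].
  by apply/seteqP; split=> t /= h i; [move=> _|]; apply: h.
by apply: closed_bigI => i _; exact: cP.
Qed.

Lemma closed_and (P Q : T -> Prop) :
  closed [set t | P t] -> closed [set t | Q t] -> closed [set t | P t /\ Q t].
Proof. exact: closedI. Qed.

Lemma continuous_mx (U : topologicalType) p q (F : T -> 'M[U]_(p, q)) :
  (forall i j, continuous (fun t => F t i j)) -> continuous F.
Proof.
move=> cF t A [P FP sPA]; apply: (@filterS _ _ _ [set s | forall i j, P i j (F s i j)]).
  by move=> s hs; apply: sPA.
by apply: filter_forall => i; apply: filter_forall => j; apply: cF; exact: FP.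
Qed.

Lemma entry_continuous (U : topologicalType) p q i j :
  continuous (fun M : 'M[U]_(p, q) => M i j).
Proof.
move=> M A MA; exists (fun i' j' => if (i' == i) && (j' == j) then A else setT).
  by move=> i' j'; case: ifP => [/andP[/eqP -> /eqP ->] //|_]; exact: filterT.
by move=> N /(_ i j); rewrite !eqxx.
Qed.

End Continuity.

Lemma bcont_continuous (R : realType) (T : topologicalType) (m : T -> bilin R) :
  bcont m -> continuous m.
Proof.
move=> cm; apply: continuous_mx => i j; apply: continuous_mx => k l.
by rewrite ord1; exact: cm.
Qed.

Lemma continuous_bcont (R : realType) (T : topologicalType) (m : T -> bilin R) :
  continuous m -> bcont m.
Proof.
move=> cm i j k t.
have c1 : {for t, continuous (fun s => m s i j)}.
  exact: (@continuous_comp _ _ _ m (fun M : bilin R => M i j) t (cm t)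
    (@entry_continuous _ 4 4 i j (m t))).
exact: (continuous_comp c1 (@entry_continuous R 4 1 k 0 (m t i j))).
Qed.

(** * Compactness of orthonormal Lagrangian frames *)

Section Frames.
Variable R : realType.
Implicit Types (mu nu : bilin R) (x y u v : 'cV[R]_4).
Local Notation frame := ('rV[R]_4 * 'rV[R]_4)%type.

Lemma closure_curve (S : set (bilin R)) (phi : R -> bilin R) :
  bcont phi -> (forall t, 0 < t -> S (phi t)) -> closure S (phi 0).
Proof.
move=> /bcont_continuous cphi h B /cphi /nbhs_ballP [e /= e0 he].
exists (phi (e / 2)); split; first by apply: h; rewrite divr_gt0.
apply: he; rewrite -ball_normE /= sub0r normrN gtr0_norm ?divr_gt0 //.
by rewrite ltr_pdivrMr // ltr_pMr // ltr1n.
Qed.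

Definition dot x y : R := \sum_i x i 0 * y i 0.

(** Frames are stored as rows because [rV_compact] gives the compact boxes of rows; the transposes
    go back to column vectors. *)
Definition orthoframe : set frame := [set p |
  [/\ dot p.1^T p.1^T = 1, dot p.2^T p.2^T = 1, dot p.1^T p.2^T = 0
    & omega_cn p.1^T p.2^T = 0]].

Lemma ccont_row (T : topologicalType) (f : T -> 'rV[R]_4) :
  continuous f -> ccont (fun t => (f t)^T).
Proof.
move=> cf k; under eq_fun do rewrite mxE; move=> t.
exact: (@continuous_comp _ _ _ f (fun r : 'rV[R]_4 => r 0 k) t (cf t)
  (@entry_continuous _ 1 4 0 k (f t))).
Qed.

Lemma continuous_fst (T U : topologicalType) : continuous (@fst T U).
Proof. by move=> p; exact: cvg_fst. Qed.

Lemma continuous_snd (T U : topologicalType) : continuous (@snd T U).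
Proof. by move=> p; exact: cvg_snd. Qed.

Lemma ccont_fst (T : topologicalType) : ccont (fun p : frame * T => p.1.1^T).
Proof.
apply: ccont_row => p.
exact: (@continuous_comp _ _ _ (@fst frame T) (@fst _ _) p
  (@continuous_fst _ _ p) (@continuous_fst _ _ p.1)).
Qed.

Lemma ccont_snd (T : topologicalType) : ccont (fun p : frame * T => p.1.2^T).
Proof.
apply: ccont_row => p.
exact: (@continuous_comp _ _ _ (@fst frame T) (@snd _ _) p
  (@continuous_fst _ _ p) (@continuous_snd _ _ p.1)).
Qed.

Lemma orthoframe_compact : compact orthoframe.
Proof.
have c0 : compact [set r : 'rV[R]_4 | forall i, `[(-1 : R), 1]%classic (r ord0 i)].
  by apply: (rV_compact (A := fun=> `[(-1 : R), 1]%classic)) => i; exact: segment_compact.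
have box x : dot x x = 1 -> forall i, `[(-1 : R), 1]%classic (x i 0).
  move=> h i; rewrite /= in_itv /= -ler_norml -(ler_pXn2r (_ : 0 < 2)%N) ?nnegrE //.
  rewrite expr1n -normrX ger0_norm ?sqr_ge0 // -h /dot (bigD1 i) //= expr2 lerDl.
  by apply: sumr_ge0 => j _; rewrite -expr2 sqr_ge0.
apply: (subclosed_compact _ (compact_setX c0 c0)); last first.
  move=> [p q] [/= h1 h2 _ _]; split=> /= i.
    by have := box _ h1 i; rewrite mxE.
  by have := box _ h2 i; rewrite mxE.
have cf : ccont (fun p : frame => p.1^T) := ccont_row (@continuous_fst _ _).
have cs : ccont (fun p : frame => p.2^T) := ccont_row (@continuous_snd _ _).
have cdot (u v : frame -> 'cV[R]_4) : ccont u -> ccont v ->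
    continuous (fun p => dot (u p) (v p)).
  by move=> cu cv; apply: cont_sum => i; apply: contM; [exact: cu|exact: cv].
have -> : orthoframe = [set p | dot p.1^T p.1^T = 1 /\ (dot p.2^T p.2^T = 1 /\
    (dot p.1^T p.2^T = 0 /\ omega_cn p.1^T p.2^T = 0))].
  by apply/seteqP; split=> p [] //= h1 [h2 [h3 h4]].
by do !apply: closed_and; (apply: closed_eqR; [|exact: contC]);
  (apply: cdot || apply: cont_omega).
Qed.

(** If no frame worked for [nu], then near each pair of a frame and [nu] the open complement of [P]
    would persist; compactness makes the neighbourhood of [nu] uniform over frames, and it meets
    [S]. *)
Lemma closure_frame (S : set (bilin R)) (P : frame -> bilin R -> Prop) nu :
  closed [set p : frame * bilin R | P p.1 p.2] ->
  (forall mu, S mu -> exists2 k, orthoframe k & P k mu) ->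
  closure S nu -> exists2 k, orthoframe k & P k nu.
Proof.
move=> cP hS clnu; apply: contrapT => hn.
have: \near nu, orthoframe `<=` (fun k => ~ P k nu).
  apply: (iffLR (compact_near_coveringP _) orthoframe_compact _ (nbhs nu)
    (fun mu k => ~ P k mu)).
  move=> k Kk.
  have : nbhs (k, nu) (~` [set p : frame * bilin R | P p.1 p.2]).
    apply: open_nbhs_nbhs; split; first exact: closed_openC.
    by move=> /= Pk; apply: hn; exists k.
  exact: filterS.
by move=> /clnu [mu [/hS[k Kk Pk]] /(_ k Kk)].
Qed.

End Frames.

(** * Closed invariant relations between a bracket and a frame *)

Section Relations.
Variable R : realType.
Implicit Types (mu nu : bilin R) (x y z u v : 'cV[R]_4).
Local Notation relation := (bilin R -> 'cV[R]_4 -> 'cV[R]_4 -> Prop).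

Definition rel_closed (P : relation) := closed
  [set p : ('rV[R]_4 * 'rV[R]_4) * bilin R | P p.2 p.1.1^T p.1.2^T].

Definition rel_invariant (P : relation) := forall nu g u v,
  Sp4 R g -> P nu u v -> P (act g nu) (g *m u) (g *m v).

Definition good (P : relation) := rel_closed P /\ rel_invariant P.

Lemma good_and (P Q : relation) : good P -> good Q ->
  good (fun nu u v => P nu u v /\ Q nu u v).
Proof.
move=> [cP iP] [cQ iQ]; split; first exact: closed_and.
by move=> nu g u v gS [p q]; split; [exact: iP|exact: iQ].
Qed.

(** The frame [(0, 0)] is fixed by the group. It serves as a dummy frame for relations that do not
    mention [u] and [v], turning them into invariants of orbits. *)
Lemma good_orb (P : relation) mu nu : good P -> orb mu nu -> P mu 0 0 -> P nu 0 0.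
Proof.
by move=> [_ iP] [g gS <-] /(iP _ _ _ _ gS); rewrite !mulmx0.
Qed.

Lemma dotxx_eq0 x : dot x x = 0 -> x = 0.
Proof.
move=> h; apply/colP => i; rewrite mxE; apply/eqP; rewrite -sqrf_eq0 expr2; apply/eqP.
by apply: (psumr_eq0P _ h) => // j _; rewrite -expr2 sqr_ge0.
Qed.

Lemma dotxx_ge0 x : 0 <= dot x x.
Proof. by apply: sumr_ge0 => j _; rewrite -expr2 sqr_ge0. Qed.

Lemma dotDr x y z : dot z (x + y) = dot z x + dot z y.
Proof. by rewrite /dot -big_split; apply: eq_bigr => i _; rewrite mxE mulrDr. Qed.
Lemma dotZr (l : R) x z : dot z (l *: x) = l * dot z x.
Proof. by rewrite /dot mulr_sumr; apply: eq_bigr => i _; rewrite mxE mulrCA. Qed.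
Lemma dotC x y : dot x y = dot y x.
Proof. by apply: eq_bigr => i _; rewrite mulrC. Qed.

Lemma normalized x : x != 0 -> exists2 l : R, l != 0 & dot (l *: x) (l *: x) = 1.
Proof.
move=> x0; have dx : 0 < dot x x.
  by rewrite lt_def dotxx_ge0 andbT; apply: contra x0 => /eqP/dotxx_eq0 ->.
exists (Num.sqrt (dot x x))^-1; first by rewrite invr_eq0 sqrtr_eq0 -ltNge.
rewrite dotZr (dotC _ x) dotZr mulrA -expr2 exprVn sqr_sqrtr ?ltW //.
by rewrite mulVf // gt_eqF.
Qed.

(* Gram-Schmidt in the Lagrangian plane spanned by [g e3] and [g e4]. *)
Lemma orthoframe_span (g : 'M[R]_4) : Sp4 R g ->
  exists al be ga : R, orthoframe
    ((g *m vec 0 0 al 0)^T, (g *m vec 0 0 be ga)^T).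
Proof.
move=> [gU gP].
have inj x : g *m x = 0 -> x = 0 by move=> h; rewrite -(mulKmx gU x) h mulmx0.
have neq0 x : x != 0 -> g *m x != 0 by apply: contra => /eqP/inj ->.
have e3n : e 3 != 0 :> 'cV[R]_4.
  rewrite e3E vec0; apply/eqP => /vec_inj [_ _ /eqP h _].
  by move: h; rewrite oner_eq0.
have [al al0 h1] := normalized (neq0 _ e3n).
set u := al *: _ in h1; set c := dot u (g *m e 4).
have wn : vec 0 0 (- (c * al)) 1 != 0.
  rewrite vec0; apply/eqP => /vec_inj [_ _ _ /eqP].
  by rewrite oner_eq0.
have [be be0 h2] := normalized (neq0 _ wn).
have uE : u = g *m vec 0 0 al 0.
  by rewrite /u scalemxAr e3E vecZ !mulr0 mulr1.
have wE : g *m vec 0 0 (- (c * al)) 1 = g *m e 4 + (- c) *: u.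
  rewrite uE scalemxAr -mulmxDr; congr (g *m _); rewrite e4E vecZ vecD.
  by congr vec; ring.
have wE' : be *: (g *m vec 0 0 (- (c * al)) 1) = g *m vec 0 0 (- (be * c * al)) be.
  by rewrite scalemxAr vecZ !mulr0 mulr1 mulrN mulrA.
exists al, (- (be * c * al)), be; rewrite /orthoframe /= !trmxK -uE -wE' h1 h2; split=> //.
  by rewrite dotZr wE dotDr dotZr h1 -/c; ring.
by rewrite wE' uE gP omegaE; ring.
Qed.

Lemma orthoframe_Sp4 u v : orthoframe (u^T, v^T) ->
  exists2 g, Sp4 R g & g *m u = e 3 /\ g *m v = e 4.
Proof.
rewrite /orthoframe /= !trmxK => -[h1 h2 h3 h4].
(* [mJ] is the compatible complex structure, [omega (mJ x) y = dot x y], so an orthonormal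
   Lagrangian frame [(u, v)] is completed to the symplectic basis [(mJ u, mJ v, u, v)]. *)
pose mJ x := vec (x (idx 3) 0) (x (idx 4) 0) (- x (idx 1) 0) (- x (idx 2) 0).
have hS : Sp4 R (colmx (mJ u) (mJ v) u v).
  apply: Sp4_colmx.
  have mJd x y : omega_cn (mJ x) y = dot x y.
    by rewrite /mJ /dot sum4 {1}(vec_eta y) omegaE; ring.
  have mJm x y : omega_cn (mJ x) (mJ y) = omega_cn x y.
    by rewrite /mJ omegaE /omega_cn /wedge_dual; ring.
  by do ?split; rewrite ?mJm ?mJd // dotC.
have hE : colmx (mJ u) (mJ v) u v *m e 3 = u /\ colmx (mJ u) (mJ v) u v *m e 4 = v.
  by rewrite !mul_colmx !eE !vecE !scale0r !add0r !scale1r addr0.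
exists (invmx (colmx (mJ u) (mJ v) u v)); first exact: Sp4_V.
have key w z : colmx (mJ u) (mJ v) u v *m w = z ->
    invmx (colmx (mJ u) (mJ v) u v) *m z = w.
  by move=> <-; rewrite mulKmx //; case: hS.
by case: hE => /key hu /key hv.
Qed.

(* Every degeneration of [mu] satisfies, up to the symplectic group, the closed
   relations satisfied by [mu] in the frames spanning the plane of [e3], [e4]. *)
Lemma frame_limit (P : relation) mu nu : good P ->
  (forall al be ga, P mu (vec 0 0 al 0) (vec 0 0 be ga)) ->
  closure (orb mu) nu -> exists2 nu', orb nu nu' & P nu' (e 3) (e 4).
Proof.
move=> [cP iP] hP clnu.
case: (closure_frame (P := fun k nu => P nu k.1^T k.2^T) cP _ clnu) => /=.
  move=> _ [g gS <-]; have [al [be [ga h]]] := orthoframe_span gS.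
  by exists (((g *m vec 0 0 al 0)^T, (g *m vec 0 0 be ga)^T)) => //=;
    rewrite !trmxK; exact: iP.
move=> [u v] h Pk; have := @orthoframe_Sp4 u^T v^T.
rewrite !trmxK => /(_ h) [g gS [gu gv]].
exists (act g nu); first exact: orb_act.
by rewrite -gu -gv; exact: iP.
Qed.

(** [u] is orthogonal to the derived algebra and is a common eigenvector of weight [k tr ad]. Vector
    identities are paired with a test vector through [omega_cn], so that closedness only concerns
    scalar functions. *)
Definition rel_line (k : R) : relation := fun nu u v =>
  (forall x y, omega_cn u (br nu x y) = 0) /\
  (forall x z, omega_cn (br nu x u) z = k * trad nu x * omega_cn u z).

(** A ratio of traces in homogeneous form: with two coefficients, [c = 0] expresses unimodularity,
    as for [mu3] in [lim_hyp]. *)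
Definition rel_trace (c d : R) : relation := fun nu u v =>
  forall x, c * trad2 nu x = d * trad nu x ^+ 2.

Definition rel_traceI (ep d : R) : relation := fun nu u v =>
  forall x, 0 <= ep * (trad2 nu x - d * trad nu x ^+ 2).

Definition rel_unimod : relation := fun nu u v => forall x, trad nu x = 0.

(** On the plane [u^perp / u] the form [omega w (M w)] has a sign that SL2 preserves, but replacing
    [x] by [- x] reverses it. The factor [trad nu x] makes the expression quadratic in [x]. *)
Definition rel_sign (ep : R) : relation := fun nu u v => forall x y z,
  0 <= ep * (trad nu x * omega_cn (perp u y z) (br nu x (perp u y z))).

(** The quadratic form [omega w (M w)] vanishes exactly when M is scalar on [u^perp / u]. *)
Definition rel_scalar : relation := fun nu u v => forall x y z,
  omega_cn (perp u y z) (br nu x (perp u y z)) = 0.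

(** For [mu11 (-1)] the square of [ad e1] is the identity on [<e2, e3, e4>] and [tr ad e1 = -1]. The
    identity fails for [mu10], because of its Jordan block, and for [mu7], which is unimodular with
    [(ad e1)^2] nonzero. *)
Definition rel_dilation : relation := fun nu u v => forall x y t,
  omega_cn (br nu x (br nu x y)) t =
  trad nu x * (trad nu x * omega_cn y t - trad nu y * omega_cn x t).

Definition rel_abelian : relation := fun nu u v => forall x y z,
  omega_cn (br nu x y) z = 0.

Definition rel_two_step : relation := fun nu u v => forall x y z t,
  omega_cn (br nu x (br nu y z)) t = 0.

(** Of degree three in the bracket and five in [x]. Unlike the traces it detects the symplectic
    form: it vanishes on [mu15], but not on [mu16] or [mu7]. *)
Definition cubic nu x := omega_cn (br nu x (lsq nu x)) (lsq nu x)
  - trad nu x * omega_cn (br nu x (lsq nu x)) x.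

Definition rel_cubic : relation := fun nu u v => forall x, cubic nu x = 0.

(** For [mu5] the nonzero eigenvalues of [ad x] are the coordinates [x1] and [x2], and the
    right-hand side is [16 l^2 (x1 x2)^4 (x1 - x2)^2]. Squaring makes it symmetric in the two
    eigenvalues, so that traces express it; the sign of [l] is lost. *)
Definition rel_cubic2 (l : R) : relation := fun nu u v => forall x,
  16 * cubic nu x ^+ 2 = l ^+ 2 * (trad nu x ^+ 2 - trad2 nu x) ^+ 4
    * (2 * trad2 nu x - trad nu x ^+ 2).

Definition rel_plane : relation := fun nu u v =>
  (forall x y, omega_cn u (br nu x y) = 0) /\
  (forall x y, omega_cn v (br nu x y) = 0) /\
  (forall z, omega_cn (br nu u v) z = 0).

(** Proportionality of [[x, u]] to [u] written as the vanishing of a wedge product, with no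
    eigenvalue to quantify over. *)
Definition rel_eigen : relation := fun nu u v => forall x z t,
  omega_cn (br nu x u) z * omega_cn u t = omega_cn (br nu x u) t * omega_cn u z.

Lemma bcont_snd : bcont (fun p : ('rV[R]_4 * 'rV[R]_4) * bilin R => p.2).
Proof.
by apply: continuous_bcont; exact: (@continuous_snd ('rV[R]_4 * 'rV[R]_4)%type).
Qed.

(* In the algebras d_{4,2}, [u] spans the orthogonal of the derived algebra and
   [v] the centre of the nilradical. *)
Definition rel_flag (ep : R) : relation := fun nu u v =>
  (forall x y, omega_cn u (br nu x y) = 0) /\
  (forall x, omega_cn v (br nu x u) = 0 /\ omega_cn v (br nu x v) = 0) /\
  (forall z, omega_cn (br nu u v) z = 0) /\
  (forall y z, trad nu (perp u y z) = 0) /\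
  (forall x y z, 2 * omega_cn v (br nu x (perp u y z)) =
     - trad nu x * omega_cn v (perp u y z)) /\
  (forall x y z, 0 <= - (ep * (trad nu x * omega_cn u x *
     omega_cn (perp u y z) (br nu (perp u y z) u)))) /\
  (forall x y x' y', 0 <= - (ep * (trad nu (perp v x y) *
     omega_cn (perp v x y) (br nu (perp u x' y') v) * omega_cn (perp u x' y') v))).

(** Each relation is an intersection of equalities and inequalities between polynomial functions, so
    closedness is read off its syntax. *)
Ltac cont_tac := repeat (cbv beta; lazymatch goal with
  | |- closed (mkset (fun t => (@?A t) /\ (@?B t))) =>
      apply: (@closed_and _ A B)
  | |- closed (mkset (fun t => @eq _ (@?f t) (@?h t))) =>
      apply: (@closed_eqR _ _ f h)
  | |- closed (mkset (fun t => is_true (Order.le (@?f t) (@?h t)))) =>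
      apply: (@closed_leR _ _ f h)
  | |- closed _ => apply: closed_all => ?
  | |- continuous (fun t => omega_cn (@?f t) (@?h t)) => apply: (@cont_omega _ _ f h)
  | |- continuous (fun t => trad (@?f t) (@?h t)) => apply: (@cont_trad _ _ f h)
  | |- continuous (fun t => trad2 (@?f t) (@?h t)) => apply: (@cont_trad2 _ _ f h)
  | |- continuous (fun t => GRing.exp (@?f t) _) => apply: (@contX _ _ f)
  | |- continuous (fun t => GRing.mul (@?f t) (@?h t)) => apply: (@contM _ _ f h)
  | |- continuous (fun t => GRing.add (@?f t) (@?h t)) => apply: (@contD _ _ f h)
  | |- continuous (fun t => GRing.opp (@?f t)) => apply: (@contN _ _ f)
  | |- continuous (fun t => _) => exact: contC
  | |- bcont snd => exact: bcont_snd
  | |- bcont (fun t => _) => exact: bcont_snd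
  | |- ccont (fun t => br (@?m t) (@?f t) (@?h t)) => apply: (@ccont_br _ _ m f h)
  | |- ccont (fun t => lsq (@?m t) (@?f t)) => apply: (@ccont_lsq _ _ m f)
  | |- ccont (fun t => perp (@?m t) (@?f t) (@?h t)) => apply: (@ccont_perp _ _ m f h)
  | |- ccont _ => first [exact: ccont_fst | exact: ccont_snd | exact: ccontC]
  end).

Lemma all_act (g : 'M[R]_4) (Q : 'cV[R]_4 -> Prop) : g \in unitmx ->
  (forall x, Q (g *m x)) -> forall x, Q x.
Proof. by move=> gU h x; rewrite -(mulKVmx gU x). Qed.

Lemma good_line k : good (rel_line k).
Proof.
split; first by rewrite /rel_closed /rel_line; cont_tac.
move=> nu g u v gS [h1 h2]; have [gU gP] := gS; split.
  by apply: (all_act gU) => x; apply: (all_act gU) => y; rewrite br_actM // gP.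
apply: (all_act gU) => x; apply: (all_act gU) => y.
by rewrite br_actM // !gP trad_act.
Qed.

Lemma good_trace c d : good (rel_trace c d).
Proof.
split; first by rewrite /rel_closed /rel_trace; cont_tac.
move=> nu g u v gS h; have [gU gP] := gS.
by apply: (all_act gU) => x; rewrite trad_act // trad2_act.
Qed.

Lemma good_traceI ep d : good (rel_traceI ep d).
Proof.
split; first by rewrite /rel_closed /rel_traceI; cont_tac.
move=> nu g u v gS h; have [gU gP] := gS.
by apply: (all_act gU) => x; rewrite trad_act // trad2_act.
Qed.

Lemma good_unimod : good rel_unimod.
Proof.
split; first by rewrite /rel_closed /rel_unimod; cont_tac.
move=> nu g u v gS h; have [gU gP] := gS.
by apply: (all_act gU) => x; rewrite trad_act.
Qed.

Lemma good_sign ep : good (rel_sign ep).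
Proof.
split; first by rewrite /rel_closed /rel_sign; cont_tac.
move=> nu g u v gS h; have [gU gP] := gS; do 3 apply: (all_act gU) => ?.
by rewrite perp_act // br_actM // gP trad_act.
Qed.

Lemma good_scalar : good rel_scalar.
Proof.
split; first by rewrite /rel_closed /rel_scalar; cont_tac.
move=> nu g u v gS h; have [gU gP] := gS; do 3 apply: (all_act gU) => ?.
by rewrite perp_act // br_actM // gP.
Qed.

Lemma good_dilation : good rel_dilation.
Proof.
split; first by rewrite /rel_closed /rel_dilation; cont_tac.
move=> nu g u v gS h; have [gU gP] := gS; do 3 apply: (all_act gU) => ?.
by rewrite !br_actM // !gP !trad_act.
Qed.

Lemma good_abelian : good rel_abelian.
Proof.
split; first by rewrite /rel_closed /rel_abelian; cont_tac.
move=> nu g u v gS h; have [gU gP] := gS; do 3 apply: (all_act gU) => ?.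
by rewrite !br_actM // !gP.
Qed.

Lemma good_two_step : good rel_two_step.
Proof.
split; first by rewrite /rel_closed /rel_two_step; cont_tac.
move=> nu g u v gS h; have [gU gP] := gS; do 4 apply: (all_act gU) => ?.
by rewrite !br_actM // !gP.
Qed.

Lemma cubic_act nu (g : 'M[R]_4) x : Sp4 R g -> cubic (act g nu) (g *m x) = cubic nu x.
Proof.
by move=> gS; have [gU gP] := gS; rewrite /cubic lsq_act // br_actM // !gP trad_act.
Qed.

Lemma good_cubic : good rel_cubic.
Proof.
split; first by rewrite /rel_closed /rel_cubic /cubic; cont_tac.
move=> nu g u v gS h; have [gU gP] := gS.
by apply: (all_act gU) => ?; rewrite cubic_act.
Qed.

Lemma good_cubic2 l : good (rel_cubic2 l).
Proof.
split; first by rewrite /rel_closed /rel_cubic2 /cubic; cont_tac.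
move=> nu g u v gS h; have [gU gP] := gS.
by apply: (all_act gU) => ?; rewrite cubic_act // trad_act // trad2_act.
Qed.

Lemma good_plane : good rel_plane.
Proof.
split; first by rewrite /rel_closed /rel_plane; cont_tac.
move=> nu g u v gS [h1 [h2 h3]]; have [gU gP] := gS.
by do ![split]; do ?apply: (all_act gU) => ?; do ?apply: (all_act gU) => ?;
  rewrite br_actM // gP.
Qed.

Lemma good_eigen : good rel_eigen.
Proof.
split; first by rewrite /rel_closed /rel_eigen; cont_tac.
move=> nu g u v gS h; have [gU gP] := gS; do 3 apply: (all_act gU) => ?.
by rewrite br_actM // !gP.
Qed.

Lemma good_flag ep : good (rel_flag ep).
Proof.
split; first by rewrite /rel_closed /rel_flag; cont_tac.
move=> nu g u v gS [h1 [h2 [h3 [h4 [h5 [h6 h7]]]]]]; have [gU gP] := gS.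
split; first by do 2 apply: (all_act gU) => ?; rewrite br_actM // gP.
split; first by apply: (all_act gU) => ?; rewrite !br_actM // !gP.
split; first by apply: (all_act gU) => ?; rewrite br_actM // gP.
split; first by do 2 apply: (all_act gU) => ?; rewrite perp_act // trad_act.
split; first by do 3 apply: (all_act gU) => ?; rewrite perp_act // br_actM // trad_act // !gP.
split; do ?apply: (all_act gU) => ?; do ?apply: (all_act gU) => ?;
  do ?apply: (all_act gU) => ?; do ?apply: (all_act gU) => ?.
  by rewrite perp_act // br_actM // trad_act // !gP.
by rewrite !perp_act // br_actM // trad_act // !gP.
Qed.

End Relations.

(** * Normal forms of brackets *)

Section Families.
Variable R : realType.
Implicit Types (mu nu : bilin R) (a b c d s u h k w p q r t x y z : R).

(* The brackets with closed form, [e3, e4] = 0, derived algebra in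
   [e3]^perp = <e2, e3, e4>, and <e3, e4> stable under [ad e2]. *)
Definition gfam (s a b c d w2 w4 u h k : R) : bilin R :=
  mk (vec 0 a w2 c) (vec 0 0 s u) (vec 0 b w4 d) (vec 0 0 u h) (vec 0 0 (a + d) k) 0.

Lemma br_gfam s a b c d w2 w4 u h k x1 x2 x3 x4 y1 y2 y3 y4 :
  br (gfam s a b c d w2 w4 u h k) (vec x1 x2 x3 x4) (vec y1 y2 y3 y4) =
  let p12 := x1 * y2 - x2 * y1 in let p13 := x1 * y3 - x3 * y1 in
  let p14 := x1 * y4 - x4 * y1 in let p23 := x2 * y3 - x3 * y2 in
  let p24 := x2 * y4 - x4 * y2 in
  vec 0 (p12 * a + p14 * b)
    (p12 * w2 + p13 * s + p14 * w4 + p23 * u + p24 * (a + d))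
    (p12 * c + p13 * u + p14 * d + p23 * h + p24 * k).
Proof.
rewrite br_mk /wedge_dual !vecE !vecZ vec0 !(vecZ, vecD) /=.
by congr vec; ring.
Qed.

Lemma alt_gfam s a b c d w2 w4 u h k : alt_bracket (gfam s a b c d w2 w4 u h k).
Proof.
by move=> x; rewrite (vec_eta x) br_gfam /= vec0; congr vec; ring.
Qed.

Lemma trad_gfam s a b c d w2 w4 u h k x1 x2 x3 x4 :
  trad (gfam s a b c d w2 w4 u h k) (vec x1 x2 x3 x4) =
  x1 * (a + s + d) + x2 * (u + k).
Proof. by rewrite /trad sum4 -!/(e _) !eE !br_gfam /= !vecE; ring. Qed.

Lemma trad2_gfam s a b c d w2 w4 u h k x1 x2 x3 x4 :
  trad2 (gfam s a b c d w2 w4 u h k) (vec x1 x2 x3 x4) =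
  (x1 * a) ^+ 2 + (x1 * s + x2 * u) ^+ 2 + (x1 * d + x2 * k) ^+ 2
  + 2 * x1 * b * (x1 * c - x3 * h - x4 * k)
  + 2 * (x1 * w4 + x2 * (a + d)) * (x1 * u + x2 * h).
Proof. by rewrite /trad2 sum4 -!/(e _) !eE !br_gfam /= !vecE; ring. Qed.

Lemma lsq_gfam s a b c d w2 w4 u h k x1 x2 x3 x4 :
  lsq (gfam s a b c d w2 w4 u h k) (vec x1 x2 x3 x4) = 
  vec (- (x1 * (x1 * s + x2 * u) + x2 * (x1 * u + x2 * h)))
      (- (x1 * (x1 * w4 + x2 * (a + d)) + x2 * (x1 * d + x2 * k) - x4 * x1 * b))
      (- (x1 * (x2 * w2 + x3 * s + x4 * w4) + x2 * (x2 * c + x3 * u + x4 * d)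
          - x4 * (x2 * a + x4 * b)))
      (x1 * (x1 * w2 - x3 * u - x4 * (a + d)) + x2 * (x1 * c - x3 * h - x4 * k)
          - x4 * x1 * a).
Proof. by rewrite /lsq !eE !br_gfam /= !omegaE; congr vec; ring. Qed.

Lemma perpE (a b c d a' b' c' d' a'' b'' c'' d'' : R) (u := vec a b c d)
  (x := vec a' b' c' d') (y := vec a'' b'' c'' d'') :
  perp u x y = vec (omega_cn u y * a' - omega_cn u x * a'')
    (omega_cn u y * b' - omega_cn u x * b'') (omega_cn u y * c' - omega_cn u x * c'')
    (omega_cn u y * d' - omega_cn u x * d'').
Proof. by rewrite /perp !vecZ vecN vecD. Qed.

Definition gfamE := (lsq_gfam, br_gfam, trad_gfam, trad2_gfam, perpE, omegaE).

Lemma all_vec (P : 'cV[R]_4 -> Prop) :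
  (forall a b c d, P (vec a b c d)) -> forall v, P v.
Proof. by move=> h v; rewrite (vec_eta v). Qed.

Lemma gfam_Jacobi s a b c d w2 w4 u h k :
  h * b = 0 -> k * b = 0 -> b * u = 0 ->
  h * w4 = u * (a + d) + a * u -> u * u + h * d = s * h + u * k + a * h ->
  (a + d) * s + k * w4 = w4 * u + d * (a + d) + a * (a + d) ->
  (a + d) * u = w4 * h + a * k ->
  L_omega R (gfam s a b c d w2 w4 u h k).
Proof.
move=> h1 h2 h3 h4 h5 h6 h7; split; first split.
- exact: alt_gfam.
- apply: all_vec => x1 x2 x3 x4; apply: all_vec => y1 y2 y3 y4.
  apply: all_vec => z1 z2 z3 z4; rewrite !br_gfam /= !vecD vec0.
  (* The Jacobi expression is alternating and trilinear, hence a combination of the 3x3 minors of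
     the three vectors. The minor on coordinates 2, 3, 4 drops out because [[e3, e4] = 0] and
     [<e3, e4>] is stable under [ad e2]. *)
  pose m3 (r1 r2 r3 s1 s2 s3 t1 t2 t3 : R) := r1 * (s2 * t3 - s3 * t2)
    - r2 * (s1 * t3 - s3 * t1) + r3 * (s1 * t2 - s2 * t1).
  pose m123 := m3 x1 x2 x3 y1 y2 y3 z1 z2 z3.
  pose m124 := m3 x1 x2 x4 y1 y2 y4 z1 z2 z4.
  pose m134 := m3 x1 x3 x4 y1 y3 y4 z1 z3 z4.
  congr vec; first ring.
  + transitivity (m123 * (h * b) + m124 * (k * b)); last by rewrite h1 h2; ring.
    by rewrite /m123 /m124 /m3; ring.
  + transitivity (m123 * (h * w4 - (u * (a + d) + a * u)) + m124 * ((a + d) * s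
      + k * w4 - (w4 * u + d * (a + d) + a * (a + d))) + m134 * (b * u)).
      by rewrite /m123 /m124 /m134 /m3; ring.
    by rewrite h3 h4 h6; ring.
  + transitivity (m123 * (u * u + h * d - (s * h + u * k + a * h)) + m124 *
      ((a + d) * u - (w4 * h + a * k)) + m134 * (h * b)).
      by rewrite /m123 /m124 /m134 /m3; ring.
    by rewrite h1 h5 h7; ring.
- do 3 apply: all_vec => ? ? ? ?; rewrite !br_gfam /= !omegaE; ring.
Qed.

Lemma Jacobi_gfam s a b c d w2 w4 u h k :
  L_omega R (gfam s a b c d w2 w4 u h k) ->
  [/\ h * b = 0, k * b = 0, b * u = 0,
  h * w4 = u * (a + d) + a * u & [/\ u * u + h * d = s * h + u * k + a * h,
  (a + d) * s + k * w4 = w4 * u + d * (a + d) + a * (a + d) &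
  (a + d) * u = w4 * h + a * k]].
Proof.
move=> [[_ J] _].
move: (J (e 1) (e 2) (e 3)) (J (e 1) (e 2) (e 4)) (J (e 1) (e 3) (e 4)).
rewrite !eE !br_gfam /= !vecD vec0.
move=> /vec_inj [_ j1 j2 j3] /vec_inj [_ j4 j5 j6] /vec_inj [_ j7 j8 j9].
by do ?split; lra.
Qed.

End Families.

(** * Symplectic changes of basis computed on coordinate tuples *)

Section Tuples.
Variable R : realType.
Local Notation R4 := (R * R * R * R)%type.

Definition tvec (x : R4) : 'cV[R]_4 := let: (a, b, c, d) := x in vec a b c d.

Definition tbr (s a b c d w2 w4 u h k : R) (x y : R4) : R4 :=
  let: (x1, x2, x3, x4) := x in let: (y1, y2, y3, y4) := y in
  let p12 := x1 * y2 - x2 * y1 in let p13 := x1 * y3 - x3 * y1 in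
  let p14 := x1 * y4 - x4 * y1 in let p23 := x2 * y3 - x3 * y2 in
  let p24 := x2 * y4 - x4 * y2 in
  (0, p12 * a + p14 * b,
    p12 * w2 + p13 * s + p14 * w4 + p23 * u + p24 * (a + d),
    p12 * c + p13 * u + p14 * d + p23 * h + p24 * k).

Definition tomega (x y : R4) : R :=
  let: (x1, x2, x3, x4) := x in let: (y1, y2, y3, y4) := y in
  x1 * y3 - x3 * y1 + (x2 * y4 - x4 * y2).

Definition tlin (g2 g3 g4 : R4) (y2 y3 y4 : R) : R4 :=
  let: (a1, a2, a3, a4) := g2 in let: (b1, b2, b3, b4) := g3 in
  let: (c1, c2, c3, c4) := g4 in
  (y2 * a1 + y3 * b1 + y4 * c1, y2 * a2 + y3 * b2 + y4 * c2,
   y2 * a3 + y3 * b3 + y4 * c3, y2 * a4 + y3 * b4 + y4 * c4).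

Lemma orb_gfam (g1 g2 g3 g4 : R4) (s a b c d w2 w4 u h k : R)
    (s' a' b' c' d' w2' w4' u' h' k' : R)
    (B := tbr s a b c d w2 w4 u h k) (L := tlin g2 g3 g4) :
  [/\ tomega g1 g3 = 1, tomega g2 g4 = 1, tomega g1 g2 = 0 &
   [/\ tomega g1 g4 = 0, tomega g2 g3 = 0 & tomega g3 g4 = 0]] ->
  B g1 g2 = L a' w2' c' -> B g1 g3 = L 0 s' u' -> B g1 g4 = L b' w4' d' ->
  B g2 g3 = L 0 u' h' -> B g2 g4 = L 0 (a' + d') k' -> B g3 g4 = L 0 0 0 ->
  orb (gfam s a b c d w2 w4 u h k) (gfam s' a' b' c' d' w2' w4' u' h' k').
Proof.
have om x y : omega_cn (tvec x) (tvec y) = tomega x y.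
  by case: x y => [[[? ?] ?] ?] [[[? ?] ?] ?]; rewrite /tvec omegaE.
have bE x y : br (gfam s a b c d w2 w4 u h k) (tvec x) (tvec y) = tvec (B x y).
  by case: x y => [[[? ?] ?] ?] [[[? ?] ?] ?]; rewrite /tvec br_gfam.
have LE y2 y3 y4 : colmx (tvec g1) (tvec g2) (tvec g3) (tvec g4) *m vec 0 y2 y3 y4
    = tvec (L y2 y3 y4).
  rewrite mul_colmx !vecE scale0r add0r /L.
  case: (g2) => [[[? ?] ?] ?]; case: (g3) => [[[? ?] ?] ?]; case: (g4) => [[[? ?] ?] ?].
  by rewrite /tvec /= !vecZ !vecD.
move=> sb h1 h2 h3 h4 h5 h6; apply: orb_sym.
apply: (@orb_basis _ _ _ (tvec g1) (tvec g2) (tvec g3) (tvec g4)).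
- exact: alt_gfam.
- exact: alt_gfam.
- by rewrite /symplectic_basis !om.
all: rewrite bE !eE br_gfam /= LE.
all: rewrite ?h1 ?h2 ?h3 ?h4 ?h5 ?h6.
all: by congr (tvec (L _ _ _)); ring.
Qed.

End Tuples.

Tactic Notation "orb_tac" uconstr(g1) uconstr(g2) uconstr(g3) uconstr(g4) :=
  refine (@orb_gfam _ g1 g2 g3 g4 _ _ _ _ _ _ _ _ _ _ _ _ _ _ _ _ _ _ _ _
    _ _ _ _ _ _ _);
  rewrite /tbr /tomega /tlin; do ?split; do 3 ? [congr (_, _)];
  first [ring | field; done | field].

(** * The line family and SL2 conjugacy of its 2x2 block *)

Section LineFamily.
Variable R : realType.
Implicit Types (a b c d s w x y p t k l m eta : R).

(* [e1] acts on [e2], [e4] by the matrix with columns [(a, c)] and [(b, d)]. *)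
Definition fam s a b c d w2 w4 := gfam s a b c d w2 w4 0 0 0.

(** The vector [(w2, w4)] moves by the image of [(x, y)] under [sg - M^T], where
    [sg = s - (a + d)]. *)
Lemma orb_transl x y s a b c d w2 w4 : orb (fam s a b c d w2 w4)
  (fam s a b c d (w2 + (s - (a + d) - a) * x - c * y)
     (w4 + (s - (a + d) - d) * y - b * x)).
Proof. by orb_tac (1, - y, 0, x) (0, 1, x, 0) (0, 0, 1, 0) (0, 0, y, 1). Qed.

Lemma orb_shearU p s a b c d w2 w4 : orb (fam s a b c d w2 w4)
  (fam s (a - c * p) (b + p * (a - d) - p ^+ 2 * c) c (d + p * c) w2 (w4 + p * w2)).
Proof. by orb_tac (1, 0, 0, 0) (0, 1, 0, 0) (0, 0, 1, 0) (0, p, 0, 1). Qed.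

Lemma orb_shearL p s a b c d w2 w4 : orb (fam s a b c d w2 w4)
  (fam s (a + p * b) b (c + p * (d - a) - p ^+ 2 * b) (d - p * b) (w2 + p * w4) w4).
Proof. by orb_tac (1, 0, 0, 0) (0, 1, 0, p) (0, 0, 1, 0) (0, 0, 0, 1). Qed.

Lemma orb_rot s a b c d w2 w4 : orb (fam s a b c d w2 w4)
  (fam s d (- c) (- b) a w4 (- w2)).
Proof. by orb_tac (1, 0, 0, 0) (0, 0, 0, 1) (0, 0, 1, 0) (0, -1, 0, 0). Qed.

(** Only [k ^+ 2] acts on [b] and [c], so their signs survive. *)
Lemma orb_diag k s a b c d w2 w4 : k != 0 -> orb (fam s a b c d w2 w4)
  (fam s a (b / k ^+ 2) (k ^+ 2 * c) d (k * w2) (w4 / k)).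
Proof. by move=> k0; orb_tac (1, 0, 0, 0) (0, k, 0, 0) (0, 0, 1, 0) (0, 0, 0, k^-1). Qed.

Lemma orb_scale t s a b c d w2 w4 : t != 0 -> orb (fam s a b c d w2 w4)
  (fam (t * s) (t * a) (t * b) (t * c) (t * d) (t ^+ 2 * w2) (t ^+ 2 * w4)).
Proof. by move=> t0; orb_tac (t, 0, 0, 0) (0, 1, 0, 0) (0, 0, t^-1, 0) (0, 0, 0, 1). Qed.

Lemma fam_w0 s a b c d w2 w4 :
  (s - (a + d) - a) * (s - (a + d) - d) - b * c != 0 ->
  orb (fam s a b c d w2 w4) (fam s a b c d 0 0).
Proof.
move: (fun x y => orb_transl x y s a b c d w2 w4); move: (s - (a + d)) => sg h D0.
(* Cramer's rule for the translation; the determinant is nonzero because [sg] is not an eigenvalue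
   of M. *)
have := h (- ((sg - d) * w2 + c * w4) / ((sg - a) * (sg - d) - b * c))
  (- ((sg - a) * w4 + b * w2) / ((sg - a) * (sg - d) - b * c)).
set z2 := w2 + _ - _; set z4 := w4 + _ - _.
have -> : z2 = 0 by rewrite /z2; field.
by have -> : z4 = 0 by rewrite /z4; field.
Qed.

(** Distinct real eigenvalues can be diagonalised inside SL2, in the prescribed order, by two shears
    and at most one quarter turn. *)
Lemma fam_diag s a b c d w2 w4 l1 l2 :
  a + d = l1 + l2 -> a * d - b * c = l1 * l2 -> l1 != l2 ->
  exists w2' w4', orb (fam s a b c d w2 w4) (fam s l1 0 0 l2 w2' w4').
Proof.
move=> htr hdet l12; have l12' : l1 - l2 != 0 by rewrite subr_eq0.
have [c0|c0] := eqVneq c 0.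
  have : (a - l1) * (a - l2) = 0.
    transitivity (a ^+ 2 - a * (l1 + l2) + l1 * l2); first ring.
    by rewrite -htr -hdet c0; ring.
  move=> /eqP; rewrite mulf_eq0 !subr_eq0 => /orP[] /eqP ha.
    exists w2, (w4 + - b / (l1 - l2) * w2).
    have hd : d = l2 by lra.
    apply: orb_trans (orb_shearU (- b / (l1 - l2)) _ _ _ _ _ _ _) _.
    rewrite c0 ha hd; have -> : b + - b / (l1 - l2) * (l1 - l2)
      - (- b / (l1 - l2)) ^+ 2 * 0 = 0 by field.
    by rewrite mul0r subr0 mulr0 addr0; exact: orb_refl.
  have hd : d = l1 by lra.
  exists (w4 + b / (l1 - l2) * w2), (- w2).
  apply: orb_trans (orb_shearU (b / (l1 - l2)) _ _ _ _ _ _ _) _.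
  apply: orb_trans (orb_rot _ _ _ _ _ _ _) _.
  rewrite c0 ha hd; have -> : b + b / (l1 - l2) * (l2 - l1)
    - (b / (l1 - l2)) ^+ 2 * 0 = 0 by field.
  by rewrite mul0r subr0 mulr0 addr0 oppr0; exact: orb_refl.
(* This upper shear puts [l1] and [l2] on the diagonal. The determinant then forces the entry [b] to
   vanish, and a lower shear removes [c]. *)
set p := (a - l1) / c; have hp : a - c * p = l1 by rewrite /p; field.
have hp2 : d + p * c = l2 by move: hp htr; lra.
have hb : b + p * (a - d) - p ^+ 2 * c = 0.
  apply: (mulfI c0); rewrite mulr0.
  have -> : c * (b + p * (a - d) - p ^+ 2 * c) =
    (a - c * p) * (d + p * c) - (a * d - b * c) by ring.
  by rewrite hp hp2 hdet subrr.
exists (w2 + c / (l1 - l2) * (w4 + p * w2)), (w4 + p * w2).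
apply: orb_trans (orb_shearU p _ _ _ _ _ _ _) _; rewrite hp hp2 hb.
apply: orb_trans (orb_shearL (c / (l1 - l2)) _ _ _ _ _ _ _) _.
have -> : c + c / (l1 - l2) * (l2 - l1) - (c / (l1 - l2)) ^+ 2 * 0 = 0 by field.
by rewrite mulr0 addr0 subr0; exact: orb_refl.
Qed.

(** An upper shear equalises the diagonal without touching [c]; the determinant fixes the remaining
    entry. *)
Lemma fam_sym s a b c d w2 w4 l : c != 0 -> a + d = 2 * l ->
  exists w2' w4', orb (fam s a b c d w2 w4)
    (fam s l ((l ^+ 2 - (a * d - b * c)) / c) c l w2' w4').
Proof.
move=> c0 htr; set p := (a - l) / c; exists w2, (w4 + p * w2).
have hp : a - c * p = l by rewrite /p; field.
have hp2 : d + p * c = l by move: hp htr; lra.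
have hb : b + p * (a - d) - p ^+ 2 * c = (l ^+ 2 - (a * d - b * c)) / c.
  apply: (mulfI c0); rewrite mulrCA mulfV // mulr1.
  have -> : c * (b + p * (a - d) - p ^+ 2 * c) =
    (a - c * p) * (d + p * c) - (a * d - b * c) by ring.
  by rewrite hp hp2 expr2.
by have := orb_shearU p s a b c d w2 w4; rewrite hp hp2 hb.
Qed.

(** A nonscalar matrix with a double eigenvalue becomes a Jordan block whose entry [c'] is either
    [c] or, after a quarter turn, [- b]. The last clause transports the sign, the invariant of the
    SL2 class. *)
Lemma fam_parabolic s a b c d w2 w4 l : a + d = 2 * l -> a * d - b * c = l ^+ 2 ->
  (b != 0) || (c != 0) ->
  exists c' w2' w4', [/\ c' != 0, orb (fam s a b c d w2 w4) (fam s l 0 c' l w2' w4') &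
    forall ep, 0 <= ep * c -> 0 <= - (ep * b) -> 0 <= ep * c'].
Proof.
move=> htr hdet bc0; have [c0|c0] := eqVneq c 0.
  have b0 : - b != 0 by move: bc0; rewrite c0 eqxx orbF oppr_eq0.
  have htr' : d + a = 2 * l by rewrite addrC.
  have [w2' [w4' h]] := fam_sym s (- c) w4 (- w2) b0 htr'.
  exists (- b), w2', w4'; split; [exact: b0| |by move=> ep _; rewrite mulrN].
  apply: orb_trans (orb_rot _ _ _ _ _ _ _) _.
  by move: h; rewrite (mulrC d) mulrNN (mulrC c) hdet subrr mul0r.
have [w2' [w4' h]] := fam_sym s b w2 w4 c0 htr.
exists c, w2', w4'; split; [exact: c0| |by move=> ep].
by move: h; rewrite hdet subrr mul0r.
Qed.

Lemma fam_elliptic s a b c d w2 w4 l m : a + d = 2 * l ->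
  a * d - b * c = l ^+ 2 + m ^+ 2 -> 0 < m ->
  exists eta w2' w4', [/\ eta ^+ 2 = 1,
    orb (fam s a b c d w2 w4) (fam s l (- (m * eta)) (m * eta) l w2' w4') &
    0 < eta * c].
Proof.
move=> htr hdet m0; have c0 : c != 0.
  apply/eqP => c0; have h : a * d - (l ^+ 2 + m ^+ 2) = 0 by rewrite -hdet c0; ring.
  have hd : d = 2 * l - a by lra.
  have : (a - l) ^+ 2 + m ^+ 2 = 0 by rewrite -oppr0 -h hd; ring.
  by apply/eqP; rewrite gt_eqF // ltr_wpDl ?sqr_ge0 // exprn_gt0.
have [w2' [w4' h]] := fam_sym s b w2 w4 c0 htr.
pose eta := Num.sg c; have e2 : eta ^+ 2 = 1 by rewrite /eta sqr_sg c0.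
have ce : c = eta * `|c| by rewrite -numEsg.
(* This scaling gives both off-diagonal entries absolute value [m]; only the sign [eta] of [c]
   remains. *)
pose k := Num.sqrt (m / `|c|).
have k0 : k != 0 by rewrite sqrtr_eq0 -ltNge divr_gt0 // normr_gt0.
have k2 : k ^+ 2 = m / `|c| by rewrite sqr_sqrtr // divr_ge0 // ltW.
have n0 : `|c| != 0 by rewrite normr_eq0.
have en : eta != 0 by rewrite /eta sgr_eq0.
have ei : eta^-1 = eta by apply: (mulfI en); rewrite mulfV // -expr2.
exists eta, (k * w2'), (w4' / k); split; [exact: e2| |]; last first.
  by rewrite ce mulrA -expr2 e2 mul1r normr_gt0.
apply: orb_trans h _.
have := orb_diag s l ((l ^+ 2 - (a * d - b * c)) / c) c l w2' w4' k0.
rewrite hdet k2; set z2 := _ / (m / _); set z4 := m / _ * c.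
have -> : z4 = m * eta by rewrite /z4 {2}ce mulrCA mulfVK // mulrC.
suff -> : z2 = - (m * eta) by [].
rewrite /z2 -[in RHS]ei; move: n0 ce; move: `|c| => n n0 ->.
field.
by rewrite n0 en gt_eqF.
Qed.

End LineFamily.

Section Labels.
Variable R : realType.
Implicit Types (a b c d s w x y p t k l m eta : R).

Definition bracket_gfam (la : label R) : bilin R :=
  match la with
  | mu0 => fam 0 0 0 0 0 0 0
  | mu1 => fam 0 0 0 0 0 1 0
  | mu2 => fam 1 0 0 0 0 0 0
  | mu3 => fam 0 (-1) 0 0 1 0 0
  | mu4 => fam 0 0 (-1) 1 0 0 0
  | mu5 l => gfam 1 0 0 0 0 (- l) 0 0 0 1
  | mu6 => gfam 1 0 0 0 1 0 0 0 (-1) 0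
  | mu7 => fam 0 0 0 1 0 0 1
  | mu8 => fam 1 0 1 0 0 0 0
  | mu9 => fam 1 0 (-1) 0 0 0 0
  | mu10 => fam (-1) 1 0 0 (-1) 0 (-1)
  | mu11 b => fam b (-1) 0 0 1 0 0
  | mu12 a => fam (- a^-1) (-1) 0 0 1 0 0
  | mu13 d => fam 1 0 d (- d) 0 0 0
  | mu14 d => fam 1 0 (- d) d 0 0 0
  | mu15 => fam 1 1 0 0 0 0 0
  | mu16 => fam 1 1 0 0 0 0 1
  | mu17 => fam 1 2 0 0 (-1) 0 0
  | mu18 => gfam 2 (-1) 0 0 1 0 0 0 1 0
  | mu19 => gfam 2 (-1) 0 0 1 0 0 0 (-1) 0
  | mu20 l => fam 1 l 0 0 (1 - l) 0 0
  | mu21 d => fam d (d / 2) 1 (-1) (d / 2) 0 0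
  | mu22 d => fam (- d) (- (d / 2)) 1 (-1) (- (d / 2)) 0 0
  | mu23 => fam 1 2^-1 1 0 2^-1 0 0
  | mu24 => fam 1 2^-1 (-1) 0 2^-1 0 0
  end.

Lemma bracket_ofE (la : label R) : bracket_of la = bracket_gfam la.
Proof.
apply: br_ext => x y; rewrite (vec_eta x) (vec_eta y).
move: (x _ _) (x _ _) (x _ _) (x _ _) => x1 x2 x3 x4.
move: (y _ _) (y _ _) (y _ _) (y _ _) => y1 y2 y3 y4.
case: la => [||||| l |||||| b | a | d | d |||||| l | d | d ||] /=.
  transitivity (0 : 'cV[R]_4).
    by rewrite /br big1 // => i _; rewrite big1 // => j _; rewrite [X in _ *: X]mxE scaler0.
  by rewrite br_gfam /= vec0; congr vec; ring.
all: rewrite /fam [RHS]br_gfam /= ?br_add !br_lb // /wedge_dual !vecE !eE.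
all: rewrite ?(vecZ, vecN, vecD) //; congr vec; by [ring | field].
Qed.

Lemma L_omega_bracket (la : label R) : L_omega R (bracket_of la).
Proof.
rewrite bracket_ofE.
by case: la => *; apply: gfam_Jacobi; by [ring | field].
Qed.

End Labels.

(** * Recognising listed orbits from the trace and determinant of the block *)

Section Recognition.
Variable R : realType.
Implicit Types (a b c d s w x y p t k l m eta : R).
Local Notation B := (@bracket_of R).

(** After scaling, M has eigenvalues [-1] and [1], and [s - (a + d) = be] is neither of them, so the
    [w] part vanishes. The admissible range of [mu11] is not imposed on [be]: [mu3] is [be = 0] and
    [mu12 a] is [be = - a^-1]. *)
Lemma rec_hyp be m s a b c d w2 w4 : m != 0 -> be ^+ 2 != 1 ->
  a + d = 0 -> a * d - b * c = - m ^+ 2 -> s = be * m ->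
  orb (fam s a b c d w2 w4) (B (mu11 be)).
Proof.
move=> m0 be1 htr hdet hs; rewrite bracket_ofE.
have mi : m^-1 != 0 by rewrite invr_eq0.
apply: orb_trans (orb_scale _ _ _ _ _ _ _ mi) _.
have [|||w2' [w4' h]] := @fam_diag _ (m^-1 * s) (m^-1 * a) (m^-1 * b) (m^-1 * c)
  (m^-1 * d) (m^-1 ^+ 2 * w2) (m^-1 ^+ 2 * w4) (-1) 1.
- by rewrite -mulrDr htr; ring.
- have -> : m^-1 * a * (m^-1 * d) - m^-1 * b * (m^-1 * c) =
    m^-1 ^+ 2 * (a * d - b * c) by ring.
  by rewrite hdet; field.
- by rewrite lt_eqF //; lra.
apply: orb_trans h _; have -> : m^-1 * s = be by rewrite hs; field.
apply: fam_w0; rewrite -subr_eq0 in be1.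
by have -> : (be - (-1 + 1) - -1) * (be - (-1 + 1) - 1) - 0 * 0 = be ^+ 2 - 1 by ring.
Qed.

(** A resonant case: [s] is an eigenvalue of M, so one coordinate of [w] resists translation. It can
    be scaled to [-1] if nonzero, which leaves two orbits. *)
Lemma rec_10_11 s a b c d w2 w4 : s != 0 ->
  a + d = 0 -> a * d - b * c = - s ^+ 2 ->
  orb (fam s a b c d w2 w4) (B mu10) \/ orb (fam s a b c d w2 w4) (B (mu11 (-1))).
Proof.
move=> s0 htr hdet; rewrite !bracket_ofE.
have mi : - s^-1 != 0 by rewrite oppr_eq0 invr_eq0.
have h0 := orb_scale s a b c d w2 w4 mi.
have [|||w2' [w4' h]] := @fam_diag _ (- s^-1 * s) (- s^-1 * a) (- s^-1 * b)
  (- s^-1 * c) (- s^-1 * d) ((- s^-1) ^+ 2 * w2) ((- s^-1) ^+ 2 * w4) 1 (-1).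
- by rewrite -mulrDr htr; ring.
- have -> : - s^-1 * a * (- s^-1 * d) - - s^-1 * b * (- s^-1 * c) =
    s^-1 ^+ 2 * (a * d - b * c) by ring.
  by rewrite hdet; field.
- by rewrite gt_eqF //; lra.
have {h0 h} h := orb_trans h0 h.
have h1 := orb_transl (w2' / 2) 0 (- s^-1 * s) 1 0 0 (-1) w2' w4'.
move: h1; set z2 := w2' + _ - _; set z4 := w4' + _ - _.
have -> : z2 = 0 by rewrite /z2; field.
have -> : z4 = w4' by rewrite /z4; ring.
have -> : - s^-1 * s = -1 by field.
rewrite (_ : - s^-1 * s = -1) in h; last by field.
move=> h1; have {h h1} h := orb_trans h h1.
have [w0|w0] := eqVneq w4' 0; [right|left].
  apply: orb_trans h _; rewrite w0.
  by have := orb_rot (-1) 1 0 0 (-1 : R) 0 0; rewrite /= oppr0.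
apply: orb_trans h _; have kn : - w4' != 0 by rewrite oppr_eq0.
have := orb_diag (-1) 1 0 0 (-1) 0 w4' kn.
by rewrite mul0r !mulr0 (_ : w4' / - w4' = -1) //; field.
Qed.

Lemma rec_2 s w2 w4 : s != 0 -> orb (fam s 0 0 0 0 w2 w4) (B mu2).
Proof.
move=> s0; rewrite bracket_ofE.
have si : s^-1 != 0 by rewrite invr_eq0.
apply: orb_trans (fam_w0 _ _ _) _.
  by rewrite (_ : _ - _ = s ^+ 2) ?expf_neq0 //; ring.
have := orb_scale s 0 0 0 0 0 0 si.
by rewrite !mulr0 mulVf.
Qed.

(* [eta] is the sign distinguishing [omega_+] from [omega_-]. *)
Lemma rec_8_9 s a b c d w2 w4 : s != 0 -> a + d = 0 -> a * d - b * c = 0 ->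
  (b != 0) || (c != 0) ->
  exists eta, [/\ eta ^+ 2 = 1, orb (fam s a b c d w2 w4) (fam 1 0 (- eta) 0 0 0 0) &
    forall ep, 0 <= ep * (s * c) -> 0 <= - (ep * (s * b)) -> 0 <= ep * eta].
Proof.
move=> s0 htr hdet bc; have si : s^-1 != 0 by rewrite invr_eq0.
have h0 := orb_scale s a b c d w2 w4 si.
have [|||c' [w2' [w4' [c0 h hs]]]] := @fam_parabolic _ (s^-1 * s) (s^-1 * a) (s^-1 * b)
  (s^-1 * c) (s^-1 * d) (s^-1 ^+ 2 * w2) (s^-1 ^+ 2 * w4) 0.
- by rewrite -mulrDr htr; ring.
- have -> : s^-1 * a * (s^-1 * d) - s^-1 * b * (s^-1 * c) =
    s^-1 ^+ 2 * (a * d - b * c) by ring.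
  by rewrite hdet; ring.
- by rewrite !mulf_eq0 !negb_or si.
have {h0 h} h := orb_trans h0 h; rewrite (mulVf s0) in h.
pose eta := Num.sg c'; have e2 : eta ^+ 2 = 1 by rewrite /eta sqr_sg c0.
have ce : c' = eta * `|c'| by rewrite -numEsg.
exists eta; split; [exact: e2| |].
  apply: orb_trans h _; apply: orb_trans (orb_rot _ _ _ _ _ _ _) _.
  have k0 : Num.sqrt `|c'| != 0 by rewrite sqrtr_eq0 -ltNge normr_gt0.
  apply: orb_trans (orb_diag _ _ _ _ _ _ _ k0) _.
  rewrite sqr_sqrtr // oppr0 mulr0 {1}ce mulNr mulfK ?normr_eq0 //.
  apply: fam_w0; rewrite (_ : _ - _ = 1) ?oner_neq0 //; ring.
move=> ep h1 h2; have P x : s^-1 * x = s^-1 ^+ 2 * (s * x) by field.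
have hh : 0 <= ep * c'.
  apply: hs; rewrite P mulrCA; first by rewrite mulr_ge0 ?sqr_ge0.
  by rewrite -mulrN mulr_ge0 ?sqr_ge0.
by move: hh; rewrite {1}ce mulrA pmulr_lge0 // normr_gt0.
Qed.

Lemma rec_13_14 de s a b c d w2 w4 : 0 < de -> s != 0 ->
  a + d = 0 -> a * d - b * c = de ^+ 2 * s ^+ 2 ->
  exists eta, [/\ eta ^+ 2 = 1,
    orb (fam s a b c d w2 w4) (fam 1 0 (- (de * eta)) (de * eta) 0 0 0) &
    0 < eta * (s * c)].
Proof.
move=> de0 s0 htr hdet; have si : s^-1 != 0 by rewrite invr_eq0.
have h0 := orb_scale s a b c d w2 w4 si.
have [|||eta [w2' [w4' [e2 h hs]]]] := @fam_elliptic _ (s^-1 * s) (s^-1 * a) (s^-1 * b)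
  (s^-1 * c) (s^-1 * d) (s^-1 ^+ 2 * w2) (s^-1 ^+ 2 * w4) 0 de.
- by rewrite -mulrDr htr; ring.
- have -> : s^-1 * a * (s^-1 * d) - s^-1 * b * (s^-1 * c) =
    s^-1 ^+ 2 * (a * d - b * c) by ring.
  by rewrite hdet; field.
- exact: de0.
have {h0 h} h := orb_trans h0 h; rewrite (mulVf s0) in h.
exists eta; split; [exact: e2| |].
  apply: orb_trans h _; apply: fam_w0.
  rewrite (_ : _ - _ = 1 + de ^+ 2 * eta ^+ 2); last by ring.
  by rewrite e2 mulr1 gt_eqF // ltr_wpDr ?sqr_ge0.
move: hs; rewrite (_ : eta * (s^-1 * c) = s^-1 ^+ 2 * (eta * (s * c))); last by field.
by rewrite pmulr_rgt0 // exprn_even_gt0.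
Qed.

Lemma rec_4 m a b c d w2 w4 : m != 0 ->
  a + d = 0 -> a * d - b * c = m ^+ 2 -> orb (fam 0 a b c d w2 w4) (B mu4).
Proof.
move=> m0 htr hdet; rewrite bracket_ofE; have mi : m^-1 != 0 by rewrite invr_eq0.
have h0 := orb_scale 0 a b c d w2 w4 mi.
have [|||eta [w2' [w4' [e2 h hs]]]] := @fam_elliptic _ (m^-1 * 0) (m^-1 * a) (m^-1 * b)
  (m^-1 * c) (m^-1 * d) (m^-1 ^+ 2 * w2) (m^-1 ^+ 2 * w4) 0 1.
- by rewrite -mulrDr htr; ring.
- have -> : m^-1 * a * (m^-1 * d) - m^-1 * b * (m^-1 * c) =
    m^-1 ^+ 2 * (a * d - b * c) by ring.
  by rewrite hdet; field.
- by [].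
have {h0 h} h := orb_trans h0 h; rewrite mulr0 mul1r in h.
have {}h : orb (fam 0 a b c d w2 w4) (fam 0 0 (- eta) eta 0 0 0).
  apply: orb_trans h _; apply: fam_w0.
  rewrite (_ : _ - _ = eta ^+ 2); last by ring.
  by rewrite e2 oner_neq0.
have en : eta != 0 by rewrite -sqrf_eq0 e2 oner_neq0.
apply: orb_trans h _; have := orb_scale 0 0 (- eta) eta 0 0 0 en.
by rewrite !mulr0 mulrN -expr2 e2.
Qed.

Lemma rec_20 la s a b c d w2 w4 : s != 0 -> a + d = s ->
  a * d - b * c = la * (1 - la) * s ^+ 2 -> la * (1 - la) != 0 -> la != 2^-1 ->
  orb (fam s a b c d w2 w4) (fam 1 la 0 0 (1 - la) 0 0).
Proof.
move=> s0 htr hdet la0 la2; have si : s^-1 != 0 by rewrite invr_eq0.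
have h0 := orb_scale s a b c d w2 w4 si.
have [|||w2' [w4' h]] := @fam_diag _ (s^-1 * s) (s^-1 * a) (s^-1 * b) (s^-1 * c)
  (s^-1 * d) (s^-1 ^+ 2 * w2) (s^-1 ^+ 2 * w4) la (1 - la).
- by rewrite -mulrDr htr mulVf //; ring.
- have -> : s^-1 * a * (s^-1 * d) - s^-1 * b * (s^-1 * c) =
    s^-1 ^+ 2 * (a * d - b * c) by ring.
  by rewrite hdet; field.
- by apply: contra la2 => /eqP h; apply/eqP; lra.
have {h0 h} h := orb_trans h0 h; rewrite (mulVf s0) in h.
apply: orb_trans h _; apply: fam_w0.
by rewrite (_ : _ - _ = la * (1 - la)) //; ring.
Qed.

Lemma rec_20h s w2 w4 : s != 0 ->
  orb (fam s (s / 2) 0 0 (s / 2) w2 w4) (B (mu20 2^-1)).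
Proof.
move=> s0; rewrite bracket_ofE; have si : s^-1 != 0 by rewrite invr_eq0.
apply: orb_trans (fam_w0 _ _ _) _.
  rewrite (_ : _ - _ = (s / 2) ^+ 2); last by field.
  by rewrite expf_neq0 // mulf_neq0 // invr_eq0 pnatr_eq0.
have := orb_scale s (s / 2) 0 0 (s / 2) 0 0 si.
rewrite !mulr0 mulVf // (_ : s^-1 * (s / 2) = 2^-1); last by field.
by rewrite /= (_ : 1 - 2^-1 = 2^-1 :> R) //; field.
Qed.

(** The resonance for weight [1/2]: [s - (a + d) = 0] is an eigenvalue of M, and the surviving [w4]
    is zero or scaled to [1]. *)
Lemma rec_15_16 s a b c d w2 w4 : s != 0 -> a + d = s -> a * d - b * c = 0 ->
  orb (fam s a b c d w2 w4) (B mu15) \/ orb (fam s a b c d w2 w4) (B mu16).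
Proof.
move=> s0 htr hdet; rewrite !bracket_ofE; have si : s^-1 != 0 by rewrite invr_eq0.
have h0 := orb_scale s a b c d w2 w4 si.
have [|||w2' [w4' h]] := @fam_diag _ (s^-1 * s) (s^-1 * a) (s^-1 * b) (s^-1 * c)
  (s^-1 * d) (s^-1 ^+ 2 * w2) (s^-1 ^+ 2 * w4) 1 0.
- by rewrite -mulrDr htr mulVf //; ring.
- have -> : s^-1 * a * (s^-1 * d) - s^-1 * b * (s^-1 * c) =
    s^-1 ^+ 2 * (a * d - b * c) by ring.
  by rewrite hdet; field.
- exact: oner_neq0.
have {h0 h} h := orb_trans h0 h; rewrite (mulVf s0) in h.
have h1 := orb_transl w2' 0 1 1 0 0 0 w2' w4'.
move: h1; set z2 := w2' + _ - _; set z4 := w4' + _ - _.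
have -> : z2 = 0 by rewrite /z2; ring.
have -> : z4 = w4' by rewrite /z4; ring.
move=> h1; have {h h1} h := orb_trans h h1.
have [w0|w0] := eqVneq w4' 0; [left|right].
  by rewrite w0 in h.
apply: orb_trans h _; have := orb_diag 1 1 0 0 0 0 w4' w0.
by rewrite mul0r !mulr0 mulfV.
Qed.

Lemma rec_23_24 s a b c d w2 w4 : s != 0 -> a + d = s -> a * d - b * c = s ^+ 2 / 4 ->
  (b != 0) || (c != 0) ->
  exists eta, [/\ eta ^+ 2 = 1,
    orb (fam s a b c d w2 w4) (fam 1 2^-1 (- eta) 0 2^-1 0 0) &
    forall ep, 0 <= ep * (s * c) -> 0 <= - (ep * (s * b)) -> 0 <= ep * eta].
Proof.
move=> s0 htr hdet bc; have si : s^-1 != 0 by rewrite invr_eq0.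
have h0 := orb_scale s a b c d w2 w4 si.
have [|||c' [w2' [w4' [c0 h hs]]]] := @fam_parabolic _ (s^-1 * s) (s^-1 * a) (s^-1 * b)
  (s^-1 * c) (s^-1 * d) (s^-1 ^+ 2 * w2) (s^-1 ^+ 2 * w4) 2^-1.
- by rewrite -mulrDr htr; field.
- have -> : s^-1 * a * (s^-1 * d) - s^-1 * b * (s^-1 * c) =
    s^-1 ^+ 2 * (a * d - b * c) by ring.
  by rewrite hdet; field.
- by rewrite !mulf_eq0 !negb_or si.
have {h0 h} h := orb_trans h0 h; rewrite (mulVf s0) in h.
pose eta := Num.sg c'; have e2 : eta ^+ 2 = 1 by rewrite /eta sqr_sg c0.
have ce : c' = eta * `|c'| by rewrite -numEsg.
exists eta; split; [exact: e2| |].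
  apply: orb_trans h _; apply: orb_trans (orb_rot _ _ _ _ _ _ _) _.
  have k0 : Num.sqrt `|c'| != 0 by rewrite sqrtr_eq0 -ltNge normr_gt0.
  apply: orb_trans (orb_diag _ _ _ _ _ _ _ k0) _.
  rewrite sqr_sqrtr // oppr0 mulr0 {1}ce mulNr mulfK ?normr_eq0 //.
  apply: fam_w0; rewrite (_ : _ - _ = 2^-1 ^+ 2); last by field.
  by rewrite expf_neq0 // invr_eq0 pnatr_eq0.
move=> ep h1 h2; have P x : s^-1 * x = s^-1 ^+ 2 * (s * x) by field.
have hh : 0 <= ep * c'.
  apply: hs; rewrite P mulrCA; first by rewrite mulr_ge0 ?sqr_ge0.
  by rewrite -mulrN mulr_ge0 ?sqr_ge0.
by move: hh; rewrite {1}ce mulrA pmulr_lge0 // normr_gt0.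
Qed.

(** Negative [de] is allowed, so that [mu22 d] is treated as the parameter [- d] of the shape of
    [mu21]. *)
Lemma rec_21_22 de s a b c d w2 w4 : de != 0 -> s != 0 -> a + d = s ->
  a * d - b * c = (4^-1 + de^-1 ^+ 2) * s ^+ 2 ->
  exists eta, [/\ eta ^+ 2 = 1,
    orb (fam s a b c d w2 w4) (fam de (de / 2) (- eta) eta (de / 2) 0 0) &
    0 < eta * (de * (s * c))].
Proof.
move=> de0 s0 htr hdet; have ti : de / s != 0 by rewrite mulf_neq0 ?invr_eq0.
have h0 := orb_scale s a b c d w2 w4 ti.
have [|||eta [w2' [w4' [e2 h hs]]]] := @fam_elliptic _ (de / s * s) (de / s * a)
  (de / s * b) (de / s * c) (de / s * d) ((de / s) ^+ 2 * w2) ((de / s) ^+ 2 * w4)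
  (de / 2) 1.
- by rewrite -mulrDr htr; field.
- have -> : de / s * a * (de / s * d) - de / s * b * (de / s * c) =
    (de / s) ^+ 2 * (a * d - b * c) by ring.
  by rewrite hdet; field; rewrite de0.
- by [].
have {h0 h} h := orb_trans h0 h; rewrite divfK // mul1r in h.
exists eta; split; [exact: e2| |].
  apply: orb_trans h _; apply: fam_w0.
  rewrite (_ : _ - _ = (de / 2) ^+ 2 + eta ^+ 2); last by field.
  by rewrite e2 gt_eqF // ltr_wpDl ?sqr_ge0.
move: hs; rewrite (_ : eta * (de / s * c) = s^-1 ^+ 2 * (eta * (de * (s * c)))).
  by rewrite pmulr_rgt0 // exprn_even_gt0 // invr_eq0.
by field.
Qed.

Lemma fifth_root x : x != 0 -> exists2 t, t != 0 & t ^+ 5 = x.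
Proof.
move=> x0; have n0 : 0 < `|x| by rewrite normr_gt0.
have r5 : (`|x| `^ (5%:R^-1)) ^+ 5 = `|x|.
  by rewrite -powR_mulrn ?powR_ge0 // -powRrM mulVf ?pnatr_eq0 // powRr1 // ltW.
exists (Num.sg x * `|x| `^ (5%:R^-1)).
  by rewrite mulf_neq0 ?sgr_eq0 // gt_eqF // powR_gt0.
rewrite exprMn r5 (_ : Num.sg x ^+ 5 = Num.sg x) -?numEsg //.
by rewrite 2!exprSr -mulrA -expr2 (exprD _ 1 2) expr1 sqr_sg x0 !mulr1.
Qed.

(** Scaling by [t] and [k] sends [c] to [k^2 t c] and [w4] to [t^2 w4 / k]. Both become [1] for
    [k = t^2 w4] and [t^5 c w4^2 = 1], whence the fifth root. *)
Lemma rec_nil c w4 (w2 : R) : c != 0 -> w4 != 0 -> orb (fam 0 0 0 c 0 w2 w4) (B mu7).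
Proof.
move=> c0 w0; rewrite bracket_ofE.
have h0 := orb_transl 0 (w2 / c) 0 0 0 c 0 w2 w4.
move: h0; set z2 := w2 + _ - _; set z4 := w4 + _ - _.
have -> : z2 = 0 by rewrite /z2; field.
have -> : z4 = w4 by rewrite /z4; ring.
move=> h; apply: orb_trans h _.
have [|t t0 t5] := @fifth_root (c * w4 ^+ 2)^-1.
  by rewrite invr_eq0 mulf_neq0 // expf_neq0.
apply: orb_trans (orb_scale _ _ _ _ _ _ _ t0) _.
have k0 : t ^+ 2 * w4 != 0 by rewrite mulf_neq0 // expf_neq0.
apply: orb_trans (orb_diag _ _ _ _ _ _ _ k0) _.
rewrite !mulr0 mul0r mulfV //.
suff -> : (t ^+ 2 * w4) ^+ 2 * (t * c) = 1 by exact: orb_refl.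
have -> : (t ^+ 2 * w4) ^+ 2 * (t * c) = t ^+ 5 * (c * w4 ^+ 2) by ring.
by rewrite t5 mulVf // mulf_neq0 // expf_neq0.
Qed.

Lemma rec_1c c w2 : c != 0 -> orb (fam 0 0 0 c 0 w2 0) (B mu1).
Proof.
move=> c0; rewrite bracket_ofE.
have h0 := orb_transl 0 (w2 / c) 0 0 0 c 0 w2 0.
move: h0; set z2 := w2 + _ - _; set z4 := 0 + _ - _.
have -> : z2 = 0 by rewrite /z2; field.
have -> : z4 = 0 by rewrite /z4; ring.
move=> h; apply: orb_trans h _.
(* The two symplectic planes are exchanged, so that the centre direction [e4] becomes [e3]. *)
by orb_tac (0, 1, 0, 0) (- c^-1, 0, 0, 0) (0, 0, 0, 1) (0, 0, - c, 0).
Qed.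

Lemma rec_1w w2 w4 : (w2 != 0) || (w4 != 0) -> orb (fam 0 0 0 0 0 w2 w4) (B mu1).
Proof.
have key x y : x != 0 -> orb (fam 0 0 0 0 0 x y) (B mu1).
  move=> x0; rewrite bracket_ofE.
  apply: orb_trans (orb_shearU (- y / x) _ _ _ _ _ _ _) _.
  rewrite !(mulr0, mul0r, subr0, addr0, add0r, oppr0) divfK // subrr.
  have xi : x^-1 != 0 by rewrite invr_eq0.
  have := orb_diag 0 0 0 0 0 x 0 xi.
  by rewrite !(mulr0, mul0r) mulVf.
move=> /orP[w0|w0]; first exact: key.
apply: orb_trans (orb_rot _ _ _ _ _ _ _) _; rewrite oppr0; exact: key.
Qed.

Lemma rec_nilpotent a b c d w2 w4 : a + d = 0 -> a * d - b * c = 0 ->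
  [\/ orb (fam 0 a b c d w2 w4) (B mu7), orb (fam 0 a b c d w2 w4) (B mu1)
    | orb (fam 0 a b c d w2 w4) (B mu0)].
Proof.
move=> htr hdet; have [/norP[/negPn/eqP b0 /negPn/eqP c0]|bc] :=
  boolP (~~ ((b != 0) || (c != 0))).
  have a0 : a = 0.
    have : a ^+ 2 = 0 by rewrite (_ : d = - a) in hdet; [move: hdet; rewrite b0; lra|lra].
    by move/eqP; rewrite sqrf_eq0 => /eqP.
  rewrite b0 c0 a0 (_ : d = 0); last by move: htr; rewrite a0 add0r.
  have [/norP[/negPn/eqP -> /negPn/eqP ->]|w0] :=
    boolP (~~ ((w2 != 0) || (w4 != 0))).
    by apply: Or33; rewrite bracket_ofE; exact: orb_refl.
  by apply: Or32; apply: rec_1w; rewrite negbK in w0.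
rewrite negbK in bc.
have [||c' [w2' [w4' [c0 h _]]]] := @fam_parabolic _ 0 a b c d w2 w4 0 _ _ bc.
- by rewrite mulr0.
- by rewrite hdet expr0n.
have [w0|w0] := eqVneq w4' 0.
  by apply: Or32; apply: orb_trans h _; rewrite w0; exact: rec_1c.
by apply: Or31; apply: orb_trans h _; exact: rec_nil.
Qed.

End Recognition.

(** * Limits of the listed orbits *)

Section LineLimits.
Variable R : realType.
Implicit Types (a b c d s w x y p t k l m eta ep al : R).
Implicit Types (mu nu : bilin R) (la : label R).
Local Notation B := (@bracket_of R).

Definition chain := clos_refl_trans (label R) (@arrow R).

Definition below la nu := exists2 lb, chain la lb & orb nu (B lb).

Lemma belowI la lb nu : chain la lb -> orb nu (B lb) -> below la nu.
Proof. by move=> h1 h2; exists lb. Qed.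

Lemma below_orb la nu nu' : orb nu nu' -> below la nu' -> below la nu.
Proof. by move=> h [lb h1 h2]; exists lb => //; exact: orb_trans h2. Qed.

Lemma omega_e3 (v : 'cV[R]_4) : omega_cn (e 3) v = - v (idx 1) 0.
Proof. by rewrite (vec_eta v) e3E omegaE !vecE; ring. Qed.

Lemma omega_e (v : 'cV[R]_4) : [/\ omega_cn v (e 1) = - v (idx 3) 0,
  omega_cn v (e 2) = - v (idx 4) 0, omega_cn v (e 3) = v (idx 1) 0
  & omega_cn v (e 4) = v (idx 2) 0].
Proof. by rewrite (vec_eta v) !eE !omegaE !vecE; split; ring. Qed.

(** Orthogonality of [e3] to the derived algebra kills the [e1]-components, the eigenvector
    condition fixes the brackets with [e3], and closedness of the form links the remaining
    entries. *)
Lemma line_normal_form k nu v : L_omega R nu -> k != 0 -> rel_line k nu (e 3) v ->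
  exists s a b c d w2 w4, nu = fam s a b c d w2 w4 /\ s = k * (a + s + d).
Proof.
move=> [[alt _] cl] k0 [h1 h2].
have A (x y : 'cV[R]_4) : br nu x y = - br nu y x by apply: alt_br.
set n12 := br nu (e 1) (e 2); set n13 := br nu (e 1) (e 3).
set n14 := br nu (e 1) (e 4); set n23 := br nu (e 2) (e 3).
set n24 := br nu (e 2) (e 4); set n34 := br nu (e 3) (e 4).
have T1 : trad nu (e 1) = n12 (idx 2) 0 + n13 (idx 3) 0 + n14 (idx 4) 0.
  by rewrite /trad sum4 -!/(e _) alt mxE add0r.
have T2 : trad nu (e 2) = - n12 (idx 1) 0 + n23 (idx 3) 0 + n24 (idx 4) 0.
  by rewrite /trad sum4 -!/(e _) alt (A _ (e 1)) !mxE addr0.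
have T3 : trad nu (e 3) = - n13 (idx 1) 0 - n23 (idx 2) 0 + n34 (idx 4) 0.
  by rewrite /trad sum4 -!/(e _) alt (A _ (e 1)) (A _ (e 2)) !mxE addr0.
have T4 : trad nu (e 4) = - n14 (idx 1) 0 - n24 (idx 2) 0 - n34 (idx 3) 0.
  by rewrite /trad sum4 -!/(e _) alt (A _ (e 1)) (A _ (e 2)) (A _ (e 3)) !mxE addr0.
have C (i j l : nat) := cl (e i) (e j) (e l).
move: (C 1 2 3) (C 1 3 4) (C 1 2 4); rewrite (A (e 3) (e 1)) (A (e 4) (e 1)).
rewrite !omegaNl -/n12 -/n13 -/n14 -/n23 -/n24 -/n34.
have oE (n : 'cV[R]_4) := omega_e n.
case: (oE n12) (oE n13) (oE n14) (oE n23) => [q121 q122 q123 q124] [q131 q132 q133 q134].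
move=> [q141 q142 q143 q144] [q231 q232 q233 q234].
case: (oE n24) (oE n34) => [q241 q242 q243 q244] [q341 q342 q343 q344].
rewrite q123 q231 q132 q134 q341 q143 q124 q241 q142.
have z (i j : nat) : br nu (e i) (e j) (idx 1) 0 = 0.
  by have := h1 (e i) (e j); rewrite omega_e3 => /eqP; rewrite oppr_eq0 => /eqP.
have [z12 z13 z14] : [/\ n12 (idx 1) 0 = 0, n13 (idx 1) 0 = 0 & n14 (idx 1) 0 = 0].
  by split; exact: z.
have [z23 z24 z34] : [/\ n23 (idx 1) 0 = 0, n24 (idx 1) 0 = 0 & n34 (idx 1) 0 = 0].
  by split; exact: z.
rewrite !z12 !z13 !z14 in T1 T2 T3 T4 *.
have w (i j : nat) : omega_cn (e 3) (e j) = 0 :> R -> omega_cn (br nu (e i) (e 3)) (e j) = 0.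
  by move=> h; rewrite h2 h mulr0.
have e33 : omega_cn (e 3) (e 3) = 0 :> R by rewrite omegaxx.
have e32 : omega_cn (e 3) (e 2) = 0 :> R by rewrite !eE omegaE; ring.
have e34 : omega_cn (e 3) (e 4) = 0 :> R by rewrite !eE omegaE; ring.
have e31 : omega_cn (e 3) (e 1) = -1 :> R by rewrite !eE omegaE; ring.
move: (w 1%N 2%N e32) (w 1%N 4%N e34) (w 2%N 2%N e32) (w 2%N 4%N e34).
rewrite -/n13 -/n23 q132 q134 q232 q234 => w1 w2 w3 w4.
move: (w 4%N 2%N e32) (w 4%N 4%N e34); rewrite (A (e 4)) !omegaNl -/n34 q342 q344.
move=> w5 w6 c1 c2 c3.
move: (h2 (e 1) (e 1)) (h2 (e 2) (e 1)) (h2 (e 4) (e 1)).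
rewrite (A (e 4)) !omegaNl -/n13 -/n23 -/n34 q131 q231 q341 e31 T1 T2 T4 => k1 k2 k3.
have n233 : n23 (idx 3) 0 = 0 by move: c1 w1 z12; clear; lra.
have n343 : n34 (idx 3) 0 = 0 by move: c2 w2 z14; clear; lra.
(* The weight of [e3] under [ad e2] is zero and equals [k tr (ad e2)]; as [k] is nonzero, the trace
   vanishes. The same argument with [e4] follows. *)
have n244 : n24 (idx 4) 0 = 0.
  by apply: (mulfI k0); rewrite mulr0; move: k2; rewrite n233; clear; lra.
have n242 : n24 (idx 2) 0 = 0.
  by apply: (mulfI k0); rewrite mulr0; move: k3; rewrite n343; clear; lra.
exists (n13 (idx 3) 0), (n12 (idx 2) 0), (n14 (idx 2) 0), (n12 (idx 4) 0),
  (n14 (idx 4) 0), (n12 (idx 3) 0), (n14 (idx 3) 0).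
split; last by move: k1; clear; lra.
rewrite {1}(mk_eta alt) -/n12 -/n13 -/n14 -/n23 -/n24 -/n34 /fam /gfam.
rewrite {1}(vec_eta n12) {1}(vec_eta n13) {1}(vec_eta n14) {1}(vec_eta n23).
rewrite {1}(vec_eta n24) {1}(vec_eta n34) z12 z13 z14 z23 z24 z34 n233 n343 n244 n242.
rewrite vec0.
have n134 : n13 (idx 4) 0 = 0 by move: w1; clear; lra.
have n234 : n23 (idx 4) 0 = 0 by move: w3; clear; lra.
have n344 : n34 (idx 4) 0 = 0 by move: w5; clear; lra.
have n342 : n34 (idx 2) 0 = 0 by move: w6; clear; lra.
have n243 : n24 (idx 3) 0 = n12 (idx 2) 0 + n14 (idx 4) 0 by move: c3; clear; lra.
by rewrite n243 w2 n134 n234 w4 n344 n342.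
Qed.

Lemma line_fam k s a b c d w2 w4 al v : s = k * (a + s + d) ->
  rel_line k (fam s a b c d w2 w4) (vec 0 0 al 0) v.
Proof.
move=> h; split; do 2 apply: all_vec => ? ? ? ?; rewrite !gfamE /=; first by ring.
have h' : k * a = s - k * s - k * d by move: h; clear; lra.
by ring: h'.
Qed.

Lemma trace_fam p q s a b c d w2 w4 u v :
  p * (a ^+ 2 + s ^+ 2 + d ^+ 2 + 2 * b * c) = q * (a + s + d) ^+ 2 ->
  rel_trace p q (fam s a b c d w2 w4) u v.
Proof.
move=> h; apply: all_vec => x ? ? ?; rewrite !gfamE.
transitivity (x ^+ 2 * (p * (a ^+ 2 + s ^+ 2 + d ^+ 2 + 2 * b * c))); first by ring.
by rewrite h; ring.
Qed.

Lemma trace_fam' p q s a b c d w2 w4 u v :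
  rel_trace p q (fam s a b c d w2 w4) u v ->
  p * (a ^+ 2 + s ^+ 2 + d ^+ 2 + 2 * b * c) = q * (a + s + d) ^+ 2.
Proof. by move=> /(_ (e 1)); rewrite eE !gfamE => h; lra. Qed.

Lemma traceI_fam ep q s a b c d w2 w4 u v :
  0 <= ep * (a ^+ 2 + s ^+ 2 + d ^+ 2 + 2 * b * c - q * (a + s + d) ^+ 2) ->
  rel_traceI ep q (fam s a b c d w2 w4) u v.
Proof.
move=> h; apply: all_vec => x ? ? ?; rewrite !gfamE.
have := mulr_ge0 (sqr_ge0 x) h; congr (0 <= _); ring.
Qed.

Lemma traceI_fam' ep q s a b c d w2 w4 u v :
  rel_traceI ep q (fam s a b c d w2 w4) u v ->
  0 <= ep * (a ^+ 2 + s ^+ 2 + d ^+ 2 + 2 * b * c - q * (a + s + d) ^+ 2).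
Proof. by move=> /(_ (e 1)); rewrite eE !gfamE; congr (0 <= _); ring. Qed.

Lemma unimod_fam s a b c d w2 w4 u v : a + s + d = 0 ->
  rel_unimod (fam s a b c d w2 w4) u v.
Proof. by move=> h; apply: all_vec => x ? ? ?; rewrite !gfamE h; ring. Qed.

Lemma unimod_fam' s a b c d w2 w4 u v :
  rel_unimod (fam s a b c d w2 w4) u v -> a + s + d = 0.
Proof. by move=> /(_ (e 1)); rewrite eE !gfamE => h; lra. Qed.

Lemma sign_fam ep s a b c d w2 w4 al v :
  (forall x y, 0 <= ep * ((a + s + d) * (c * x ^+ 2 + (d - a) * (x * y) - b * y ^+ 2))) ->
  rel_sign ep (fam s a b c d w2 w4) (vec 0 0 al 0) v.
Proof.
move=> h; apply: all_vec => x1 x2 x3 x4; apply: all_vec => y1 y2 y3 y4.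
apply: all_vec => z1 z2 z3 z4; rewrite !gfamE /=.
have := mulr_ge0 (sqr_ge0 x1) (h (- al * (z1 * y2 - y1 * z2)) (- al * (z1 * y4 - y1 * z4))).
by congr (0 <= _); ring.
Qed.

Lemma sign_fam' ep s a b c d w2 w4 v :
  rel_sign ep (fam s a b c d w2 w4) (e 3) v ->
  0 <= ep * ((a + s + d) * c) /\ 0 <= - (ep * ((a + s + d) * b)).
Proof.
move=> h; move: (h (e 1) (e 2) (e 1)) (h (e 1) (e 4) (e 1)).
by rewrite !eE !gfamE /= => h1 h2; split; [move: h1|move: h2]; congr (0 <= _); ring.
Qed.

Lemma scalar_fam s a w2 w4 al v :
  rel_scalar (fam s a 0 0 a w2 w4) (vec 0 0 al 0) v.
Proof. by do 3 apply: all_vec => ? ? ? ?; rewrite !gfamE /=; ring. Qed.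

Lemma scalar_fam' s a b c d w2 w4 v :
  rel_scalar (fam s a b c d w2 w4) (e 3) v -> [/\ b = 0, c = 0 & a = d].
Proof.
move=> h; move: (h (e 1) (e 2) (e 1)) (h (e 1) (e 4) (e 1)) (h (e 1) (vec 0 1 0 1) (e 1)).
by rewrite !eE !gfamE /= => h1 h2 h3; split; lra.
Qed.

End LineLimits.

Section LineLabels.
Variable R : realType.
Implicit Types (a b c d s w x y p t k l m eta ep al be : R).
Implicit Types (mu nu : bilin R) (la : label R).
Local Notation B := (@bracket_of R).

Lemma chain71 : chain (@mu7 R) mu1.
Proof. by apply: rt_step; constructor. Qed.

Lemma chain10 : chain (@mu1 R) mu0.
Proof. by apply: rt_step; constructor. Qed.

Lemma chain_trans (la lb lc : label R) : chain la lb -> chain lb lc -> chain la lc.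
Proof. by move=> h1 h2; apply: rt_trans h1 h2. Qed.

(** The scheme for every label of the line family: limits stay in that family with the same weight
    [k], so what remains is to solve [Q] in the structure constants. *)
Lemma fam_limit la k (Q : bilin R -> 'cV[R]_4 -> 'cV[R]_4 -> Prop)
    s0 a0 b0 c0 d0 z2 z4 nu :
  k != 0 -> good Q -> s0 = k * (a0 + s0 + d0) ->
  (forall al v, Q (fam s0 a0 b0 c0 d0 z2 z4) (vec 0 0 al 0) v) ->
  L_omega R nu -> closure (orb (fam s0 a0 b0 c0 d0 z2 z4)) nu ->
  (forall s a b c d w2 w4, s = k * (a + s + d) ->
     Q (fam s a b c d w2 w4) (e 3) (e 4) -> below la (fam s a b c d w2 w4)) ->
  below la nu.
Proof.
move=> k0 gQ hs hQ Lnu clnu hyp.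
have [al be ga|nu' o [hl hq]] := frame_limit (good_and (good_line k) gQ) _ clnu.
  by split; [exact: line_fam|exact: hQ].
have [s [a [b [c [d [w2 [w4 [E hs']]]]]]]] :=
  line_normal_form (L_omega_orb o Lnu) k0 hl.
by apply: below_orb o _; rewrite E; apply: hyp => //; rewrite -E.
Qed.

Lemma below_nilpotent la a b c d w2 w4 : chain la mu7 -> a + d = 0 ->
  a * d - b * c = 0 -> below la (fam 0 a b c d w2 w4).
Proof.
move=> h h1 h2; have [h3|h3|h3] := rec_nilpotent w2 w4 h1 h2; apply: belowI h3.
- exact: h.
- exact: chain_trans h chain71.
- exact: chain_trans h (chain_trans chain71 chain10).
Qed.

Lemma mu7_two_step : ~ rel_two_step (B mu7) 0 0.
Proof.
rewrite bracket_ofE => /(_ (e 1) (e 1) (e 2) (e 1)).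
by rewrite !eE !gfamE /= => h; lra.
Qed.

Lemma below_two_step la a b c d w2 w4 : chain la mu1 -> a + d = 0 ->
  a * d - b * c = 0 -> rel_two_step (fam 0 a b c d w2 w4) 0 0 ->
  below la (fam 0 a b c d w2 w4).
Proof.
move=> h h1 h2 ts; have [h3|h3|h3] := rec_nilpotent w2 w4 h1 h2; last 2 first.
- by apply: belowI h3.
- by apply: belowI h3; exact: chain_trans h chain10.
by case: mu7_two_step; exact: good_orb (good_two_step R) h3 ts.
Qed.

Lemma lim0 nu : closure (orb (B mu0)) nu -> below mu0 nu.
Proof.
move=> cl.
have [al be ga|nu' o hz] := frame_limit (good_abelian R) _ cl.
  by rewrite bracket_ofE; do 3 apply: all_vec => ? ? ? ?; rewrite !gfamE /=; ring.
apply: below_orb o _; exists mu0; first exact: rt_refl.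
suff -> : nu' = B mu0 by exact: orb_refl.
apply: br_ext => x y; apply: omega_nondeg => z; rewrite hz; apply/esym.
rewrite bracket_ofE; move: x y z; do 3 apply: all_vec => ? ? ? ?.
by rewrite !gfamE /=; ring.
Qed.

Lemma lim1 nu : L_omega R nu -> closure (orb (B mu1)) nu -> below mu1 nu.
Proof.
rewrite bracket_ofE => L cl.
apply: (fam_limit (oner_neq0 R) (good_two_step R) _ _ L cl); first by ring.
  by move=> al v; do 4 apply: all_vec => ? ? ? ?; rewrite !gfamE /=; ring.
move=> s a b c d w2 w4 hs ts.
have s0 : s = 0.
  have := ts (e 1) (e 1) (e 3) (e 1); rewrite !eE !gfamE /= => h.
  by apply/eqP; rewrite -sqrf_eq0; apply/eqP; lra.
have htr : a + d = 0 by lra.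
have hd : d = - a by lra.
have hdet : a * d - b * c = 0.
  by have := ts (e 1) (e 1) (e 2) (e 4); rewrite !eE !gfamE /= hd; clear; lra.
rewrite s0 in ts *; apply: below_two_step htr hdet ts; exact: rt_refl.
Qed.

Lemma below_scalar0 la w2 w4 : chain la mu1 -> below la (fam 0 0 0 0 0 w2 w4).
Proof.
move=> h; apply: below_two_step => //; do ?ring.
by do 4 apply: all_vec => ? ? ? ?; rewrite !gfamE /=; ring.
Qed.

Lemma lim2 nu : L_omega R nu -> closure (orb (B mu2)) nu -> below mu2 nu.
Proof.
rewrite bracket_ofE => L cl.
apply: (fam_limit (oner_neq0 R) (good_scalar R) _ _ L cl); first by ring.
  by move=> al v; exact: scalar_fam.
move=> s a b c d w2 w4 hs /scalar_fam' [-> -> ad].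
have a0 : a = 0 by lra.
rewrite -ad a0; have [->|s0] := eqVneq s 0.
  by apply: below_scalar0; apply: rt_step; constructor.
by apply: belowI (rec_2 w2 w4 s0); exact: rt_refl.
Qed.

Lemma lim7 nu : L_omega R nu -> closure (orb (B mu7)) nu -> below mu7 nu.
Proof.
rewrite bracket_ofE => L cl.
apply: (fam_limit (oner_neq0 R) (good_and (good_unimod R) (good_trace 1 0)) _ _ L cl).
- by ring.
- by move=> al v; split; [apply: unimod_fam|apply: trace_fam]; ring.
move=> s a b c d w2 w4 hs [/unimod_fam' h1 /trace_fam' h2].
have s0 : s = 0 by lra.
have hd : d = - a by lra.
rewrite s0 hd in h2 *; apply: below_nilpotent; [exact: rt_refl|ring|].
by move: h2; clear; lra.
Qed.

(** The traces make M nilpotent. It is zero ([mu2]), or [s = 0] (nilpotent brackets), or M is a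
    Jordan block whose sign [rel_sign] pins to [ep]. *)
Lemma lim_8_9 la ep nu : ep ^+ 2 = 1 -> chain la mu7 -> chain la mu2 ->
  B la = fam 1 0 (- ep) 0 0 0 0 -> L_omega R nu -> closure (orb (B la)) nu -> below la nu.
Proof.
move=> e2 c7 c2 E L; rewrite E => cl.
apply: (fam_limit (oner_neq0 R) (good_and (good_trace 1 1) (good_sign ep)) _ _ L cl).
- by ring.
- move=> al v; split; [apply: trace_fam; ring|apply: sign_fam => x y].
  rewrite (_ : _ * _ = ep ^+ 2 * y ^+ 2); last by ring.
  by rewrite e2 mul1r sqr_ge0.
move=> s a b c d w2 w4 hs [/trace_fam' h1 /sign_fam' [h2 h3]].
have htr : a + d = 0 by lra.
have hd : d = - a by lra.
have hdet : a * d - b * c = 0 by rewrite hd in h1 *; move: h1; clear; lra.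
have [s0|s0] := eqVneq s 0; first by rewrite s0; exact: below_nilpotent.
have sE : a + s + d = s by lra.
rewrite sE in h2 h3.
have [bc|] := boolP ((b != 0) || (c != 0)).
  have [eta [et2 h hs']] := rec_8_9 w2 w4 s0 htr hdet bc.
  have he : eta = ep.
    have h4 := hs' _ h2 h3; apply/eqP; rewrite -subr_eq0.
    have : (eta - ep) * (eta + ep) = 0 by rewrite -subr_sqr et2 e2 subrr.
    move/eqP; rewrite mulf_eq0 => /orP[//|/eqP h5].
    have h6 : eta = - ep by lra.
    move: h4; rewrite h6 mulrN -expr2 e2 => h4.
    by have : 0 <= -1 :> R := h4; rewrite oppr_ge0 ler10.
  by exists la; [exact: rt_refl|rewrite E -he].
move=> /norP[/negPn/eqP b0 /negPn/eqP c0].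
have a0 : a = 0.
  have : a ^+ 2 = 0 by move: hdet; rewrite hd b0; clear; lra.
  by move/eqP; rewrite sqrf_eq0 => /eqP.
rewrite b0 c0 (_ : d = 0) ?a0; last by rewrite hd a0 oppr0.
by apply: belowI (rec_2 w2 w4 s0).
Qed.

Lemma lim8 nu : L_omega R nu -> closure (orb (B mu8)) nu -> below mu8 nu.
Proof.
apply: (@lim_8_9 _ (-1)); [by rewrite sqrrN expr1n|by apply: rt_step; constructor..|].
by rewrite bracket_ofE /= opprK.
Qed.

Lemma lim9 nu : L_omega R nu -> closure (orb (B mu9)) nu -> below mu9 nu.
Proof.
apply: (@lim_8_9 _ 1); [by rewrite expr1n|by apply: rt_step; constructor..|].
by rewrite bracket_ofE.
Qed.

Lemma lim10 nu : L_omega R nu -> closure (orb (B mu10)) nu -> below mu10 nu.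
Proof.
rewrite bracket_ofE => L cl.
apply: (fam_limit (oner_neq0 R) (good_trace 1 3) _ _ L cl); first by ring.
  by move=> al v; apply: trace_fam; ring.
move=> s a b c d w2 w4 hs /trace_fam' h1.
have htr : a + d = 0 by lra.
have hd : d = - a by lra.
have hdet : a * d - b * c = - s ^+ 2 by rewrite hd in h1 *; move: h1; clear; lra.
have [s0|s0] := eqVneq s 0.
  rewrite s0 in hdet *; apply: below_nilpotent htr _; last by rewrite hdet expr0n oppr0.
  by apply: rt_step; constructor.
have [h|h] := rec_10_11 w2 w4 s0 htr hdet; apply: belowI h; first exact: rt_refl.
by apply: rt_step; constructor.
Qed.

(** The trace condition of [lim10] would also allow [mu10] and [mu7]; [rel_dilation] excludes
    both. *)
Lemma lim11m nu : L_omega R nu -> closure (orb (B (mu11 (-1)))) nu -> below (mu11 (-1)) nu.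
Proof.
rewrite bracket_ofE => L cl.
apply: (fam_limit (oner_neq0 R) (good_dilation R) _ _ L cl); first by ring.
  by move=> al v; do 3 apply: all_vec => ? ? ? ?; rewrite !gfamE /=; ring.
move=> s a b c d w2 w4 hs h1.
have htr : a + d = 0 by lra.
have hd : d = - a by lra.
have hdet : a * d - b * c = - s ^+ 2.
  have := h1 (e 1) (e 2) (e 4); rewrite !eE !gfamE /= hd; clear; lra.
have [s0|s0] := eqVneq s 0.
  have c1 : chain (@mu11 R (-1)) mu1 by apply: rt_step; constructor.
  rewrite s0 in hdet h1 *.
  have hdet0 : a * d - b * c = 0 by rewrite hdet expr0n oppr0.
  have [h3|h3|h3] := rec_nilpotent w2 w4 htr hdet0; last 2 first.
  - exact: belowI h3.
  - by apply: belowI h3; exact: chain_trans c1 chain10.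
  have := good_orb (good_dilation R) h3 h1; rewrite bracket_ofE.
  move=> /(_ (e 1) (e 2) (e 1)); rewrite !eE !gfamE /= => h4; exfalso; move: h4.
  by clear; lra.
have [h|h] := rec_10_11 w2 w4 s0 htr hdet; last by apply: belowI h; exact: rt_refl.
have := good_orb (good_dilation R) h h1; rewrite bracket_ofE.
move=> /(_ (e 1) (e 4) (e 1)); rewrite !eE !gfamE /= => h4; exfalso; move: h4.
by clear; lra.
Qed.

(** With [D = - det M] the relations say [s^2 = be^2 D] and [D >= 0]. The inequality carries
    information when [be = 0], where the equality only gives [s = 0] and [mu4] must be excluded. *)
Lemma lim_hyp la be nu : be ^+ 2 != 1 -> chain la mu7 -> B la = B (mu11 be) ->
  L_omega R nu -> closure (orb (B la)) nu -> below la nu.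
Proof.
move=> be1 c7 E L; rewrite E bracket_ofE => cl.
apply: (fam_limit (oner_neq0 R) (good_and (good_trace (be ^+ 2) (be ^+ 2 + 2))
  (good_traceI 1 1)) _ _ L cl).
- by ring.
- by move=> al v; split; [apply: trace_fam; ring|apply: traceI_fam]; lra.
move=> s a b c d w2 w4 hs [/trace_fam' h1 /traceI_fam' h2].
have hd : d = - a by lra.
have htr : a + d = 0 by lra.
pose D := a ^+ 2 + b * c.
have hD : s ^+ 2 = be ^+ 2 * D by move: h1; rewrite hd /D; clear; lra.
have D0 : 0 <= D by move: h2; rewrite hd /D; clear; lra.
have hdet : a * d - b * c = - D by rewrite hd /D; ring.
have [Dz|Dn] := eqVneq D 0.
  have s0 : s = 0 by apply/eqP; rewrite -sqrf_eq0 hD Dz mulr0.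
  by rewrite s0; apply: below_nilpotent htr _ => //; rewrite hdet Dz oppr0.
have Dp : 0 < D by rewrite lt_def Dn.
have m2 : Num.sqrt D ^+ 2 = D by rewrite sqr_sqrtr.
have m0 : Num.sqrt D != 0 by rewrite -sqrf_eq0 m2.
have : (s - be * Num.sqrt D) * (s - be * - Num.sqrt D) = 0.
  by rewrite mulrN opprK -subr_sqr exprMn m2 hD subrr.
have fin m : m ^+ 2 = D -> s = be * m -> below la (fam s a b c d w2 w4).
  move=> mD sm; exists la; first exact: rt_refl.
  rewrite E; apply: (rec_hyp (m := m)) => //; last by rewrite mD.
  by rewrite -sqrf_eq0 mD.
move/eqP; rewrite mulf_eq0 !subr_eq0 => /orP[] /eqP; first exact: fin.
by apply: fin; rewrite sqrrN.
Qed.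

Lemma lim3 nu : L_omega R nu -> closure (orb (B mu3)) nu -> below mu3 nu.
Proof.
apply: (@lim_hyp _ 0); first by rewrite expr0n eq_sym oner_neq0.
  by apply: rt_step; constructor.
by rewrite !bracket_ofE.
Qed.

Lemma lim11 be nu : -1 < be < 1 -> L_omega R nu -> closure (orb (B (mu11 be))) nu ->
  below (mu11 be) nu.
Proof.
move=> /[dup] hb /andP[h1 h2]; apply: (@lim_hyp _ be) => //.
  by rewrite lt_eqF // expr2; nra.
by apply: rt_step; constructor.
Qed.

Lemma lim12 al nu : -1 < al < 0 -> L_omega R nu -> closure (orb (B (mu12 al))) nu ->
  below (mu12 al) nu.
Proof.
move=> /[dup] hb /andP[h1 h2]; apply: (@lim_hyp _ (- al^-1)); last first.
- by rewrite !bracket_ofE.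
- by apply: rt_step; constructor.
rewrite sqrrN exprVn; apply/eqP => h.
have : al ^+ 2 = 1 by rewrite -[LHS]invrK h invr1.
by nra.
Qed.

Lemma lim4 nu : L_omega R nu -> closure (orb (B mu4)) nu -> below mu4 nu.
Proof.
rewrite bracket_ofE => L cl.
apply: (fam_limit (oner_neq0 R) (good_and (good_unimod R) (good_traceI (-1) 0)) _ _ L cl).
- by ring.
- by move=> al v; split; [apply: unimod_fam; ring|apply: traceI_fam; lra].
move=> s a b c d w2 w4 hs [/unimod_fam' h1 /traceI_fam' h2].
have s0 : s = 0 by lra.
have hd : d = - a by lra.
have htr : a + d = 0 by lra.
rewrite s0; pose D := a * d - b * c.
have D0 : 0 <= D by move: h2; rewrite /D s0 hd; clear; lra.
have [Dz|Dn] := eqVneq D 0.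
  by apply: below_nilpotent htr _ => //; apply: rt_step; constructor.
exists mu4; first exact: rt_refl.
have m2 : Num.sqrt D ^+ 2 = D by rewrite sqr_sqrtr.
by apply: (rec_4 (m := Num.sqrt D)) => //; rewrite -sqrf_eq0 m2.
Qed.

Lemma lim_13_14 la ep de nu : ep ^+ 2 = 1 -> 0 < de -> chain la mu7 ->
  B la = fam 1 0 (- (de * ep)) (de * ep) 0 0 0 ->
  L_omega R nu -> closure (orb (B la)) nu -> below la nu.
Proof.
move=> e2 de0 c7 E L; rewrite E => cl.
apply: (fam_limit (oner_neq0 R) (good_and (good_trace 1 (1 - 2 * de ^+ 2))
  (good_sign ep)) _ _ L cl).
- by ring.
- move=> al v; split; last first.
    apply: sign_fam => x y.
    rewrite (_ : _ * _ = ep ^+ 2 * (de * (x ^+ 2 + y ^+ 2))); last by ring.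
    by rewrite e2 mul1r mulr_ge0 ?addr_ge0 ?sqr_ge0 // ltW.
  apply: trace_fam; have -> : 2 * - (de * ep) * (de * ep) = - (2 * de ^+ 2 * ep ^+ 2) by ring.
  by rewrite e2; ring.
move=> s a b c d w2 w4 hs [/trace_fam' h1 /sign_fam' [h2 h3]].
have htr : a + d = 0 by lra.
have hd : d = - a by lra.
have hdet : a * d - b * c = de ^+ 2 * s ^+ 2.
  by rewrite hd in h1 *; move: h1; clear; lra.
have [s0|s0] := eqVneq s 0.
  by rewrite s0 in hdet *; apply: below_nilpotent htr _ => //; rewrite hdet expr0n mulr0.
have sE : a + s + d = s by lra.
rewrite sE in h2 h3.
have [eta [et2 h hs']] := rec_13_14 w2 w4 de0 s0 htr hdet.
have he : eta = ep.
  apply/eqP; rewrite -subr_eq0.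
  have : (eta - ep) * (eta + ep) = 0 by rewrite -subr_sqr et2 e2 subrr.
  move/eqP; rewrite mulf_eq0 => /orP[//|/eqP h5].
  by exfalso; have h6 : ep = - eta by [lra]; move: h2 hs'; rewrite h6; clear; lra.
by exists la; [exact: rt_refl|rewrite E -he].
Qed.

Lemma lim13 de nu : 0 < de -> L_omega R nu -> closure (orb (B (mu13 de))) nu ->
  below (mu13 de) nu.
Proof.
move=> h; apply: (@lim_13_14 _ (-1) de) => //; first by rewrite sqrrN expr1n.
  by apply: rt_step; constructor.
by rewrite bracket_ofE mulrN1 opprK.
Qed.

Lemma lim14 de nu : 0 < de -> L_omega R nu -> closure (orb (B (mu14 de))) nu ->
  below (mu14 de) nu.
Proof.
move=> h; apply: (@lim_13_14 _ 1 de) => //; first by rewrite expr1n.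
  by apply: rt_step; constructor.
by rewrite bracket_ofE mulr1.
Qed.

Let half_neq0 : 2^-1 != 0 :> R.
Proof. by rewrite invr_eq0 pnatr_eq0. Qed.

Lemma mu7_cubic : ~ rel_cubic (B mu7) 0 0.
Proof.
by rewrite bracket_ofE /= /fam => /(_ (e 1)); rewrite /cubic !eE !gfamE /=; clear; lra.
Qed.

Lemma mu16_cubic : ~ rel_cubic (B mu16) 0 0.
Proof.
move=> h; have := h (vec 1 1 0 0); have := h (vec 1 0 0 1).
by rewrite bracket_ofE /= /fam /cubic !gfamE /=; clear; lra.
Qed.

(** [mu15] and [mu16] have the same traces; the cubic removes [mu16], and in the nilpotent case also
    [mu7]. *)
Lemma lim15 nu : L_omega R nu -> closure (orb (B mu15)) nu -> below mu15 nu.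
Proof.
rewrite bracket_ofE => L cl.
apply: (fam_limit half_neq0 (good_and (good_trace 2 1) (good_cubic R)) _ _ L cl).
- by field.
- move=> al v; split; first by apply: trace_fam; ring.
  by apply: all_vec => ? ? ? ?; rewrite /fam /cubic !gfamE /=; ring.
move=> s a b c d w2 w4 hs [/trace_fam' h1 h2].
have htr : a + d = s by lra.
have hdet : a * d - b * c = 0.
  by have hd : d = s - a by [lra]; rewrite hd in h1 *; move: h1; clear; lra.
have [s0|s0] := eqVneq s 0.
  have c1 : chain (@mu15 R) mu1 by apply: rt_step; constructor.
  rewrite s0 in htr h2 *; have [h3|h3|h3] := rec_nilpotent w2 w4 htr hdet; last 2 first.
  - exact: belowI h3.
  - by apply: belowI h3; exact: chain_trans c1 chain10.
  by case: mu7_cubic; exact: good_orb (good_cubic R) h3 h2.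
have [h|h] := rec_15_16 w2 w4 s0 htr hdet; first by apply: belowI h; exact: rt_refl.
by case: mu16_cubic; exact: good_orb (good_cubic R) h h2.
Qed.

Lemma lim16 nu : L_omega R nu -> closure (orb (B mu16)) nu -> below mu16 nu.
Proof.
rewrite bracket_ofE => L cl.
apply: (fam_limit half_neq0 (good_trace 2 1) _ _ L cl); first by field.
  by move=> al v; apply: trace_fam; ring.
move=> s a b c d w2 w4 hs /trace_fam' h1.
have htr : a + d = s by lra.
have hdet : a * d - b * c = 0.
  by have hd : d = s - a by [lra]; rewrite hd in h1 *; move: h1; clear; lra.
have [s0|s0] := eqVneq s 0.
  rewrite s0 in htr *; apply: below_nilpotent htr hdet.
  by apply: rt_step; constructor.
have [h|h] := rec_15_16 w2 w4 s0 htr hdet; apply: belowI h; last exact: rt_refl.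
by apply: rt_step; constructor.
Qed.

(** For weight [1/2] one has [tr = 2 s] and [tr2 = 2 (s^2 - det M)]. The trace coefficient [1 - th]
    thus encodes [det M = th s^2], here with [th = l (1 - l)]. *)
Lemma lim_20 la l nu : l * (1 - l) != 0 -> l != 2^-1 -> chain la mu7 ->
  B la = fam 1 l 0 0 (1 - l) 0 0 ->
  L_omega R nu -> closure (orb (B la)) nu -> below la nu.
Proof.
move=> l0 l2 c7 E L; rewrite E => cl.
apply: (fam_limit half_neq0 (good_trace 2 (1 - l * (1 - l))) _ _ L cl); first by field.
  by move=> al v; apply: trace_fam; ring.
move=> s a b c d w2 w4 hs /trace_fam' h1.
have htr : a + d = s by lra.
have hdet : a * d - b * c = l * (1 - l) * s ^+ 2.
  by have hd : d = s - a by [lra]; rewrite hd in h1 *; move: h1; clear; lra.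
have [s0|s0] := eqVneq s 0.
  rewrite s0 in htr hdet *; apply: below_nilpotent htr _ => //.
  by rewrite hdet expr0n mulr0.
by exists la; [exact: rt_refl|rewrite E; exact: rec_20].
Qed.

(** [mu17] is the value [l = 2] omitted from the family [mu20]. *)
Lemma lim17 nu : L_omega R nu -> closure (orb (B mu17)) nu -> below mu17 nu.
Proof.
apply: (@lim_20 _ 2); last first.
- by rewrite bracket_ofE /= (_ : 1 - 2 = -1 :> R) //; ring.
- by apply: rt_step; constructor.
- by apply/eqP; lra.
- by apply/eqP; lra.
Qed.

Lemma lim20 l nu : 2^-1 < l -> l <> 1 -> l <> 2 -> L_omega R nu ->
  closure (orb (B (mu20 l))) nu -> below (mu20 l) nu.
Proof.
move=> h1 h2 h3; apply: (@lim_20 _ l); last first.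
- by rewrite bracket_ofE.
- by apply: rt_step; constructor.
- by rewrite gt_eqF.
- by rewrite mulf_neq0 ?subr_eq0 //; apply/eqP; lra.
Qed.

Lemma lim20h nu : L_omega R nu -> closure (orb (B (mu20 2^-1))) nu -> below (mu20 2^-1) nu.
Proof.
rewrite bracket_ofE /= (_ : 1 - 2^-1 = 2^-1 :> R); last by field.
move=> L cl.
apply: (fam_limit half_neq0 (good_scalar R) _ _ L cl); first by field.
  by move=> al v; exact: scalar_fam.
move=> s a b c d w2 w4 hs /scalar_fam' [-> -> ad].
have aE : a = s / 2 by lra.
rewrite -ad aE; have [->|s0] := eqVneq s 0.
  by rewrite mul0r; apply: below_scalar0; apply: rt_step; constructor.
by apply: belowI (rec_20h w2 w4 s0); exact: rt_refl.
Qed.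

Lemma lim_23_24 la ep nu : ep ^+ 2 = 1 -> chain la mu7 -> chain la (mu20 2^-1) ->
  B la = fam 1 2^-1 (- ep) 0 2^-1 0 0 -> L_omega R nu -> closure (orb (B la)) nu ->
  below la nu.
Proof.
move=> e2 c7 c2 E L; rewrite E => cl.
apply: (fam_limit half_neq0 (good_and (good_trace 2 (3 / 4)) (good_sign ep)) _ _ L cl).
- by field.
- move=> al v; split; first by apply: trace_fam; field.
  apply: sign_fam => x y.
  rewrite (_ : _ * _ = 2 * (ep ^+ 2 * y ^+ 2)); last by field.
  by rewrite e2 mul1r mulr_ge0 ?sqr_ge0.
move=> s a b c d w2 w4 hs [/trace_fam' h1 /sign_fam' [h2 h3]].
have htr : a + d = s by lra.
have hd : d = s - a by lra.
have hdet : a * d - b * c = s ^+ 2 / 4 by rewrite hd in h1 *; move: h1; clear; lra.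
have [s0|s0] := eqVneq s 0.
  by rewrite s0 in hdet htr *; apply: below_nilpotent htr _ => //; rewrite hdet expr0n mul0r.
have sE : a + s + d = 2 * s by lra.
have h2' : 0 <= ep * (s * c) by move: h2; rewrite sE; clear; lra.
have h3' : 0 <= - (ep * (s * b)) by move: h3; rewrite sE; clear; lra.
have [bc|] := boolP ((b != 0) || (c != 0)).
  have [eta [et2 h hs']] := rec_23_24 w2 w4 s0 htr hdet bc.
  have he : eta = ep.
    have h4 := hs' _ h2' h3'; apply/eqP; rewrite -subr_eq0.
    have : (eta - ep) * (eta + ep) = 0 by rewrite -subr_sqr et2 e2 subrr.
    move/eqP; rewrite mulf_eq0 => /orP[//|/eqP h5].
    have h6 : eta = - ep by lra.
    move: h4; rewrite h6 mulrN -expr2 e2 => h4.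
    by have : 0 <= -1 :> R := h4; rewrite oppr_ge0 ler10.
  by exists la; [exact: rt_refl|rewrite E -he].
move=> /norP[/negPn/eqP b0 /negPn/eqP c0].
have aE : a = s / 2.
  have : (a - s / 2) ^+ 2 = 0 by move: hdet; rewrite hd b0; clear; lra.
  by move/eqP; rewrite sqrf_eq0 subr_eq0 => /eqP.
have dE : d = s / 2 by lra.
by rewrite b0 c0 dE aE; apply: belowI (rec_20h w2 w4 s0).
Qed.

Lemma lim23 nu : L_omega R nu -> closure (orb (B mu23)) nu -> below mu23 nu.
Proof.
apply: (@lim_23_24 _ (-1)); [by rewrite sqrrN expr1n|by apply: rt_step; constructor..|].
by rewrite bracket_ofE /= opprK.
Qed.

Lemma lim24 nu : L_omega R nu -> closure (orb (B mu24)) nu -> below mu24 nu.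
Proof.
apply: (@lim_23_24 _ 1); [by rewrite expr1n|by apply: rt_step; constructor..|].
by rewrite bracket_ofE.
Qed.

Lemma lim_21_22 la de nu : de != 0 -> chain la mu7 ->
  B la = fam de (de / 2) 1 (-1) (de / 2) 0 0 ->
  L_omega R nu -> closure (orb (B la)) nu -> below la nu.
Proof.
move=> de0 c7 E L; rewrite E => cl; pose th := 4^-1 + de^-1 ^+ 2.
apply: (fam_limit half_neq0 (good_and (good_trace 2 (1 - th)) (good_sign (- de)))
  _ _ L cl).
- by field.
- move=> al v; split; first by apply: trace_fam; rewrite /th; field.
  apply: sign_fam => x y.
  rewrite (_ : _ * _ = 2 * de ^+ 2 * (x ^+ 2 + y ^+ 2)); last by field.
  by apply: mulr_ge0; [apply: mulr_ge0; rewrite ?ler0n ?sqr_ge0|rewrite addr_ge0 ?sqr_ge0].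
move=> s a b c d w2 w4 hs [/trace_fam' h1 /sign_fam' [h2 h3]].
have htr : a + d = s by lra.
have hd : d = s - a by lra.
have hdet : a * d - b * c = th * s ^+ 2 by rewrite hd in h1 *; move: h1; clear; lra.
have [s0|s0] := eqVneq s 0.
  by rewrite s0 in hdet htr *; apply: below_nilpotent htr _ => //; rewrite hdet expr0n mulr0.
have sE : a + s + d = 2 * s by lra.
have [eta [et2 h hs']] := rec_21_22 w2 w4 de0 s0 htr hdet.
have he : eta = -1.
  have : (eta - 1) * (eta + 1) = 0 by rewrite -subr_sqr et2 expr1n subrr.
  move/eqP; rewrite mulf_eq0 subr_eq0 addr_eq0 => /orP[/eqP h5|/eqP //].
  by exfalso; move: h2 hs'; rewrite h5 sE; clear; lra.
by exists la; [exact: rt_refl|rewrite E; move: h; rewrite he opprK].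
Qed.

Lemma lim21 de nu : 0 < de -> L_omega R nu -> closure (orb (B (mu21 de))) nu ->
  below (mu21 de) nu.
Proof.
move=> h; apply: (@lim_21_22 _ de); first by rewrite gt_eqF.
  by apply: rt_step; constructor.
by rewrite bracket_ofE.
Qed.

Lemma lim22 de nu : 0 < de -> L_omega R nu -> closure (orb (B (mu22 de))) nu ->
  below (mu22 de) nu.
Proof.
move=> h; apply: (@lim_21_22 _ (- de)); first by rewrite oppr_eq0 gt_eqF.
  by apply: rt_step; constructor.
by rewrite bracket_ofE mulNr.
Qed.

End LineLabels.

(** * Limits for abelian derived plane: [mu5] and [mu6] *)

Section PlaneLabels.
Variable R : realType.
Implicit Types (a b c d s w x y z p t k l m eta ep al be : R).
Implicit Types (mu nu : bilin R) (la : label R).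
Local Notation B := (@bracket_of R).

Lemma omega_e4 (v : 'cV[R]_4) : omega_cn (e 4) v = - v (idx 2) 0.
Proof. by rewrite (vec_eta v) e4E omegaE !vecE; ring. Qed.

(** The hypotheses make [<e3, e4>] an abelian ideal and put the derived algebra in [<e2, e3, e4>];
    closedness of the form gives the two remaining coincidences of coefficients. *)
Lemma plane_normal_form nu : L_omega R nu ->
  (forall x y : 'cV[R]_4, omega_cn (e 3) (br nu x y) = 0) ->
  (forall x : 'cV[R]_4, omega_cn (e 4) (br nu x (e 3)) = 0 /\ omega_cn (e 4) (br nu x (e 4)) = 0) ->
  (forall z : 'cV[R]_4, omega_cn (br nu (e 3) (e 4)) z = 0) ->
  exists s a c d w2 w4 u h k, nu = gfam s a 0 c d w2 w4 u h k.
Proof.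
move=> [[alt _] cl] h1 h2 h3.
have A (x y : 'cV[R]_4) : br nu x y = - br nu y x by apply: alt_br.
have n34 : br nu (e 3) (e 4) = 0.
  by apply: omega_nondeg => z; rewrite h3 /omega_cn /wedge_dual !mxE; ring.
set n12 := br nu (e 1) (e 2); set n13 := br nu (e 1) (e 3).
set n14 := br nu (e 1) (e 4); set n23 := br nu (e 2) (e 3).
set n24 := br nu (e 2) (e 4).
have C (i j l : nat) := cl (e i) (e j) (e l).
move: (C 1 2 3) (C 1 2 4); rewrite (A (e 3) (e 1)) (A (e 4) (e 1)).
rewrite !omegaNl -/n12 -/n13 -/n14 -/n23 -/n24.
have oE (n : 'cV[R]_4) := omega_e n.
case: (oE n12) (oE n13) (oE n14) (oE n23) => [q121 q122 q123 q124] [q131 q132 q133 q134].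
move=> [q141 q142 q143 q144] [q231 q232 q233 q234].
case: (oE n24) => [q241 q242 q243 q244].
rewrite q123 q231 q132 q124 q241 q142 => c1 c2.
have z (i j : nat) : br nu (e i) (e j) (idx 1) 0 = 0.
  by have := h1 (e i) (e j); rewrite omega_e3 => /eqP; rewrite oppr_eq0 => /eqP.
have z12 : n12 (idx 1) 0 = 0 by exact: z.
have z13 : n13 (idx 1) 0 = 0 by exact: z.
have z14 : n14 (idx 1) 0 = 0 by exact: z.
have z23 : n23 (idx 1) 0 = 0 by exact: z.
have z24 : n24 (idx 1) 0 = 0 by exact: z.
have y3 (i : nat) : br nu (e i) (e 3) (idx 2) 0 = 0.
  by have [/eqP] := h2 (e i); rewrite omega_e4 oppr_eq0 => /eqP.
have y4 (i : nat) : br nu (e i) (e 4) (idx 2) 0 = 0.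
  by have [_ /eqP] := h2 (e i); rewrite omega_e4 oppr_eq0 => /eqP.
have y13 : n13 (idx 2) 0 = 0 by exact: y3.
have y23 : n23 (idx 2) 0 = 0 by exact: y3.
have y14 : n14 (idx 2) 0 = 0 by exact: y4.
have y24 : n24 (idx 2) 0 = 0 by exact: y4.
exists (n13 (idx 3) 0), (n12 (idx 2) 0), (n12 (idx 4) 0),
  (n14 (idx 4) 0), (n12 (idx 3) 0), (n14 (idx 3) 0), (n13 (idx 4) 0),
  (n23 (idx 4) 0), (n24 (idx 4) 0).
have n233 : n23 (idx 3) 0 = n13 (idx 4) 0 by move: c1 z12; clear; lra.
have n243 : n24 (idx 3) 0 = n12 (idx 2) 0 + n14 (idx 4) 0 by move: c2; clear; lra.
rewrite {1}(mk_eta alt) -/n12 -/n13 -/n14 -/n23 -/n24 n34 /gfam.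
rewrite {1}(vec_eta n12) {1}(vec_eta n13) {1}(vec_eta n14) {1}(vec_eta n23).
by rewrite {1}(vec_eta n24) z12 z13 z14 z23 z24 y13 y23 y14 y24 n233 n243.
Qed.

Lemma orb_shear y s a c d w2 w4 u h k :
  orb (gfam s a 0 c d w2 w4 u h k)
   (gfam (s - 2 * y * u + y ^+ 2 * h) a 0 c (d + y * u - y * k - y ^+ 2 * h) (w2 - c * y)
     (w4 + y * s - y * (a + d) - y ^+ 2 * u - y * (d + y * u - y * k - y ^+ 2 * h))
     (u - y * h) h (k + y * h)).
Proof. by orb_tac (1, - y, 0, 0) (0, 1, 0, 0) (0, 0, 1, 0) (0, 0, y, 1). Qed.

(** The unipotent maps fixing [e3] and [e4] are given by symmetric 2x2 matrices; they change only
    [c] and [w2]. *)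
Lemma orb_sym2 x y z s a c d w2 w4 u h k :
  orb (gfam s a 0 c d w2 w4 u h k)
   (gfam s a 0 (c + y * u + z * d - x * h - y * k - a * z) d
     (w2 + y * s + z * w4 - x * u - y * (a + d) - a * y) w4 u h k).
Proof. by orb_tac (1, 0, x, y) (0, 1, y, z) (0, 0, 1, 0) (0, 0, 0, 1). Qed.

Lemma orb_scale2 t l s a c d w2 w4 u h k : t != 0 -> l != 0 ->
  orb (gfam s a 0 c d w2 w4 u h k)
   (gfam (t * s) (t * a) 0 (t * l ^+ 2 * c) (t * d) (t ^+ 2 * l * w2) (t ^+ 2 * w4 / l)
     (l * u) (l ^+ 2 * h / t) (l * k)).
Proof.
move=> t0 l0; orb_tac (t, 0, 0, 0) (0, l, 0, 0) (0, 0, t^-1, 0) (0, 0, 0, l^-1).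
all: by rewrite t0 l0.
Qed.

Lemma orb_swap s c d w2 w4 u h k :
  orb (gfam s 0 0 c d w2 w4 u h k) (gfam k 0 0 (- w2) u (- c) h d w4 s).
Proof. by orb_tac (0, 1, 0, 0) (1, 0, 0, 0) (0, 0, 0, 1) (0, 0, 1, 0). Qed.



Lemma below_cubic_nilpotent la a b c d w2 w4 : chain la mu1 -> a + d = 0 ->
  a * d - b * c = 0 -> rel_cubic (fam 0 a b c d w2 w4) 0 0 ->
  below la (fam 0 a b c d w2 w4).
Proof.
move=> h h1 h2 ts; have [h3|h3|h3] := rec_nilpotent w2 w4 h1 h2; last 2 first.
- by apply: belowI h3.
- by apply: belowI h3; exact: chain_trans h (chain10 R).
by case: (@mu7_cubic R); exact: good_orb (good_cubic R) h3 ts.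
Qed.

Lemma below_cubic_15 la s a b c d w2 w4 : chain la mu15 -> s != 0 -> a + d = s ->
  a * d - b * c = 0 -> rel_cubic (fam s a b c d w2 w4) 0 0 ->
  below la (fam s a b c d w2 w4).
Proof.
move=> h s0 h1 h2 h3; have [h4|h4] := rec_15_16 w2 w4 s0 h1 h2.
  exact: belowI h4.
by case: (@mu16_cubic R); exact: good_orb (good_cubic R) h4 h3.
Qed.

Lemma below_cubic_2 la s c w2 w4 : chain la mu2 -> s != 0 ->
  rel_cubic (fam s 0 0 c 0 w2 w4) 0 0 -> below la (fam s 0 0 c 0 w2 w4).
Proof.
move=> h sn cub; have c0 : c = 0.
  apply/eqP; have := cub (vec 1 1 0 0); have := cub (vec 1 (-1) 0 0); have := cub (e 1).
  rewrite !eE /fam /cubic !gfamE /= => q1 q2 q3.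
  have : s ^+ 2 * c = 0 by move: q1 q2 q3; clear; lra.
  by move/eqP; rewrite mulf_eq0 expf_eq0 /= (negPf sn).
by rewrite c0; apply: belowI (rec_2 w2 w4 sn).
Qed.

(** [rel_plane] and [rel_eigen] make the action on [<e3, e4>] triangular; [rel_cubic2] then recovers
    the parameter or, in a degenerate case, reduces to [rel_cubic]. *)
Lemma lim5 be nu : 0 <= be -> L_omega R nu -> closure (orb (B (mu5 be))) nu ->
  below (mu5 be) nu.
Proof.
move=> be0 L; rewrite bracket_ofE => cl.
have c15 : chain (mu5 be) mu15 by apply: rt_step; constructor.
have c2 : chain (mu5 be) mu2 by apply: rt_step; constructor.
have c1 : chain (mu5 be) mu1 by apply: chain_trans c15 _; apply: rt_step; constructor.
have [al x y|nu' o [[p1 [p2 p3]] [p4 p5]]] := frame_limit (good_and (good_plane R)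
    (good_and (good_eigen R) (good_cubic2 be))) _ cl.
  rewrite /=; split; [split; [|split]|split].
  - by do 2 apply: all_vec => ? ? ? ?; rewrite !gfamE /=; ring.
  - by do 2 apply: all_vec => ? ? ? ?; rewrite !gfamE /=; ring.
  - by apply: all_vec => ? ? ? ?; rewrite !gfamE /=; ring.
  - by do 3 apply: all_vec => ? ? ? ?; rewrite !gfamE /=; ring.
  - by apply: all_vec => ? ? ? ?; rewrite /cubic !gfamE /=; ring.
have L' := L_omega_orb o L; apply: (below_orb o).
have [|s [a [c [d [w2 [w4 [u [h [k E]]]]]]]]] := plane_normal_form L' p1 _ p3.
  by move=> x; split; exact: p2.
rewrite E in L' p2 p4 p5 *.
have a0 : a = 0.
  have := p2 (e 1) (e 2); rewrite !eE !gfamE /=; clear; lra.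
have u0 : u = 0.
  have := p4 (e 1) (e 2) (e 1); rewrite !eE !gfamE /=; clear; lra.
have h0 : h = 0.
  have := p4 (e 2) (e 2) (e 1); rewrite !eE !gfamE /=; clear; lra.
rewrite a0 u0 h0 in L' p5 *.
have [_ _ _ _ [_ J _]] := Jacobi_gfam L'.
have tE x1 x2 x3 x4 : cubic (gfam s 0 0 c d w2 w4 0 0 k) (vec x1 x2 x3 x4) ^+ 2 * 16 =
   be ^+ 2 * (2 * (x1 * s) * (x1 * d + x2 * k)) ^+ 4 * (x1 * s - (x1 * d + x2 * k)) ^+ 2.
  have := p5 (vec x1 x2 x3 x4); rewrite mulrC => ->; rewrite !gfamE; ring.
(* When [k = 0], Jacobi forces [d = 0] or [d = s], and either choice makes the right-hand side of
   [tE] vanish, so the cubic vanishes. *)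
have [k0|kn] := eqVneq k 0.
  rewrite k0 in J tE *; rewrite -/(fam _ _ _ _ _ _ _) in tE *.
  have : d * (s - d) = 0 by move: J; clear; lra.
  move/eqP; rewrite mulf_eq0 subr_eq0 => /orP[] /eqP hd.
    rewrite hd in tE *.
    have cub : rel_cubic (fam s 0 0 c 0 w2 w4) 0 0.
      apply: all_vec => x1 x2 x3 x4; apply/eqP; rewrite -sqrf_eq0; apply/eqP.
      by apply: (mulIf (_ : 16 != 0 :> R)); rewrite ?pnatr_eq0 // tE; ring.
    have [s0|sn] := eqVneq s 0.
      by rewrite s0 in cub *; apply: below_cubic_nilpotent cub => //; ring.
    exact: below_cubic_2.
  rewrite -hd in tE *.
  have cub : rel_cubic (fam s 0 0 c s w2 w4) 0 0.
    apply: all_vec => x1 x2 x3 x4; apply/eqP; rewrite -sqrf_eq0; apply/eqP.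
    by apply: (mulIf (_ : 16 != 0 :> R)); rewrite ?pnatr_eq0 // tE; ring.
  have [s0|sn] := eqVneq s 0.
    by rewrite s0 in cub *; apply: below_cubic_nilpotent cub => //; ring.
  by apply: below_cubic_15 cub => //; ring.
(* Replacing [e1] by [e1 - (d / k) e2] separates the two weights; Jacobi then makes the new [w4]
   vanish. *)
have := orb_shear (d / k) s 0 c d w2 w4 0 0 k.
have -> : d + d / k * 0 - d / k * k - (d / k) ^+ 2 * 0 = 0 by field.
have -> : w4 + d / k * s - d / k * (0 + d) - (d / k) ^+ 2 * 0 - d / k * 0 = 0.
  have -> : w4 = (d * d - d * s) / k.
    by apply: (mulfI kn); rewrite mulrCA mulfV // mulr1; move: J; clear; lra.
  by field.
rewrite !(mulr0, addr0, subr0); move: (w2 - _) => v2 h1.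
apply: (below_orb h1).
have p6 := good_orb (good_cubic2 be) h1 p5.
have [s0|sn] := eqVneq s 0.
  rewrite s0 in p6 *; have h2 := orb_swap 0 c 0 v2 0 0 0 k.
  apply: (below_orb h2); have := good_orb (good_cubic2 be) h2 p6.
  rewrite -/(fam _ _ _ _ _ _ _) => p7; apply: below_cubic_2 => //.
  apply: all_vec => x1 x2 x3 x4; apply/eqP; rewrite -sqrf_eq0; apply/eqP.
  apply: (mulfI (_ : 16 != 0 :> R)); rewrite ?pnatr_eq0 // p7.
  by rewrite /fam !gfamE; ring.
have si : s^-1 != 0 by rewrite invr_eq0.
have ki : k^-1 != 0 by rewrite invr_eq0.
have := orb_scale2 s 0 c 0 v2 0 0 0 k si ki.
rewrite !(mulr0, mul0r) !mulVf //.
move: (_ * c) (_ * v2) => c' v' h2.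
have := orb_sym2 0 c' 0 1 0 c' 0 v' 0 0 0 1.
rewrite !(mulr0, mul0r, addr0, subr0, mulr1) subrr; move: (v' + c') => ka h3.
have {h2 h3} h2 := orb_trans h2 h3.
apply: (below_orb h2); have p7 := good_orb (good_cubic2 be) h2 p6.
(* The test vector [(1, 2, 0, 0)] has distinct nonzero eigenvalues, so the relation determines
   [ka ^+ 2]. *)
have hka : (ka - be) * (ka + be) = 0.
  by have := p7 (vec 1 2 0 0); rewrite /cubic !gfamE /=; clear; lra.
exists (mu5 be); first exact: rt_refl.
rewrite bracket_ofE /=; move: hka => /eqP; rewrite mulf_eq0 subr_eq0 addr_eq0.
move=> /orP[/eqP ->|/eqP ->]; last exact: orb_refl.
(* Exchanging the two affine factors reverses the sign of the parameter. *)
apply: (orb_trans (orb_swap _ _ _ _ _ _ _ _)).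
have := orb_sym2 0 (- be) 0 1 0 (- be) 0 0 0 0 0 1.
by rewrite !(mulr0, mul0r, addr0, subr0, mulr1, add0r, oppr0) subrr.
Qed.

(** Here [ad e1] is the scalar [s] on [<e3, e4>], so the plane is acted on by the commutative unital
    algebra generated by [ad e2]: complex for [mu6], dual numbers for [mu15]. *)
Lemma lim6_unital s c w2 h k : s != 0 ->
  rel_traceI (-1) 2^-1 (gfam s 0 0 c s w2 0 0 h k) 0 0 ->
  rel_cubic (gfam s 0 0 c s w2 0 0 h k) 0 0 ->
  below mu6 (gfam s 0 0 c s w2 0 0 h k).
Proof.
move=> sn p1 p2.
have c15 : chain (@mu6 R) mu15 by apply: rt_step; constructor.
have h1 := orb_swap s c s w2 0 0 h k.
(* Completing the square: between two swaps this shear replaces [e2] by [e2 - (k / (2 s)) e1], whose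
   action on the plane is traceless. *)
have h2 := orb_shear (k / (2 * s)) k 0 (- w2) 0 (- c) h s 0 s.
have {h1 h2} h1 := orb_trans h1 h2.
have h2 := orb_swap (k - 2 * (k / (2 * s)) * s + (k / (2 * s)) ^+ 2 * 0) (- w2)
  (0 + k / (2 * s) * s - k / (2 * s) * s - (k / (2 * s)) ^+ 2 * 0)
  (- c - - w2 * (k / (2 * s)))
  (h + k / (2 * s) * k - k / (2 * s) * (0 + 0) - (k / (2 * s)) ^+ 2 * s -
    k / (2 * s) * (0 + k / (2 * s) * s - k / (2 * s) * s - (k / (2 * s)) ^+ 2 * 0))
  (s - k / (2 * s) * 0) 0 (s + k / (2 * s) * 0).
have {h1 h2} := orb_trans h1 h2.
have -> : k - 2 * (k / (2 * s)) * s + (k / (2 * s)) ^+ 2 * 0 = 0 by field.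
rewrite !(mulr0, subr0, addr0, add0r) subrr mulr0 subr0.
move: (- (- c - _)) (- - w2) (h + _ - _) => c' v f h1.
apply: (below_orb h1).
have p3 := good_orb (good_traceI (-1) 2^-1) h1 p1.
have p4 := good_orb (good_cubic R) h1 p2.
(* The square of [ad e2] on the plane is now [s f], and the trace inequality makes it
   nonpositive. *)
have sf : s * f <= 0.
  by have := p3 (e 2); rewrite !eE !gfamE; clear; lra.
have [f0|fn] := eqVneq f 0.
  rewrite f0 in p4 *; apply: below_cubic_15 p4 => //; ring.
have sfn : 0 < - (f * s) by rewrite oppr_gt0 lt_neqAle mulf_neq0 //= mulrC.
pose l := (Num.sqrt (- (f * s)))^-1.
have l2 : l ^+ 2 = - (f * s)^-1 by rewrite exprVn sqr_sqrtr ?ltW // invrN.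
have l0 : l != 0 by rewrite invr_eq0 sqrtr_eq0 -ltNge.
have si : s^-1 != 0 by rewrite invr_eq0.
have := orb_scale2 s 0 c' s v 0 0 f 0 si l0.
rewrite !(mulr0, mul0r) mulVf // l2.
have -> : - (f * s)^-1 * f / s^-1 = -1 by field; rewrite fn sn.
move: (_ * c') (_ * v) => c2 v2 h2.
have := orb_sym2 0 0 (- c2) 1 0 c2 1 v2 0 0 (-1) 0.
rewrite !(mulr0, mul0r, addr0, subr0, mulr1) subrr => h3.
have {h2 h3} h2 := orb_trans h2 h3.
have p5 := good_orb (good_cubic R) h2 p4.
apply: (below_orb h2); exists mu6; first exact: rt_refl.
rewrite bracket_ofE /=; suff -> : v2 = 0 by exact: orb_refl.
by have := p5 (vec 1 1 0 0); have := p5 (e 1); rewrite !eE /cubic !gfamE /=; clear; lra.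
Qed.

(** The inequality [tr2 <= tr^2 / 2] says that the two eigenvalues of [ad x] on the plane are
    conjugate or equal, a closed condition. The cubic then controls the remaining constants. *)
Lemma lim6 nu : L_omega R nu -> closure (orb (B mu6)) nu -> below mu6 nu.
Proof.
move=> L; rewrite bracket_ofE => cl.
have c15 : chain (@mu6 R) mu15 by apply: rt_step; constructor.
have c1 : chain (@mu6 R) mu1 by apply: chain_trans c15 _; apply: rt_step; constructor.
have [al x y|nu' o [[p1 [p2 p3]] [p4 p5]]] := frame_limit (good_and (good_plane R)
    (good_and (good_traceI (-1) 2^-1) (good_cubic R))) _ cl.
  rewrite /=; split; [split; [|split]|split].
  - by do 2 apply: all_vec => ? ? ? ?; rewrite !gfamE /=; ring.
  - by do 2 apply: all_vec => ? ? ? ?; rewrite !gfamE /=; ring.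
  - by apply: all_vec => ? ? ? ?; rewrite !gfamE /=; ring.
  - apply: all_vec => x1 x2 x3 x4; rewrite !gfamE; have := sqr_ge0 x2; lra.
  - by apply: all_vec => ? ? ? ?; rewrite /cubic !gfamE /=; ring.
have L' := L_omega_orb o L; apply: (below_orb o).
have [|s [a [c [d [w2 [w4 [u [h [k E]]]]]]]]] := plane_normal_form L' p1 _ p3.
  by move=> x; split; exact: p2.
rewrite E in L' p2 p4 p5 *.
have a0 : a = 0.
  have := p2 (e 1) (e 2); rewrite !eE !gfamE /=; clear; lra.
rewrite a0 in L' p4 p5 *.
have [_ _ _ J1 [J2 J3 J4]] := Jacobi_gfam L'.
(* If [h] is nonzero, a shear removes [u] and Jacobi gives [w4 = 0] and [d = s]. If [h = 0] and [u]
   is nonzero, a swap leads to the same unital shape. *)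
have [h0|hn] := eqVneq h 0; last first.
  have := orb_shear (u / h) s 0 c d w2 w4 u h k.
  have -> : u - u / h * h = 0 by field.
  move: (s - _ + _) (d + _ - _ - _) (w2 - _) => s1 d1 v2.
  move: (w4 + _ - _ - _ - _) (k + _) => w1 k1 h1.
  have L2 := L_omega_orb h1 L'.
  have q4 := good_orb (good_traceI (-1) 2^-1) h1 p4.
  have q5 := good_orb (good_cubic R) h1 p5.
  have [_ _ _ K1 [K2 K3 K4]] := Jacobi_gfam L2.
  have w0 : w1 = 0 by apply: (mulfI hn); rewrite K1; ring.
  have ds : d1 = s1 by apply: (mulfI hn); move: K2; clear; lra.
  apply: (below_orb h1); rewrite w0 ds in q4 q5 *.
  have [s0|sn] := eqVneq s1 0; last exact: lim6_unital.
  rewrite s0 in q4 q5 *.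
  have k0 : k1 = 0.
    have : 0 <= - k1 ^+ 2 by have := q4 (e 2); rewrite !eE !gfamE; clear; lra.
    by rewrite oppr_ge0 => /(conj (sqr_ge0 k1)) /andP; rewrite -eq_le eq_sym sqrf_eq0 => /eqP.
  rewrite k0 in q5 *; have h2 := orb_swap 0 c 0 v2 0 0 h 0.
  apply: (below_orb h2); have := good_orb (good_cubic R) h2 q5.
  by rewrite -/(fam _ _ _ _ _ _ _) => q6; apply: below_cubic_nilpotent q6 => //; ring.
rewrite h0 in J1 J2 J3 J4 p4 p5 *.
have [u0|un] := eqVneq u 0; last first.
  have d0 : d = 0 by apply: (mulfI un); move: J1; clear; lra.
  have ku : k = u by apply: (mulfI un); move: J2; clear; lra.
  rewrite d0 ku in p4 p5 *; have h1 := orb_swap s c 0 w2 w4 u 0 u.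
  apply: (below_orb h1).
  have q4 := good_orb (good_traceI (-1) 2^-1) h1 p4.
  have q5 := good_orb (good_cubic R) h1 p5.
  exact: lim6_unital.
rewrite u0 in J1 J2 J3 J4 p4 p5 *.
have k0 : k = 0.
  have : 0 <= - k ^+ 2 by have := p4 (e 2); rewrite !eE !gfamE; clear; lra.
  by rewrite oppr_ge0 => /(conj (sqr_ge0 k)) /andP; rewrite -eq_le eq_sym sqrf_eq0 => /eqP.
rewrite k0 in J1 J2 J3 J4 p4 p5 *; rewrite -/(fam _ _ _ _ _ _ _) in p5 *.
have ds : d = s.
  have : 0 <= - (d - s) ^+ 2 by have := p4 (e 1); rewrite !eE !gfamE; clear; lra.
  rewrite oppr_ge0 => /(conj (sqr_ge0 (d - s))) /andP; rewrite -eq_le eq_sym sqrf_eq0.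
  by rewrite subr_eq0 => /eqP.
rewrite ds in p5 *; have [s0|sn] := eqVneq s 0.
  by rewrite s0 in p5 *; apply: below_cubic_nilpotent p5 => //; ring.
by apply: below_cubic_15 p5 => //; ring.
Qed.

End PlaneLabels.

(** * Limits for the algebras [mu18] and [mu19] *)

Section FlagLabels.
Variable R : realType.
Implicit Types (a b c d s w x y z p t k l m eta ep al be : R).
Implicit Types (mu nu : bilin R) (la : label R).
Local Notation B := (@bracket_of R).

Lemma flag_18_19 ep x y z : rel_flag ep (gfam 2 (-1) 0 0 1 0 0 0 ep 0)
  (vec 0 0 x 0) (vec 0 0 y z).
Proof.
split; first by do 2 apply: all_vec => ? ? ? ?; rewrite !gfamE /=; ring.
split; first by apply: all_vec => ? ? ? ?; rewrite !gfamE /=; split; ring.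
split; first by apply: all_vec => ? ? ? ?; rewrite !gfamE /=; ring.
split; first by do 2 apply: all_vec => ? ? ? ?; rewrite !gfamE /=; ring.
split; first by do 3 apply: all_vec => ? ? ? ?; rewrite !gfamE /=; ring.
split.
  apply: all_vec => x1 x2 x3 x4; apply: all_vec => y1 y2 y3 y4.
  apply: all_vec => z1 z2 z3 z4; rewrite !gfamE /=.
  have h : 0 <= (2 : R) by [].
  have := mulr_ge0 h (sqr_ge0 (ep * x * x1 * (x * (z1 * y2 - y1 * z2)))).
  by congr (0 <= _); ring.
apply: all_vec => x1 x2 x3 x4; apply: all_vec => y1 y2 y3 y4.
apply: all_vec => z1 z2 z3 z4; apply: all_vec => t1 t2 t3 t4; rewrite !gfamE /=.
have h : 0 <= (2 : R) by [].
have := mulr_ge0 h (sqr_ge0 (ep * y * (x * (t1 * z2 - z1 * t2)) *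
  ((- y * y1 - z * y2) * x1 - (- y * x1 - z * x2) * y1))).
by congr (0 <= _); ring.
Qed.

(** The linear clauses of [rel_flag] become [s = - 3 a - d] and [k = - u]; its inequalities become
    the sign of [a h], which separates [mu18] from [mu19], and the sign of [a (a + d)]. *)
Lemma lim_18_19 la ep nu : ep ^+ 2 = 1 -> chain la (mu12 (- 2^-1)) ->
  (ep = -1 -> chain la mu17) -> B la = gfam 2 (-1) 0 0 1 0 0 0 ep 0 ->
  L_omega R nu -> closure (orb (B la)) nu -> below la nu.
Proof.
move=> e2 c12 c17 EB L; rewrite EB => cl.
have en : ep != 0 by rewrite -sqrf_eq0 e2 oner_neq0.
have c7 : chain la mu7.
  apply: chain_trans c12 _; apply: rt_step; constructor.
  by apply/andP; split; lra.
have [al x y|nu' o [p1 [p2 [p3 [p4 [p5 [p6 p7]]]]]]] :=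
    frame_limit (good_flag ep) _ cl; first exact: flag_18_19.
have L' := L_omega_orb o L; apply: (below_orb o).
have [s [a [c [d [w2 [w4 [u [h [k E]]]]]]]]] := plane_normal_form L' p1 p2 p3.
rewrite {}E in L' p4 p5 p6 p7 *.
have sE : s = - 3 * a - d.
  have := p5 (e 1) (e 2) (e 1); rewrite !eE !gfamE /=; clear; lra.
have kE : k = - u.
  have := p4 (e 2) (e 1); rewrite !eE !gfamE /=; clear; lra.
have s1 : 0 <= - (ep * (a * h)).
  have := p6 (e 1) (e 2) (e 1); rewrite !eE !gfamE /= sE; clear; lra.
have s2 : 0 <= ep * (a * (a + d)).
  have := p7 (e 1) (e 2) (e 2) (e 1); rewrite !eE !gfamE /= sE; clear; lra.
move=> {p1 p2 p3 p4 p5 p6 p7}.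
have [_ _ _ J1 [J2 J3 J4]] := Jacobi_gfam L'.
have [h0|hn] := eqVneq h 0.
  have u0 : u = 0.
    by apply/eqP; rewrite -sqrf_eq0; apply/eqP; move: J2; rewrite h0 kE; clear; lra.
  have k0 : k = 0 by rewrite kE u0 oppr0.
  rewrite h0 u0 k0 -/(fam _ _ _ _ _ _ _) in J3 *.
  (* The first factor leads to [mu12 (- 2^-1)], the second to [mu17]. *)
  have : (a + d) * (2 * a + d) = 0 by move: J3; rewrite sE; clear; lra.
  move/eqP; rewrite mulf_eq0 => /orP[] /eqP hd.
    have [a0|an] := eqVneq a 0.
      have d0 : d = 0 by lra.
      have s0 : s = 0 by lra.
      by rewrite s0 a0 d0; apply: below_nilpotent => //; ring.
    exists (mu12 (- 2^-1)) => //.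
    have -> : B (mu12 (- 2^-1)) = B (mu11 2).
      by rewrite !bracket_ofE /= invrN opprK invrK.
    apply: (rec_hyp (m := - a)); [by rewrite oppr_eq0| |exact: hd| |lra].
      by rewrite -natrX pnatr_eq1.
    by have -> : d = - a by [lra]; ring.
  have [a0|an] := eqVneq a 0.
    have d0 : d = 0 by lra.
    have s0 : s = 0 by lra.
    by rewrite s0 a0 d0; apply: below_nilpotent => //; ring.
  (* Here [a + d = - a], so the inequality [s2] reads [0 <= - ep a^2]. This is why [mu19], but not
     [mu18], degenerates to [mu17]. *)
  have epE : ep = -1.
    have : (ep - 1) * (ep + 1) = 0 by rewrite -subr_sqr e2 expr1n subrr.
    move/eqP; rewrite mulf_eq0 subr_eq0 addr_eq0 => /orP[/eqP h5|/eqP //].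
    have a2 : 0 < a ^+ 2 by rewrite exprn_even_gt0.
    by exfalso; move: s2 a2; rewrite h5 (_ : a + d = - a); [clear; lra|lra].
  exists mu17; first exact: c17.
  rewrite bracket_ofE /=; have -> : -1 = 1 - 2 :> R by ring.
  have sa : s = - a by lra.
  have da : d = - 2 * a by lra.
  apply: rec_20; rewrite ?sa ?da ?oppr_eq0 //; try ring.
  by apply/eqP; lra.
have := orb_shear (u / h) s a c d w2 w4 u h k.
(* The shear preserves [s + d = - 3 a]. Together with [d1 = r1 + a] from Jacobi this restores the
   weights [- 2 a] and [- a]. *)
have hs1 : s - 2 * (u / h) * u + (u / h) ^+ 2 * h +
   (d + u / h * u - u / h * k - (u / h) ^+ 2 * h) = s + d by rewrite kE; field.
have -> : u - u / h * h = 0 by field.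
have -> : k + u / h * h = 0 by rewrite kE; field.
move: hs1; move: (s - _ + _) (d + _ - _ - _) (w2 - _) => r1 d1 v2.
move: (w4 + _ - _ - _ - _) => w1 hs1 h1.
have [_ _ _ K1 [K2 K3 K4]] := Jacobi_gfam (L_omega_orb h1 L').
have w0 : w1 = 0 by apply: (mulfI hn); rewrite K1; ring.
have ds : d1 = r1 + a by apply: (mulfI hn); move: K2; clear; lra.
have rE : r1 = - 2 * a by lra.
have dE : d1 = - a by lra.
apply: (below_orb h1); rewrite {h1} w0 rE dE.
have [a0|an] := eqVneq a 0.
  rewrite a0 mulr0 oppr0; apply: below_orb (orb_swap _ _ _ _ _ _ _ _) _.
  by rewrite -/(fam _ _ _ _ _ _ _); apply: below_nilpotent => //; ring.
have := orb_sym2 0 (v2 / (3 * a)) (c / (2 * a)) (- 2 * a) a c (- a) v2 0 0 h 0.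
set z1 := c + _ + _ - _ - _ - _; set z2 := v2 + _ + _ - _ - _ - _.
have -> : z1 = 0 by rewrite /z1; field.
have -> : z2 = 0 by rewrite /z2; field.
move=> h1; apply: (below_orb h1).
have hp : 0 < - (ep * (a * h)).
  by rewrite lt_def s1 andbT oppr_eq0 !mulf_neq0.
pose l := (Num.sqrt (- (ep * (a * h))))^-1.
have l2 : l ^+ 2 = - (ep * (a * h))^-1 by rewrite exprVn sqr_sqrtr ?ltW // invrN.
have l0 : l != 0 by rewrite invr_eq0 sqrtr_eq0 -ltNge.
have ti : - a^-1 != 0 by rewrite oppr_eq0 invr_eq0.
have := orb_scale2 (- 2 * a) a 0 (- a) 0 0 0 h 0 ti l0.
rewrite !(mulr0, mul0r) l2.
have -> : - a^-1 * (- 2 * a) = 2 by field.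
have -> : - a^-1 * a = -1 by field.
have -> : - a^-1 * - a = 1 by field.
have -> : - (ep * (a * h))^-1 * h / - a^-1 = ep^-1.
  by field; rewrite en an hn.
have -> : ep^-1 = ep by apply: (mulfI en); rewrite mulfV // -expr2 e2.
by move=> h2; exists la; [exact: rt_refl|rewrite EB].
Qed.

Lemma lim18 nu : L_omega R nu -> closure (orb (B mu18)) nu -> below mu18 nu.
Proof.
apply: (@lim_18_19 _ 1); [by rewrite expr1n|by apply: rt_step; constructor| |].
  by move=> h; exfalso; lra.
by rewrite bracket_ofE.
Qed.

Lemma lim19 nu : L_omega R nu -> closure (orb (B mu19)) nu -> below mu19 nu.
Proof.
apply: (@lim_18_19 _ (-1)); [by rewrite sqrrN expr1n|by apply: rt_step; constructor| |].
  by move=> _; apply: rt_step; constructor.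
by rewrite bracket_ofE.
Qed.

Lemma admissible_limit la nu : admissible la -> L_omega R nu ->
  closure (orb (B la)) nu -> below la nu.
Proof.
case: la => [||||| l |||||| b | a | d | d |||||| l | d | d ||] /= adm L.
- exact: lim0.
- exact: lim1.
- exact: lim2.
- exact: lim3.
- exact: lim4.
- exact: lim5.
- exact: lim6.
- exact: lim7.
- exact: lim8.
- exact: lim9.
- exact: lim10.
- have [b1|bn] := eqVneq b (-1); first by rewrite b1; exact: lim11m.
  apply: lim11 => //; case/andP: adm => h1 h2.
  by rewrite h2 andbT lt_def bn.
- exact: lim12.
- exact: lim13.
- exact: lim14.
- exact: lim15.
- exact: lim16.
- exact: lim17.
- exact: lim18.
- exact: lim19.
- case: adm => h1 h2 h3; have [l1|ln] := eqVneq l 2^-1; first by rewrite l1; exact: lim20h.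
  by apply: lim20 => //; rewrite lt_def ln.
- exact: lim21.
- exact: lim22.
- exact: lim23.
- exact: lim24.
Qed.

End FlagLabels.

(** * Curves realising the arrows *)

Lemma contI (R : realType) : continuous (fun t : R => t).
Proof. by move=> t; exact: cvg_id. Qed.

Ltac poly_cont := repeat (cbv beta; lazymatch goal with
  | |- continuous (fun t => GRing.add (@?f t) (@?h t)) => apply: (@contD _ _ f h)
  | |- continuous (fun t => GRing.opp (@?f t)) => apply: (@contN _ _ f)
  | |- continuous (fun t => GRing.exp (@?f t) _) => apply: (@contX _ _ f)
  | |- continuous (fun t => GRing.mul (@?f t) (@?h t)) => apply: (@contM _ _ f h)
  | |- continuous (fun t => t) => exact: contI
  | |- continuous (GRing.mul ?x) => apply: (@contM _ _ (fun=> x) (fun t => t))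
  | |- continuous GRing.opp => apply: (@contN _ _ (fun t => t))
  | |- continuous _ => first [assumption | exact: contC]
  end).

Section Arrows.
Variable R : realType.
Implicit Types (mu nu : bilin R) (la : label R).
Local Notation B := (@bracket_of R).

Lemma ccont_mulmx (T : topologicalType) (g : 'M[R]_4) (u : T -> 'cV[R]_4) :
  ccont u -> ccont (fun t => g *m u t).
Proof.
move=> cu k; under eq_fun do rewrite mxE.
by apply: cont_sum => j; apply: contM; [exact: contC|exact: cu].
Qed.

Lemma act_continuous (g : 'M[R]_4) : continuous (act g).
Proof.
apply: bcont_continuous => i j; under eq_fun do rewrite mxE.
apply: ccont_mulmx; apply: ccont_br; try exact: ccontC.
by apply: continuous_bcont => M; exact: cvg_id.
Qed.

(** Each group element acts continuously, so the closure of an orbit is a union of orbits. *)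
Lemma closure_orb mu nu mu' : closure (orb mu) nu -> closure (orb nu) mu' ->
  closure (orb mu) mu'.
Proof.
move=> h1 h2; have sub : orb nu `<=` closure (orb mu).
  move=> _ [g gS <-] A /(@act_continuous g nu) /h1 [la' [h3 h4]].
  by exists (act g la'); split=> //; apply: orb_trans h3 _; exact: orb_act.
by have := closureS sub h2; rewrite -(iffLR (closure_id _) (@closed_closure _ _)).
Qed.

Lemma closure_refl mu : closure (orb mu) mu.
Proof. by apply: subset_closure; exact: orb_refl. Qed.

Lemma bcont_gfam (T : topologicalType) (s a b c d w2 w4 u h k : T -> R) :
  continuous s -> continuous a -> continuous b -> continuous c -> continuous d ->
  continuous w2 -> continuous w4 -> continuous u -> continuous h -> continuous k ->
  bcont (fun t => gfam (s t) (a t) (b t) (c t) (d t) (w2 t) (w4 t) (u t) (h t) (k t)).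
Proof.
move=> cs ca cb cc cd c2 c4 cu ch ck i j.
under eq_fun do rewrite -br_delta (vec_eta (delta_mx i 0)) (vec_eta (delta_mx j 0)) br_gfam.
by apply: ccont_vec; poly_cont.
Qed.

(** The curve lives in the structure constants; recognition lemmas or explicit rescalings place
    [phi t] in the orbit, so no diverging path in the group is written down. *)
Lemma degen_curve la lb (phi : R -> bilin R) : bcont phi ->
  (forall t, 0 < t -> orb (phi t) (B la)) -> orb (phi 0) (B lb) ->
  closure (orb (B la)) (B lb).
Proof.
move=> cphi h1 h2; apply: (@closure_orb _ (phi 0)).
  by apply: closure_curve cphi _ => t /h1; exact: orb_sym.
by apply: subset_closure.
Qed.

End Arrows.

Ltac curve_tac := rewrite /fam; apply: bcont_gfam; poly_cont.

Section ArrowList.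
Variable R : realType.
Implicit Types (a b c d s w x y z p t k l m eta ep al be : R).
Implicit Types (mu nu : bilin R) (la : label R).
Local Notation B := (@bracket_of R).

Lemma sqr1_neq0 x : x ^+ 2 = 1 -> x != 0.
Proof. by move=> h; rewrite -sqrf_eq0 h oner_neq0. Qed.

Lemma sign_unique eta ep : eta ^+ 2 = 1 -> ep ^+ 2 = 1 -> 0 <= eta * ep -> eta = ep.
Proof.
move=> h1 h2 h3; apply/eqP; rewrite -subr_eq0.
have : (eta - ep) * (eta + ep) = 0 by rewrite -subr_sqr h1 h2 subrr.
move/eqP; rewrite mulf_eq0 => /orP[//|/eqP h4].
have {}h4 : eta = - ep by lra.
by move: h3; rewrite h4 mulNr -expr2 h2 oppr_ge0 ler10.
Qed.

Lemma rec_7b b w2 w4 : b != 0 -> w2 != 0 -> orb (fam 0 0 b 0 0 w2 w4) (B mu7).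
Proof.
move=> b0 w0; apply: orb_trans (orb_rot _ _ _ _ _ _ _) _; rewrite oppr0.
by apply: rec_nil; rewrite oppr_eq0.
Qed.

(** With [s = si t] and [det M = - ka t^2], the ratio of [det M] to [s^2] is constant along the
    curve, while the Jordan entry [b = 1] and [w2 = 1] survive at [t = 0]. This is the model for
    weight [1]; [to7B] is the one for weight [1/2]. *)
Lemma to7A la (si ka : R) :
  (forall t, 0 < t -> orb (fam (si * t) 0 1 (ka * t ^+ 2) 0 1 0) (B la)) ->
  closure (orb (B la)) (B mu7).
Proof.
move=> h; apply: (degen_curve _ h); first by curve_tac.
by rewrite !(mulr0, expr0n) /= ?mulr0; apply: rec_7b; exact: oner_neq0.
Qed.

Lemma to7B la (si ka : R) :
  (forall t, 0 < t -> orb (fam (si * t) (si * t / 2) 1 (ka * t ^+ 2) (si * t / 2) 1 0) (B la)) ->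
  closure (orb (B la)) (B mu7).
Proof.
move=> h; apply: (degen_curve _ h); first by curve_tac.
by rewrite !(mulr0, mul0r, expr0n) /= ?mulr0; apply: rec_7b; exact: oner_neq0.
Qed.

Lemma to7_hyp la be : be ^+ 2 != 1 -> B la = B (mu11 be) ->
  closure (orb (B la)) (B mu7).
Proof.
move=> h ->; apply: (@to7A _ be 1) => t t0; apply: (rec_hyp (m := t)) => //; try ring.
by rewrite gt_eqF.
Qed.

Lemma to7_10 : closure (orb (B mu10)) (B mu7).
Proof.
apply: (@to7A _ (-1) 1) => t t0.
have tn : -1 * t != 0 by rewrite mulN1r oppr_eq0 gt_eqF.
have [h|h] : orb (fam (-1 * t) 0 1 (1 * t ^+ 2) 0 1 0) (B mu10) \/
    orb (fam (-1 * t) 0 1 (1 * t ^+ 2) 0 1 0) (B (mu11 (-1))).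
  by apply: rec_10_11 tn _ _; ring.
  exact: h.
(* Recognition leaves two candidates; a point of the curve violates the dilation identity, which
   rules out [mu11 (-1)]. *)
have dil : rel_dilation (B (mu11 (-1))) 0 0.
  by rewrite bracket_ofE; do 3 apply: all_vec => ? ? ? ?; rewrite !gfamE /=; ring.
have := good_orb (good_dilation R) (orb_sym h) dil.
move=> /(_ (e 1) (e 2) (e 1)); rewrite !eE !gfamE /= => h1; exfalso.
by move: h1 t0; clear; lra.
Qed.

Lemma to7_4 : closure (orb (B mu4)) (B mu7).
Proof.
apply: (@to7A _ 0 (-1)) => t t0; rewrite mul0r; apply: (rec_4 (m := t)); try ring.
by rewrite gt_eqF.
Qed.

Lemma to7_13_14 la ep de : ep ^+ 2 = 1 -> 0 < de ->
  B la = fam 1 0 (- (de * ep)) (de * ep) 0 0 0 -> closure (orb (B la)) (B mu7).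
Proof.
(* With [s = - ep t] and [c = - de^2 t^2], the product [s c] has the sign of [ep], as [rec_13_14]
   requires. *)
move=> e2 de0 E; apply: (@to7A _ (- ep) (- de ^+ 2)) => t t0; rewrite E.
have en : - ep * t != 0.
  by rewrite mulf_neq0 ?oppr_eq0 ?(sqr1_neq0 e2) ?(lt0r_neq0 t0).
have [||eta [h1 h2 h3]] := @rec_13_14 _ de (- ep * t) 0 1 (- de ^+ 2 * t ^+ 2) 0 1 0 de0 en.
- by ring.
- by rewrite exprMn sqrrN e2; ring.
suff he : eta = ep by move: h2; rewrite he.
apply: (sign_unique h1 e2); rewrite ltW //.
have h4 : 0 < de ^+ 2 * t ^+ 3 by rewrite mulr_gt0 // exprn_gt0.
by rewrite -(pmulr_lgt0 _ h4); move: h3; congr (0 < _); ring.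
Qed.

Lemma to7_8_9 la ep : ep ^+ 2 = 1 -> B la = fam 1 0 (- ep) 0 0 0 0 ->
  closure (orb (B la)) (B mu7).
Proof.
move=> e2 E; apply: (@to7A _ (- ep) 0) => t t0; rewrite E mul0r.
have en : - ep * t != 0.
  by rewrite mulf_neq0 ?oppr_eq0 ?(sqr1_neq0 e2) ?(lt0r_neq0 t0).
have [||//|eta [h1 h2 h3]] := @rec_8_9 _ (- ep * t) 0 1 0 0 1 0 en.
- by ring.
- by ring.
- by rewrite oner_neq0.
suff he : eta = ep by move: h2; rewrite he.
apply/esym; apply: (sign_unique e2 h1); apply: h3; first by rewrite !mulr0.
rewrite (_ : - _ = ep ^+ 2 * t); last by ring.
by rewrite e2 mul1r ltW.
Qed.

Lemma to7_20 la l : l * (1 - l) != 0 -> l != 2^-1 -> B la = fam 1 l 0 0 (1 - l) 0 0 ->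
  closure (orb (B la)) (B mu7).
Proof.
move=> h1 h2 E; apply: (@to7B _ 1 ((l - 2^-1) ^+ 2)) => t t0; rewrite E.
by apply: rec_20 => //; rewrite ?mul1r ?gt_eqF //; field.
Qed.

Lemma to7_23_24 la ep : ep ^+ 2 = 1 -> B la = fam 1 2^-1 (- ep) 0 2^-1 0 0 ->
  closure (orb (B la)) (B mu7).
Proof.
move=> e2 E; apply: (@to7B _ (- ep) 0) => t t0; rewrite E mul0r.
have en : - ep * t != 0.
  by rewrite mulf_neq0 ?oppr_eq0 ?(sqr1_neq0 e2) ?(lt0r_neq0 t0).
have [||//|eta [h1 h2 h3]] := @rec_23_24 _ (- ep * t) (- ep * t / 2) 1 0 (- ep * t / 2) 1 0 en.
- by field.
- by field.
- by rewrite oner_neq0.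
suff he : eta = ep by move: h2; rewrite he.
apply/esym; apply: (sign_unique e2 h1); apply: h3; first by rewrite !mulr0.
rewrite (_ : - _ = ep ^+ 2 * t); last by ring.
by rewrite e2 mul1r ltW.
Qed.

Lemma to7_21_22 la de : de != 0 -> B la = fam de (de / 2) 1 (-1) (de / 2) 0 0 ->
  closure (orb (B la)) (B mu7).
Proof.
move=> d0 E; apply: (@to7B _ de (-1)) => t t0; rewrite E.
have en : de * t != 0 by rewrite mulf_neq0 ?(lt0r_neq0 t0).
have [||eta [h1 h2 h3]] := @rec_21_22 _ de (de * t) (de * t / 2) 1 (-1 * t ^+ 2)
  (de * t / 2) 1 0 d0 en.
- by field.
- by field.
have he : eta = -1.
  apply: sign_unique => //; first by rewrite sqrrN expr1n.
  have h4 : 0 < de ^+ 2 * t ^+ 3 by apply: mulr_gt0; [rewrite exprn_even_gt0|exact: exprn_gt0].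
  by rewrite ltW // -(pmulr_lgt0 _ h4); move: h3; congr (0 < _); ring.
by move: h2; rewrite he opprK.
Qed.

Lemma to7_16 : closure (orb (B mu16)) (B mu7).
Proof.
(* The constant [1/4] makes [det M = 0]; the cubic at [e1] then decides for [mu16] against
   [mu15]. *)
apply: (@to7B _ 1 4^-1) => t t0.
have tn : 1 * t != 0 by rewrite mul1r gt_eqF.
have [h|h] : orb (fam (1 * t) (1 * t / 2) 1 (4^-1 * t ^+ 2) (1 * t / 2) 1 0) (B mu15) \/
    orb (fam (1 * t) (1 * t / 2) 1 (4^-1 * t ^+ 2) (1 * t / 2) 1 0) (B mu16).
  by apply: rec_15_16 tn _ _; field.
2: exact: h.
have cub : rel_cubic (B mu15) 0 0.
  rewrite bracket_ofE /= /fam.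
  by apply: all_vec => ? ? ? ?; rewrite /cubic !gfamE /=; ring.
have := good_orb (good_cubic R) (orb_sym h) cub.
move=> /(_ (e 1)); rewrite /fam !eE /cubic !gfamE /= => h1; exfalso.
by move: h1; rewrite (_ : _ - _ = 1); [apply/eqP; exact: oner_neq0|field].
Qed.

Lemma to1 la (phi : R -> bilin R) : bcont phi ->
  (forall t, 0 < t -> orb (phi t) (B la)) -> phi 0 = fam 0 0 0 0 0 1 0 ->
  closure (orb (B la)) (B mu1).
Proof.
by move=> c h E; apply: degen_curve c h _; rewrite E bracket_ofE; exact: orb_refl.
Qed.

Lemma to1_15 : closure (orb (B mu15)) (B mu1).
Proof.
apply: (@to1 _ (fun t => fam t t 0 0 0 1 0)); [by curve_tac| |by []] => t t0.
have tn : t != 0 by rewrite gt_eqF.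
have cub : rel_cubic (fam t t 0 0 0 1 0) 0 0.
  by apply: all_vec => ? ? ? ?; rewrite /fam /cubic !gfamE /=; ring.
have [h|h] : orb (fam t t 0 0 0 1 0) (B mu15) \/ orb (fam t t 0 0 0 1 0) (B mu16).
  by apply: rec_15_16 tn _ _; ring.
  exact: h.
by case: (@mu16_cubic R); exact: good_orb (good_cubic R) h cub.
Qed.

Lemma to1_11 : closure (orb (B (mu11 (-1)))) (B mu1).
Proof.
apply: (@to1 _ (fun t => fam t (- t) 0 0 t 1 0)); [by curve_tac| |by rewrite oppr0] => t t0.
have tn : t != 0 by rewrite gt_eqF.
have dil : rel_dilation (fam t (- t) 0 0 t 1 0) 0 0.
  by do 3 apply: all_vec => ? ? ? ?; rewrite !gfamE /=; ring.
have [h|h] : orb (fam t (- t) 0 0 t 1 0) (B mu10) \/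
    orb (fam t (- t) 0 0 t 1 0) (B (mu11 (-1))).
  by apply: rec_10_11 tn _ _; ring.
2: exact: h.
have := good_orb (good_dilation R) h dil; rewrite bracket_ofE.
move=> /(_ (e 1) (e 4) (e 1)); rewrite !eE !gfamE /= => h1; exfalso.
by move: h1; clear; lra.
Qed.

Lemma to1_20 : closure (orb (B (mu20 2^-1))) (B mu1).
Proof.
apply: (@to1 _ (fun t => fam t (t / 2) 0 0 (t / 2) 1 0)); [by curve_tac| |by rewrite mul0r].
by move=> t t0; apply: rec_20h; rewrite gt_eqF.
Qed.

Lemma to1_2 : closure (orb (B mu2)) (B mu1).
Proof.
apply: (@to1 _ (fun t => fam t 0 0 0 0 1 0)); [by curve_tac| |by []] => t t0.
by apply: rec_2; rewrite gt_eqF.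
Qed.

Lemma to1_7 : closure (orb (B mu7)) (B mu1).
Proof.
apply: (@degen_curve _ _ _ (fun t => fam 0 0 0 t 0 0 1)); first by curve_tac.
  by move=> t t0; apply: rec_nil; rewrite ?gt_eqF.
by apply: rec_1w; rewrite oner_neq0 orbT.
Qed.

Lemma to0 : closure (orb (B mu1)) (B mu0).
Proof.
apply: (@degen_curve _ _ _ (fun t => fam 0 0 0 0 0 t 0)); first by curve_tac.
  by move=> t t0; apply: rec_1w; rewrite gt_eqF.
by rewrite bracket_ofE; exact: orb_refl.
Qed.

Lemma to2_8_9 la ep : ep ^+ 2 = 1 -> B la = fam 1 0 (- ep) 0 0 0 0 ->
  closure (orb (B la)) (B mu2).
Proof.
move=> e2 E; apply: (@degen_curve _ _ _ (fun t => fam 1 0 (- ep * t) 0 0 0 0)).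
- by curve_tac.
- move=> t t0; rewrite E.
  have en : - ep * t != 0.
    by rewrite mulf_neq0 ?oppr_eq0 ?(sqr1_neq0 e2) ?(lt0r_neq0 t0).
  have [||//|eta [h1 h2 h3]] := @rec_8_9 _ 1 0 (- ep * t) 0 0 0 0 (oner_neq0 R).
  + by ring.
  + by ring.
  + by rewrite en.
  suff he : eta = ep by move: h2; rewrite he.
  apply/esym; apply: (sign_unique e2 h1); apply: h3; first by rewrite !mulr0.
  rewrite (_ : - _ = ep ^+ 2 * t); last by ring.
  by rewrite e2 mul1r ltW.
- by rewrite mulr0 bracket_ofE; exact: orb_refl.
Qed.

Lemma to11_10 : closure (orb (B mu10)) (B (mu11 (-1))).
Proof.
apply: (@degen_curve _ _ _ (fun t => fam (-1) 1 0 0 (-1) 0 (- t))).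
- by curve_tac.
- move=> t t0; rewrite bracket_ofE; have tn : t != 0 by rewrite gt_eqF.
  have := orb_diag (-1) 1 0 0 (-1) 0 (- t) tn.
  by rewrite mul0r !mulr0 mulNr mulfV.
- rewrite oppr0 bracket_ofE; have := orb_rot (-1) 1 0 0 (-1 : R) 0 0.
  by rewrite !oppr0.
Qed.

Lemma to15_16 : closure (orb (B mu16)) (B mu15).
Proof.
apply: (@degen_curve _ _ _ (fun t => fam 1 1 0 0 0 0 t)).
- by curve_tac.
- move=> t t0; rewrite bracket_ofE; have tn : t != 0 by rewrite gt_eqF.
  have := orb_diag 1 1 0 0 0 0 t tn.
  by rewrite mul0r !mulr0 mulfV.
- by rewrite bracket_ofE; exact: orb_refl.
Qed.

Lemma to20_23_24 la ep : ep ^+ 2 = 1 -> B la = fam 1 2^-1 (- ep) 0 2^-1 0 0 ->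
  closure (orb (B la)) (B (mu20 2^-1)).
Proof.
move=> e2 E; apply: (@degen_curve _ _ _ (fun t => fam 1 2^-1 (- ep * t) 0 2^-1 0 0)).
- by curve_tac.
- move=> t t0; rewrite E.
  have en : - ep * t != 0.
    by rewrite mulf_neq0 ?oppr_eq0 ?(sqr1_neq0 e2) ?(lt0r_neq0 t0).
  have [||//|eta [h1 h2 h3]] := @rec_23_24 _ 1 2^-1 (- ep * t) 0 2^-1 0 0 (oner_neq0 R).
  + by field.
  + by field.
  + by rewrite en.
  suff he : eta = ep by move: h2; rewrite he.
  apply/esym; apply: (sign_unique e2 h1); apply: h3; first by rewrite !mulr0.
  rewrite (_ : - _ = ep ^+ 2 * t); last by ring.
  by rewrite e2 mul1r ltW.
- rewrite mulr0 bracket_ofE /= (_ : 1 - 2^-1 = 2^-1 :> R); last by field.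
  exact: orb_refl.
Qed.

Lemma to12_18_19 la ep : B la = gfam 2 (-1) 0 0 1 0 0 0 ep 0 ->
  closure (orb (B la)) (B (mu12 (- 2^-1))).
Proof.
move=> E; apply: (@degen_curve _ _ _ (fun t => gfam 2 (-1) 0 0 1 0 0 0 (ep * t ^+ 2) 0)).
- by curve_tac.
- move=> t t0; rewrite E; have tn : t^-1 != 0 by rewrite invr_eq0 gt_eqF.
  have := orb_scale2 2 (-1) 0 1 0 0 0 (ep * t ^+ 2) 0 (oner_neq0 R) tn.
  rewrite !(mulr0, mul0r, mul1r) divr1.
  rewrite (_ : t^-1 ^+ 2 * (ep * t ^+ 2) = ep) //; field.
  by rewrite gt_eqF.
- by rewrite bracket_ofE expr0n /= mulr0 invrN opprK invrK; exact: orb_refl.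
Qed.

Lemma to17_19 : closure (orb (B mu19)) (B mu17).
Proof.
(* The curve is a rescaled [mu19] sheared by the inverse of [- t^-1]. The diverging shear exchanges
   the weights [2] and [1] of [e3] and [e4], which stay exchanged in the limit. *)
apply: (@degen_curve _ _ _ (fun t => gfam 1 (-1) 0 0 2 0 0 t (- t ^+ 2) (- t))).
- by curve_tac.
- move=> t t0; rewrite bracket_ofE; have tn : t^-1 != 0 by rewrite invr_eq0 gt_eqF.
  have tn' : t != 0 by rewrite gt_eqF.
  apply: (orb_trans (orb_shear (- t^-1) _ _ _ _ _ _ _ _ _)).
  have -> : 1 - 2 * - t^-1 * t + (- t^-1) ^+ 2 * - t ^+ 2 = 2 by field.
  have -> : 2 + - t^-1 * t - - t^-1 * - t - (- t^-1) ^+ 2 * - t ^+ 2 = 1 by field.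
  have -> : 0 - 0 * - t^-1 = 0 by ring.
  have -> : 0 + - t^-1 * 1 - - t^-1 * (-1 + 2) - (- t^-1) ^+ 2 * t - - t^-1 * 1 = 0 by field.
  have -> : t - - t^-1 * - t ^+ 2 = 0 by field.
  have -> : - t + - t^-1 * - t ^+ 2 = 0 by field.
  have := orb_scale2 2 (-1) 0 1 0 0 0 (- t ^+ 2) 0 (oner_neq0 R) tn.
  rewrite !(mulr0, mul0r, mul1r) divr1.
  by rewrite (_ : t^-1 ^+ 2 * - t ^+ 2 = -1) //; field.
- rewrite bracket_ofE /= expr0n /= oppr0; have -> : -1 = 1 - 2 :> R by ring.
  by apply: rec_20; [exact: oner_neq0|ring|ring|apply/eqP; lra|apply/eqP; lra].
Qed.

Lemma orb_15_rot : orb (gfam 1 0 0 0 1 0 0 0 0 0) (B mu15).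
Proof. by rewrite bracket_ofE; have := orb_rot (1 : R) 0 0 0 1 0 0; rewrite !oppr0. Qed.

Lemma to15_5 be : closure (orb (B (mu5 be))) (B mu15).
Proof.
(* As [t] tends to zero the action of [e2] dies. The entry [d = 1], removed for [t > 0] by the shear
   [t^-1], makes [e1] act on the whole plane, in contrast with the limit [mu2]. *)
apply: (@degen_curve _ _ _ (fun t => gfam 1 0 0 0 1 (- be * t) 0 0 0 t)).
- by curve_tac.
- move=> t t0; rewrite bracket_ofE; have tn : t^-1 != 0 by rewrite invr_eq0 gt_eqF.
  have tn' : t != 0 by rewrite gt_eqF.
  apply: (orb_trans (orb_shear t^-1 _ _ _ _ _ _ _ _ _)).
  rewrite !(mulr0, mul0r, mulr1, subr0, addr0, add0r) mulVf // subrr mulr0 subrr subr0.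
  have := orb_scale2 1 0 0 0 (- be * t) 0 0 0 t (oner_neq0 R) tn.
  rewrite !(mulr0, mul0r, mul1r, mulr1, expr1n) (mulVf tn').
  by rewrite (_ : t^-1 * (- be * t) = - be) //; field.
- by rewrite mulr0; exact: orb_15_rot.
Qed.

Lemma to2_5 be : closure (orb (B (mu5 be))) (B mu2).
Proof.
apply: (@degen_curve _ _ _ (fun t => gfam 1 0 0 0 0 (- be * t) 0 0 0 t)).
- by curve_tac.
- move=> t t0; rewrite bracket_ofE; have tn : t^-1 != 0 by rewrite invr_eq0 gt_eqF.
  have tn' : t != 0 by rewrite gt_eqF.
  have := orb_scale2 1 0 0 0 (- be * t) 0 0 0 t (oner_neq0 R) tn.
  rewrite !(mulr0, mul0r, mul1r, mulr1, expr1n) (mulVf tn').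
  by rewrite (_ : t^-1 * (- be * t) = - be) //; field.
- by rewrite mulr0 bracket_ofE; exact: orb_refl.
Qed.

Lemma to15_6 : closure (orb (B mu6)) (B mu15).
Proof.
apply: (@degen_curve _ _ _ (fun t => gfam 1 0 0 0 1 0 0 0 (- t ^+ 2) 0)).
- by curve_tac.
- move=> t t0; rewrite bracket_ofE; have tn : t^-1 != 0 by rewrite invr_eq0 gt_eqF.
  have tn' : t != 0 by rewrite gt_eqF.
  have := orb_scale2 1 0 0 1 0 0 0 (- t ^+ 2) 0 (oner_neq0 R) tn.
  rewrite !(mulr0, mul0r, mul1r, mulr1, expr1n) divr1.
  by rewrite (_ : t^-1 ^+ 2 * - t ^+ 2 = -1) //; field.
- by rewrite expr0n /= oppr0; exact: orb_15_rot.
Qed.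

Lemma arrow_closure (la lb : label R) : arrow la lb -> closure (orb (B la)) (B lb).
Proof.
have m2 : (-1) ^+ 2 = 1 :> R by rewrite sqrrN expr1n.
have p2 : 1 ^+ 2 = 1 :> R by rewrite expr1n.
case=> [l _|l _|||||||||||||||||||||l h1 h2 h3|d h|d h|a /andP[h1 h2]|b /andP[h1 h2]|d h|d h|||||].
- exact: to15_5.
- exact: to2_5.
- exact: to15_6.
- exact: to15_16.
- exact: to7_16.
- exact: to1_15.
- by apply: (@to12_18_19 _ 1); rewrite bracket_ofE.
- by apply: (@to12_18_19 _ (-1)); rewrite bracket_ofE.
- exact: to17_19.
- apply: (@to7_20 _ 2); [by apply/eqP; lra|by apply/eqP; lra|].
  by rewrite bracket_ofE /= (_ : 1 - 2 = -1 :> R) //; ring.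
- exact: to7_10.
- exact: to11_10.
- exact: to1_11.
- by apply: (to7_8_9 m2); rewrite bracket_ofE /= opprK.
- by apply: (to2_8_9 m2); rewrite bracket_ofE /= opprK.
- by apply: (to7_8_9 p2); rewrite bracket_ofE.
- by apply: (to2_8_9 p2); rewrite bracket_ofE.
- by apply: (to20_23_24 m2); rewrite bracket_ofE /= opprK.
- by apply: (to7_23_24 m2); rewrite bracket_ofE /= opprK.
- by apply: (to20_23_24 p2); rewrite bracket_ofE.
- by apply: (to7_23_24 p2); rewrite bracket_ofE.
- exact: to1_20.
- apply: (@to7_20 _ l); last by rewrite bracket_ofE.
    by rewrite mulf_neq0 ?subr_eq0 //; apply/eqP; lra.
  by rewrite gt_eqF.
- by apply: (@to7_21_22 _ d); rewrite ?gt_eqF // bracket_ofE.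
- by apply: (@to7_21_22 _ (- d)); rewrite ?oppr_eq0 ?gt_eqF // bracket_ofE /= mulNr.
- apply: (@to7_hyp _ (- a^-1)); last by rewrite !bracket_ofE.
  rewrite sqrrN exprVn; apply/eqP => h.
  have : a ^+ 2 = 1 by rewrite -[LHS]invrK h invr1.
  by nra.
- by apply: (@to7_hyp _ b) => //; rewrite lt_eqF // expr2; nra.
- by apply: (to7_13_14 m2 h); rewrite bracket_ofE /= mulrN1 opprK.
- by apply: (to7_13_14 p2 h); rewrite bracket_ofE /= mulr1.
- by apply: (@to7_hyp _ 0); rewrite ?bracket_ofE // expr0n eq_sym oner_neq0.
- exact: to7_4.
- exact: to1_7.
- exact: to1_2.
- exact: to0.
Qed.

End ArrowList.

(** * Levels and the Hasse diagram *)

Section Levels.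
Variable R : realType.
Implicit Types (a b c d s w x y z p q t k l m eta ep al be : R).
Implicit Types (mu nu : bilin R) (la : label R).
Local Notation B := (@bracket_of R).
Local Notation E := (@e R).

Definition ad_cubic p q nu := forall x y z : 'cV[R]_4,
  omega_cn (br nu x (br nu x (br nu x y))) z =
  p * trad nu x * omega_cn (br nu x (br nu x y)) z
  + q * trad nu x ^+ 2 * omega_cn (br nu x y) z.

(** Cubic identities of [ad x]: [T^3 = tr^2 T] for [mu2], [mu7] and [mu11 (-1)];
    [T (T - 1) (T - 1/2)] at trace two for [mu20 2^-1]; [T (T - 1)^2] at trace two for [mu15], where
    [rel_cubic] excludes [mu16]. *)
Definition level2 nu := ad_cubic 0 1 nu \/ ad_cubic (3 / 4) (- 8^-1) nu \/
  (ad_cubic 1 (- 4^-1) nu /\ rel_cubic nu 0 0).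

(** The symplectic dual [h] of the trace form centralises the derived algebra. *)
Definition level3 nu := forall h : 'cV[R]_4,
  (forall z : 'cV[R]_4, omega_cn h z = trad nu z) ->
  forall x y : 'cV[R]_4, br nu (br nu x y) h = 0.

(* The length of the longest descending path in the Hasse diagram. *)
Definition level nu : nat :=
  if `[< rel_abelian nu 0 0 >] then 0 else if `[< rel_two_step nu 0 0 >] then 1 else
  if `[< level2 nu >] then 2 else if `[< level3 nu >] then 3 else 4.

Lemma ad_cubic_orb p q mu nu : orb mu nu -> ad_cubic p q mu -> ad_cubic p q nu.
Proof.
move=> [g gS <-] h; have [gU gP] := gS; do 3 apply: (all_act gU) => ?.
by rewrite !br_actM // !gP trad_act.
Qed.

Lemma level2_orb mu nu : orb mu nu -> level2 mu -> level2 nu.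
Proof.
move=> h [h1|[h1|[h1 h2]]]; [left|right; left|right; right].
- exact: ad_cubic_orb h h1.
- exact: ad_cubic_orb h h1.
- by split; [exact: ad_cubic_orb h h1|exact: good_orb (good_cubic R) h h2].
Qed.

Lemma level3_orb mu nu : orb mu nu -> level3 mu -> level3 nu.
Proof.
move=> [g gS <-] h; have [gU gP] := gS.
apply: (all_act gU) => v hv; do 2 apply: (all_act gU) => ?.
rewrite !br_actM // h ?mulmx0 // => z.
by rewrite -gP hv trad_act.
Qed.

Lemma level_orb mu nu : orb mu nu -> level mu = level nu.
Proof.
move=> h; have h' := orb_sym h; rewrite /level.
have -> : `[< rel_abelian mu 0 0 >] = `[< rel_abelian nu 0 0 >].
  by apply: asbool_equiv_eq; split; apply: good_orb => //; exact: good_abelian.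
have -> : `[< rel_two_step mu 0 0 >] = `[< rel_two_step nu 0 0 >].
  by apply: asbool_equiv_eq; split; apply: good_orb => //; exact: good_two_step.
have -> : `[< level2 mu >] = `[< level2 nu >].
  by apply: asbool_equiv_eq; split; exact: level2_orb.
have -> // : `[< level3 mu >] = `[< level3 nu >].
by apply: asbool_equiv_eq; split; exact: level3_orb.
Qed.

Lemma not_abelian nu : ~ rel_two_step nu 0 0 -> `[< rel_abelian nu 0 0 >] = false.
Proof.
by move=> h; apply/asboolPn => h1; apply: h => x y z t; exact: h1.
Qed.

Lemma level_2 nu : ~ rel_two_step nu 0 0 -> level2 nu -> level nu = 2.
Proof.
by move=> h1 h2; rewrite /level not_abelian // (asboolF h1) (asboolT h2).
Qed.

Lemma level_3 nu : ~ rel_two_step nu 0 0 -> ~ level2 nu -> level3 nu -> level nu = 3.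
Proof.
by move=> h1 h2 h3; rewrite /level not_abelian // (asboolF h1) (asboolF h2) (asboolT h3).
Qed.

Lemma level_4 nu : ~ rel_two_step nu 0 0 -> ~ level2 nu -> ~ level3 nu -> level nu = 4.
Proof.
by move=> h1 h2 h3; rewrite /level not_abelian // (asboolF h1) (asboolF h2) (asboolF h3).
Qed.

Lemma not_level2 nu : ~ ad_cubic 0 1 nu -> ~ ad_cubic (3 / 4) (- 8^-1) nu ->
  (ad_cubic 1 (- 4^-1) nu -> rel_cubic nu 0 0 -> False) -> ~ level2 nu.
Proof. by move=> h1 h2 h3 [//|[//|[]]]. Qed.

Lemma level3_fam s a b c d w2 w4 : level3 (fam s a b c d w2 w4).
Proof.
rewrite /fam; apply: all_vec => h1 h2 h3 h4 hh; do 2 apply: all_vec => ? ? ? ?.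
move: (hh (e 2)) (hh (e 4)) (hh (e 3)); rewrite !eE !gfamE => q4 q2 q1.
have {q4} h40 : h4 = 0 by lra.
have {q2} h20 : h2 = 0 by lra.
have {q1} h10 : h1 = 0 by lra.
by rewrite /= vec0 h10 h20 h40; congr vec; ring.
Qed.

Lemma level3_plane s c d w2 w4 u h k : level3 (gfam s 0 0 c d w2 w4 u h k).
Proof.
apply: all_vec => h1 h2 h3 h4 hh; do 2 apply: all_vec => ? ? ? ?.
move: (hh (e 4)) (hh (e 3)); rewrite !eE !gfamE => q2 q1.
have {q2} h20 : h2 = 0 by lra.
have {q1} h10 : h1 = 0 by lra.
by rewrite /= vec0 h10 h20; congr vec; ring.
Qed.

Definition rk la : nat :=
  match la with
  | mu0 => 0 | mu1 => 1
  | mu2 | mu7 | mu15 => 2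
  | mu11 b => if b == -1 then 2 else 3
  | mu20 l => if l == 2^-1 then 2 else 3
  | mu18 | mu19 => 4
  | _ => 3
  end.

Lemma level_bracket0 : level (B mu0) = 0.
Proof.
rewrite /level ifT // bracket_ofE; apply/asboolP.
by do 3 apply: all_vec => ? ? ? ?; rewrite /= /fam !gfamE /=; ring.
Qed.

Lemma level_bracket1 : level (B mu1) = 1.
Proof.
rewrite /level bracket_ofE ifF; last first.
  by apply/asboolPn => /(_ (e 1) (e 2) (e 1)); rewrite /= /fam !eE !gfamE /=; clear; lra.
rewrite ifT //; apply/asboolP.
by do 4 apply: all_vec => ? ? ? ?; rewrite /= /fam !gfamE /=; ring.
Qed.

Ltac witness2 x y z := move=> /(_ x x y z); rewrite /= /fam !eE !gfamE /= => ?; lra.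
Ltac witness x y z := move=> /(_ x y z); rewrite /= /fam !eE !gfamE /= => ?; lra.
Ltac identity := do 3 apply: all_vec => ? ? ? ?; rewrite /= /fam !gfamE /=; field.

Lemma level_bracket2 : level (B mu2) = 2.
Proof.
rewrite bracket_ofE; apply: level_2; first by witness2 (E 1) (E 3) (E 1).
by left; identity.
Qed.

Lemma level_bracket3 : level (B mu3) = 3.
Proof.
rewrite bracket_ofE; apply: level_3; [|apply: not_level2|exact: level3_fam].
- by witness2 (E 1) (E 4) (E 2).
- by witness (E 1) (E 4) (E 2).
- by witness (E 1) (E 4) (E 2).
- by witness (E 1) (E 4) (E 2).
Qed.

Lemma level_bracket4 : level (B mu4) = 3.
Proof.
rewrite bracket_ofE; apply: level_3; [|apply: not_level2|exact: level3_fam].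
- by witness2 (E 1) (E 4) (E 2).
- by witness (E 1) (E 4) (E 4).
- by witness (E 1) (E 4) (E 4).
- by witness (E 1) (E 4) (E 4).
Qed.

Lemma level_bracket5 l : level (B (mu5 l)) = 3.
Proof.
rewrite bracket_ofE; apply: level_3; [|apply: not_level2|exact: level3_plane].
- by witness2 (E 1) (E 3) (E 1).
(* [ad e1] alone satisfies [T^3 = tr^2 T]; at [e1 + e2] the eigenvalue is still [1] but the trace is
   two. *)
- by witness (vec 1 1 0 0 : 'cV[R]_4) (E 3) (E 1).
- by witness (E 1) (E 3) (E 1).
- by witness (E 1) (E 3) (E 1).
Qed.

Lemma level_bracket6 : level (B mu6) = 3.
Proof.
rewrite bracket_ofE; apply: level_3; [|apply: not_level2|exact: level3_plane].
- by witness2 (E 1) (E 3) (E 1).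
- by witness (E 2) (E 3) (E 2).
- by witness (E 2) (E 3) (E 2).
- by witness (E 2) (E 3) (E 2).
Qed.

Lemma level_bracket7 : level (B mu7) = 2.
Proof.
rewrite bracket_ofE; apply: level_2; first by witness2 (E 1) (E 2) (E 1).
by left; identity.
Qed.

Lemma level_bracket8 : level (B mu8) = 3.
Proof.
rewrite bracket_ofE; apply: level_3; [|apply: not_level2|exact: level3_fam].
- by witness2 (E 1) (E 3) (E 1).
- by witness (E 1) (E 4) (E 4).
- by witness (E 1) (E 3) (E 1).
- by witness (E 1) (E 3) (E 1).
Qed.

Lemma level_bracket9 : level (B mu9) = 3.
Proof.
rewrite bracket_ofE; apply: level_3; [|apply: not_level2|exact: level3_fam].
- by witness2 (E 1) (E 3) (E 1).
- by witness (E 1) (E 4) (E 4).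
- by witness (E 1) (E 3) (E 1).
- by witness (E 1) (E 3) (E 1).
Qed.

Lemma level_bracket10 : level (B mu10) = 3.
Proof.
rewrite bracket_ofE; apply: level_3; [|apply: not_level2|exact: level3_fam].
- by witness2 (E 1) (E 3) (E 1).
- by witness (E 1) (E 4) (E 1).
- by witness (E 1) (E 3) (E 1).
- by witness (E 1) (E 3) (E 1).
Qed.

Lemma level_bracket11m : level (B (mu11 (-1))) = 2.
Proof.
rewrite bracket_ofE; apply: level_2; first by witness2 (E 1) (E 3) (E 1).
by left; identity.
Qed.

Lemma level_hyp be : be ^+ 2 != 1 -> level (fam be (-1) 0 0 1 0 0) = 3.
Proof.
move=> b1; apply: level_3; [|apply: not_level2|exact: level3_fam].
- by witness2 (E 1) (E 4) (E 2).
- move=> /(_ (e 1) (e 4) (e 2)); rewrite /= /fam !eE !gfamE /= => h; case/eqP: b1; lra.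
(* The eigenvalues [1] and [-1] together give [q be^2 = 1], impossible since [q] is negative. *)
- move=> h; move: (h (e 1) (e 4) (e 2)) (h (e 1) (e 2) (e 4)).
  by rewrite /= /fam !eE !gfamE /= => h1 h2; have := sqr_ge0 be; lra.
- move=> h; move: (h (e 1) (e 4) (e 2)) (h (e 1) (e 2) (e 4)).
  by rewrite /= /fam !eE !gfamE /= => h1 h2 _; have := sqr_ge0 be; lra.
Qed.

Lemma level_13_14 de : de != 0 -> level (fam 1 0 de (- de) 0 0 0) = 3.
Proof.
move=> d0; have d2 : 0 < de ^+ 2 by rewrite exprn_even_gt0.
apply: level_3; [|apply: not_level2|exact: level3_fam].
- by witness2 (E 1) (E 3) (E 1).
- move=> /(_ (e 1) (e 4) (e 4)); rewrite /= /fam !eE !gfamE /= => h.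
  have : de * (de ^+ 2 + 1) = 0 by move: h; clear; lra.
  by move/eqP; rewrite mulf_eq0 (negPf d0) /= => /eqP; lra.
- by witness (E 1) (E 3) (E 1).
- by witness (E 1) (E 3) (E 1).
Qed.

Lemma level_bracket15 : level (B mu15) = 2.
Proof.
rewrite bracket_ofE; apply: level_2; first by witness2 (E 1) (E 3) (E 1).
right; right; split; first by identity.
by apply: all_vec => ? ? ? ?; rewrite /= /fam /cubic !gfamE /=; ring.
Qed.

Lemma level_bracket16 : level (B mu16) = 3.
Proof.
have c16 := @mu16_cubic R; rewrite bracket_ofE in c16 *.
apply: level_3; [|apply: not_level2|exact: level3_fam].
- by witness2 (E 1) (E 3) (E 1).
- by witness (E 1) (E 3) (E 1).
(* [ad e1] satisfies this identity; adding [e4] creates a Jordan block for the eigenvalue [1]. *)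
- by witness (vec 1 0 0 1 : 'cV[R]_4) (E 2) (E 1).
- by move=> _.
Qed.

Lemma level_20 l : l != 0 -> l != 1 -> l != 2^-1 -> level (fam 1 l 0 0 (1 - l) 0 0) = 3.
Proof.
move=> l0 l1 l2; apply: level_3; [|apply: not_level2|exact: level3_fam].
- by witness2 (E 1) (E 3) (E 1).
- by witness (E 1) (E 3) (E 1).
- move=> /(_ (e 1) (e 2) (e 4)); rewrite /= /fam !eE !gfamE /= => h.
  have : l * (l - 2^-1) * (l - 1) = 0 by move: h; clear; lra.
  by apply/eqP; rewrite !mulf_neq0 ?subr_eq0.
- move=> /(_ (e 1) (e 2) (e 4)); rewrite /= /fam !eE !gfamE /= => h _.
  have : l * (l - 1) ^+ 2 = 0 by move: h; clear; lra.
  by apply/eqP; rewrite !mulf_neq0 ?subr_eq0.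
Qed.

Lemma level_20h : level (B (mu20 2^-1)) = 2.
Proof.
rewrite bracket_ofE; apply: level_2; first by witness2 (E 1) (E 3) (E 1).
by right; left; identity.
Qed.

Lemma level_21_22 de : de != 0 -> level (fam de (de / 2) 1 (-1) (de / 2) 0 0) = 3.
Proof.
move=> d0; have d2 : 0 < de ^+ 2 by rewrite exprn_even_gt0.
apply: level_3; [|apply: not_level2|exact: level3_fam].
- move=> /(_ (e 1) (e 1) (e 3) (e 1)); rewrite /= /fam !eE !gfamE /= => h; lra.
- move=> /(_ (e 1) (e 3) (e 1)); rewrite /= /fam !eE !gfamE /= => h.
  have : de ^+ 3 = 0 by move: h; clear; lra.
  by apply/eqP; rewrite expf_neq0.
- move=> /(_ (e 1) (e 2) (e 2)); rewrite /= /fam !eE !gfamE /= => h; lra.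
- move=> /(_ (e 1) (e 2) (e 2)); rewrite /= /fam !eE !gfamE /= => h _; lra.
Qed.

Lemma level_23_24 b : b != 0 -> level (fam 1 2^-1 b 0 2^-1 0 0) = 3.
Proof.
move=> /eqP b0; apply: level_3; [|apply: not_level2|exact: level3_fam].
- by witness2 (E 1) (E 3) (E 1).
- by witness (E 1) (E 3) (E 1).
- by move=> /(_ (e 1) (e 4) (e 4)); rewrite /= /fam !eE !gfamE /= => h; apply: b0; lra.
- by move=> /(_ (e 1) (e 2) (e 4)); rewrite /= /fam !eE !gfamE /= => h _; lra.
Qed.

Lemma level_18_19 ep : ep != 0 -> level (gfam 2 (-1) 0 0 1 0 0 0 ep 0) = 4.
Proof.
move=> e0; apply: level_4; [|apply: not_level2|].
- by witness2 (E 1) (E 3) (E 1).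
- by witness (E 1) (E 4) (E 2).
- by witness (E 1) (E 2) (E 4).
- by witness (E 1) (E 2) (E 4).
(* The dual of the trace form is [- 2 e3], and it fails to commute with [[e1, e2] = - e2] because
   [[e2, e3] = ep e4]. *)
move=> /(_ (vec 0 0 (-2) 0)) h.
have {h} : br (gfam 2 (-1) 0 0 1 0 0 0 ep 0) (br (gfam 2 (-1) 0 0 1 0 0 0 ep 0) (e 1) (e 2))
    (vec 0 0 (-2) 0) = 0.
  by apply: h; apply: all_vec => ? ? ? ?; rewrite !gfamE; ring.
by rewrite !eE !gfamE /= vec0 => /vec_inj[_ _ _ h1]; case/eqP: e0; move: h1; clear; lra.
Qed.

End Levels.

Section LevelBracket.
Variable R : realType.
Implicit Type la : label R.
Local Notation B := (@bracket_of R).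

Lemma level_bracket la : admissible la -> level (B la) = rk la.
Proof.
case: la => [||||| l |||||| b | a | d | d |||||| l | d | d ||] adm; rewrite [rk _]/=; simpl in adm.
- exact: level_bracket0.
- exact: level_bracket1.
- exact: level_bracket2.
- exact: level_bracket3.
- exact: level_bracket4.
- exact: level_bracket5.
- exact: level_bracket6.
- exact: level_bracket7.
- exact: level_bracket8.
- exact: level_bracket9.
- exact: level_bracket10.
- case: eqP => [->|/eqP bn]; first exact: level_bracket11m.
  rewrite bracket_ofE; apply: level_hyp; case/andP: adm => h1 h2.
  have h3 : -1 < b by rewrite lt_def bn.
  by rewrite lt_eqF // expr2; nra.
- rewrite bracket_ofE; apply: level_hyp; case/andP: adm => h1 h2.
  rewrite sqrrN exprVn; apply/eqP => h.
  have : a ^+ 2 = 1 by rewrite -[LHS]invrK h invr1.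
  by nra.
- by rewrite bracket_ofE; apply: level_13_14; rewrite gt_eqF.
- rewrite bracket_ofE; have dn : - d != 0 by rewrite oppr_eq0 gt_eqF.
  by have := level_13_14 dn; rewrite opprK.
- exact: level_bracket15.
- exact: level_bracket16.
- rewrite bracket_ofE; have -> : bracket_gfam (@mu17 R) = fam 1 2 0 0 (1 - 2) 0 0.
    by rewrite /= (_ : 1 - 2 = -1 :> R) //; ring.
  by apply: level_20; apply/eqP; lra.
- by rewrite bracket_ofE; apply: level_18_19; rewrite oner_neq0.
- by rewrite bracket_ofE; apply: level_18_19; rewrite oppr_eq0 oner_neq0.
- case: adm => h1 h2 h3; case: eqP => [->|/eqP ln]; first exact: level_20h.
  by rewrite bracket_ofE; apply: level_20 => //; apply/eqP; lra.
- by rewrite bracket_ofE; apply: level_21_22; rewrite gt_eqF.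
- rewrite bracket_ofE; have dn : - d != 0 by rewrite oppr_eq0 gt_eqF.
  by have := level_21_22 dn; rewrite mulNr.
- by rewrite bracket_ofE; apply: level_23_24; rewrite oner_neq0.
- by rewrite bracket_ofE; apply: level_23_24; rewrite oppr_eq0 oner_neq0.
Qed.

End LevelBracket.

(** * From labels to orbits: the Hasse diagram *)

Section Hasse.
Variable R : realType.
Implicit Types (mu nu : bilin R) (la lb lc : label R).
Local Notation B := (@bracket_of R).

Lemma arrow_rk la lb : arrow la lb -> [/\ admissible la, admissible lb & rk la = (rk lb).+1].
Proof.
have m1 : (-1 : R) < 1 by lra.
have q1 : (-1 : R) <= (-1 : R) < (1 : R) by rewrite lexx m1.
have q2 : (-1 : R) < (- 2^-1 : R) < (0 : R) by apply/andP; split; lra.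
have q3 : [/\ (2^-1 : R) <= 2^-1, (2^-1 : R) <> 1 & (2^-1 : R) <> 2].
  by split=> //; lra.
case=> [l h|l h|||||||||||||||||||||l h1 h2 h3|d h|d h|a h|b h|d h|d h|||||] /=; rewrite ?eqxx //.
  by rewrite gt_eqF //; split=> //; split=> //; exact: ltW.
by case/andP: h => h1 h2; rewrite gt_eqF // h2 ltW.
Qed.

Lemma chain_inv la lb : chain la lb ->
  la = lb \/ exists2 lc, arrow la lc & chain lc lb.
Proof.
elim=> [x y h|x|x y z h1 IH1 h2 IH2]; [right|by left|].
  by exists y => //; exact: rt_refl.
case: IH1 => [->|[c h3 h4]]; first exact: IH2.
by right; exists c => //; exact: rt_trans h4 h2.
Qed.

Lemma chain_rk la lb : chain la lb -> admissible la ->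
  [/\ admissible lb, closure (orb (B la)) (B lb) & la = lb \/ (rk lb < rk la)%N].
Proof.
elim=> [x y h _|x ax|x y z h1 IH1 h2 IH2 ax].
- have [_ ay ->] := arrow_rk h.
  by split; [exact: ay|exact: arrow_closure|right].
- by split; [exact: ax|exact: closure_refl|left].
have [ay c1 r1] := IH1 ax; have [az c2 r2] := IH2 ay.
split; [exact: az|exact: closure_orb c1 c2|].
case: r1 r2 => [->|r1] [<-|r2]; [by left|by right|by right|right].
exact: ltn_trans r2 r1.
Qed.

Lemma orbit_degenP mu nu : orbit_degen (orb mu) (orb nu) <-> closure (orb mu) nu.
Proof.
split=> [h|h nu' o]; first by apply: h; exact: orb_refl.
by apply: closure_orb h _; apply: subset_closure.
Qed.

Lemma orb_eqP mu nu : orb mu = orb nu <-> orb mu nu.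
Proof. by split=> [->|]; [exact: orb_refl|exact: orb_eq]. Qed.

Lemma level_eq mu nu : orb mu = orb nu -> level mu = level nu.
Proof. by move/orb_eqP/level_orb. Qed.

Lemma chain_proper la lb : chain la lb -> admissible la -> la <> lb ->
  orbit_proper_degen (orb (B la)) (orb (B lb)).
Proof.
move=> h ax n; have [ay c [//|r]] := chain_rk h ax.
split; first exact/orbit_degenP.
by move/level_eq; rewrite !level_bracket // => E; rewrite E ltnn in r.
Qed.

Lemma degen_chain la nu : admissible la -> L_omega R nu ->
  orbit_proper_degen (orb (B la)) (orb nu) ->
  exists lb, [/\ chain la lb, la <> lb & orb nu = orb (B lb)].
Proof.
move=> ax L [/orbit_degenP c n]; have [lb h o] := admissible_limit ax L c.
exists lb; split; [exact: h| |exact: orb_eq].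
by move=> E; apply: n; rewrite E; exact: orb_eq.
Qed.

(** Consecutive arrows share an orbit but perhaps not a label, so the induction carries
    representatives and [level], an invariant of orbits, instead of a chain of labels. *)
Lemma listed_path_degen (P Q : set (bilin R)) : listed_path P Q ->
  exists mu nu, [/\ P = orb mu, Q = orb nu, closure (orb mu) nu & (level nu < level mu)%N].
Proof.
elim=> [x y [a [b [h -> ->]]]|x y z h1 [m [n [-> -> c1 r1]]] h2 [n' [l [E -> c2 r2]]]].
  exists (B a), (B b); split=> //; first exact: arrow_closure.
  by have [aa ab r] := arrow_rk h; rewrite !level_bracket // r.
exists m, l; split=> //; last by apply: ltn_trans r2 _; rewrite -(level_eq E).
apply: closure_orb c1 _; rewrite E; exact: c2.
Qed.

Lemma chain_listed la lb : chain la lb -> la <> lb ->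
  listed_path (orb (B la)) (orb (B lb)).
Proof.
have key x y : chain x y -> x = y \/ listed_path (orb (B x)) (orb (B y)).
  elim=> [x' y' h|x'|x' y' z _ IH1 _ IH2]; [right|by left|].
    by apply: t_step; exists x', y'.
  case: IH1 IH2 => [->|h1] [<-|h2]; [by left|by right|by right|right].
  exact: t_trans h1 h2.
by move=> /key [].
Qed.

End Hasse.

Theorem theoremA (R : realType) (a : label R) (ha : admissible a) :
  (forall O' : set (bilin R), orbit_space R O' ->
     hasse_arrow (orb (bracket_of a)) O' <->
     listed_arrow (orb (bracket_of a)) O')
  /\
  (forall b : label R, admissible b ->
     (closure (orb (bracket_of a)) (bracket_of b) /\
      ~ orb (bracket_of a) (bracket_of b)) <->
     listed_path (orb (bracket_of a)) (orb (bracket_of b))).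
Proof.
split=> [_ [nu L <-]|b hb]; split.
- move=> [pd no]; have [lb [h n E]] := degen_chain ha L pd.
  (* If the first arrow of the chain does not already end at [lb], its target is an orbit strictly
     in between. *)
  have [//|[lc arr h2]] := chain_inv h.
  have [_ ac r] := arrow_rk arr.
  have [E2|n2] := pselect (lc = lb); first by exists a, lb; rewrite -E2 in E *.
  case: no; exists (orb (bracket_of lc)); split.
  + by exists (bracket_of lc) => //; exact: L_omega_bracket.
  + apply: chain_proper ha _; first exact: rt_step.
    by move=> E2; move: r; rewrite -E2 => /eqP; rewrite eqn_leq ltnn andbF.
  + by rewrite E; exact: chain_proper.
- move=> [a' [b' [arr -> ->]]]; have [aa ab r] := arrow_rk arr.
  split.
    apply: chain_proper aa _; first exact: rt_step.
    by move=> E2; move: r; rewrite -E2 => /eqP; rewrite eqn_leq ltnn andbF.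
  (* An intermediate orbit would have a label of rank strictly between [rk b'] and
     [rk a' = (rk b').+1]. The target may reappear as a label [ld] other than [b'], but of equal
     level. *)
  move=> [_ [[mu Lm <-] pd1 pd2]].
  have [lc [h1 n1 E1]] := degen_chain aa Lm pd1; rewrite E1 in pd2.
  have [ac _ [//|r1]] := chain_rk h1 aa.
  have [ld [h2 n2 E2]] := degen_chain ac (L_omega_bracket b') pd2.
  have [ad _ [//|r2]] := chain_rk h2 ac.
  have := level_eq E2; rewrite !level_bracket // => E3.
  by rewrite r ltnS in r1; move: (leq_trans r2 r1); rewrite E3 ltnn.
- move=> [c n]; have pd : orbit_proper_degen (orb (bracket_of a)) (orb (bracket_of b)).
    split; first exact/orbit_degenP.
    by move=> E; apply: n; rewrite -E; exact: orb_refl.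
  have [lb [h n' E]] := degen_chain ha (L_omega_bracket b) pd.
  by rewrite E; exact: chain_listed.
- move=> /listed_path_degen [mu [nu [E1 E2 c r]]]; split.
    rewrite E1; apply: closure_orb c _; rewrite -E2; exact: closure_refl.
  move=> /orb_eqP; rewrite E1 E2 => /level_eq E3.
  by rewrite E3 ltnn in r.
Qed.
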